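(* For each $N\ge 2$ let $M=M(N)$ be an integer with $M\ge N$, and let $\mathscr{O}_{1,1}$ be the diagonal overlap associated with the eigenvalue $\lambda_1$ of a matrix distributed according to the truncated unitary ensemble $\mathrm{TUE}(N,M)$. Then, conditionally on $\{\lambda_1=0\}$, $$\frac1N\,\mathscr{O}_{1,1}\ \xrightarrow[N\to\infty]{d}\ \frac1{\gamma_2},$$ where $\gamma_2$ is a random variable with density $te^{-t}\mathbf{1}_{t>0}$.
   Context: $\mathrm{TUE}(N,M)$ is the law of the top-left $N\times N$ block $G$ of a Haar-distributed unitary matrix of size $N+M$; throughout $N\le M$. The spectrum is almost surely simple; the eigenvalues $\lambda_1,\dots,\lambda_N$ are labelled exchangeably (uniformly random labelling). Overlaps: for a matrix $G$ with simple spectrum, let $R_j$ be right eigenvectors (columns) and $L_j$ left eigenvectors (rows) with $GR_j=\lambda_jR_j$, $L_jG=\lambda_jL_j$, $L_iR_j=\delta_{ij}$. Then $\mathscr{O}_{i,j}=(L_iL_j^* )(R_j^*R_i)$; this does not depend on the choice of such eigenvectors and is invariant under unitary change of basis. Schur form and conditioning: $G$ can be written $G=UTU^*$ with $U$ unitary (suitably chosen at random) and $T$ upper triangular with diagonal $(\lambda_1,\dots,\lambda_N)$, such that $T$ has density proportional to $\prod_{i<j}|\lambda_i-\lambda_j|^2\det(I_N-TT^* )^{M-N}\mathbf{1}_{TT^*<1}$ with respect to Lebesgue measure on all diagonal and strictly upper-triangular complex entries ($TT^*<1$ means $I_N-TT^*$ is positive definite). The overlaps of $G$ equal those of $T$.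 Conditioning on $\{\lambda_1=0\}$ means taking the law of $T$ obtained by setting $T_{1,1}=0$ in this density and renormalizing. *)

(* Defs.v *)
From HB Require Import structures.
From mathcomp Require Import all_boot all_order all_algebra.
From mathcomp Require Import all_classical all_reals all_analysis.
From mathcomp Require Import complex.

Set Implicit Arguments.
Unset Strict Implicit.
Unset Printing Implicit Defensive.
Import Order.TTheory GRing.Theory Num.Theory.
Import numFieldNormedType.Exports.
Local Open Scope classical_set_scope.
Local Open Scope ring_scope.
Local Open Scope sesquilinear_scope.

(* A copy of \x: the sigma-finiteness instance that the library declares for
   m1 \x m2 is masked by the one for subprobabilities. *)
Section prod_measure.
Context d1 d2 (T1 : measurableType d1) (T2 : measurableType d2) (R : realType).
Variable m1 : {sigma_finite_measure set T1 -> \bar R}.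
Variable m2 : {sigma_finite_measure set T2 -> \bar R}.

Definition prod_measure : set (T1 * T2) -> \bar R := (m1 \x m2)%E.

HB.instance Definition _ := Measure.on prod_measure.

Let prod_measure_sigma_finite : sigma_finite setT prod_measure.
Proof.
have /sigma_finiteP[F [TF ndF Foo]] := sigma_finiteT m1.
have /sigma_finiteP[G [TG ndG Goo]] := sigma_finiteT m2.
exists (fun n => F n `*` G n).
  rewrite -setXTT TF TG predeqE => -[x y]; split.
    move=> [/= [n _ Fnx] [k _ Gky]]; exists (maxn n k) => //; split.
    - by move: x Fnx; exact/subsetPset/ndF/leq_maxl.
    - by move: y Gky; exact/subsetPset/ndG/leq_maxr.
  by move=> [n _ []/= ? ?]; split; exists n.
move=> k; have [? ?] := Foo k; have [? ?] := Goo k.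
split; first exact: measurableX.
by rewrite /prod_measure product_measure1E// lte_mul_pinfty// ge0_fin_numE.
Qed.

HB.instance Definition _ := Measure_isSigmaFinite.Build _ _ _ prod_measure
  prod_measure_sigma_finite.

End prod_measure.

Section power_measure.
Context d (T : measurableType d) (R : realType).
Variable mu : {sigma_finite_measure set T -> \bar R}.

Definition tuple_cons (n : nat) (p : T * n.-tuple T) : n.+1.-tuple T :=
  [tuple of p.1 :: p.2].

Let measurable_tuple_cons n : measurable_fun setT (@tuple_cons n).
Proof. exact: measurable_cons. Qed.

Section cons_measure.
Variables (n : nat) (nu : {sigma_finite_measure set (n.-tuple T) -> \bar R}).

Definition cons_measure : set (n.+1.-tuple T) -> \bar R :=
  pushforward (prod_measure mu nu) (@tuple_cons n).

Let cons_measure0 : cons_measure set0 = 0%E.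
Proof. by rewrite /cons_measure /pushforward preimage_set0 measure0. Qed.

Let cons_measure_ge0 A : (0 <= cons_measure A)%E.
Proof. by rewrite /cons_measure /pushforward measure_ge0. Qed.

Let cons_measure_sigma_additive : semi_sigma_additive cons_measure.
Proof.
have mcons B : measurable B -> measurable (@tuple_cons n @^-1` B).
  by move=> mB; rewrite -[X in measurable X]setTI; exact: measurable_tuple_cons.
move=> F mF tF mUF; rewrite /cons_measure /pushforward preimage_bigcup.
apply: measure_semi_sigma_additive; first by move=> k; exact: mcons.
- apply/trivIsetP => /= i j _ _ ij; rewrite -preimage_setI.
  by move/trivIsetP : tF => /(_ _ _ _ _ ij) ->//; rewrite preimage_set0.
- by rewrite -preimage_bigcup; exact: mcons.
Qed.

HB.instance Definition _ := isMeasure.Build _ _ _ cons_measure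
  cons_measure0 cons_measure_ge0 cons_measure_sigma_additive.

Let cons_measure_sigma_finite : sigma_finite setT cons_measure.
Proof.
have [F FT Foo] := sigma_finiteT (prod_measure mu nu).
pose u (t : n.+1.-tuple T) := (thead t, [tuple of behead t]).
have uK p : u (tuple_cons p) = p.
  by case: p => x s; rewrite /u /tuple_cons /=; congr pair; exact/val_inj.
have mu_ : measurable_fun [set: n.+1.-tuple T] u.
  apply: measurable_fun_pair; first exact: measurable_tnth.
  exact: measurable_behead.
exists (fun k => u @^-1` F k).
  by rewrite -preimage_bigcup -FT preimage_setT.
move=> k; have [mF Fk] := Foo k; split.
  by rewrite -[X in measurable X]setTI; exact: mu_.
rewrite /cons_measure /pushforward.
rewrite (_ : @tuple_cons n @^-1` (u @^-1` F k) = F k)//.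
by apply/seteqP; split=> p /=; rewrite uK.
Qed.

HB.instance Definition _ := Measure_isSigmaFinite.Build _ _ _ cons_measure
  cons_measure_sigma_finite.

End cons_measure.

(* The product measure mu \x ... \x mu on n-tuples. *)
Fixpoint power_measure (n : nat) :
    {sigma_finite_measure set (n.-tuple T) -> \bar R} :=
  match n with
  | 0 => \d_([tuple] : 0.-tuple T)
  | m.+1 => cons_measure (power_measure m)
  end.

End power_measure.

(* R[i] carries no measurable structure in the library: a complex variable is
   represented by the pair of its real and imaginary parts. *)
Definition complex_lebesgue (R : realType) :
    {sigma_finite_measure set (measurableTypeR R * measurableTypeR R)%type -> \bar R} :=
  prod_measure lebesgue_measure lebesgue_measure.

Definition has_density d d' (Omega : measurableType d) (E : measurableType d')
    (R : realType) (P : probability Omega R) (X : {RV P >-> E})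
    (mu : {measure set E -> \bar R}) (f : E -> R) : Prop :=
  forall A : set E, measurable A ->
    distribution P X A = (\int[mu]_(x in A) (f x)%:E)%E.

Definition has_density_propto d d' (Omega : measurableType d)
    (E : measurableType d') (R : realType) (P : probability Omega R)
    (X : {RV P >-> E}) (mu : {measure set E -> \bar R}) (f : E -> R) : Prop :=
  exists c : R, has_density X mu (fun x => c * f x).

(* The value of f at 0 in the density is irrelevant. *)
Definition gamma2_pdf (R : realType) (t : R) : R :=
  if 0 < t then t * expR (- t) else 0.

Definition cvg_in_distribution (R : realType)
    (d : nat -> measure_display) (Omega : forall n, measurableType (d n))
    (P : forall n, probability (Omega n) R) (X : forall n, Omega n -> R)
    (d' : measure_display) (Omega' : measurableType d')
    (Q : probability Omega' R) (Y : Omega' -> R) : Prop :=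
  [/\ forall n, measurable_fun setT (X n),
      measurable_fun setT Y
    & forall f : R -> R, continuous f -> bounded_fun f ->
        ('E_(P n)[f \o X n])%E @[n --> \oo] --> ('E_Q[f \o Y])%E].

Section overlap.
Context (R : realType) (N : nat).
Implicit Types (G : 'M[R[i]]_N) (lam : 'I_N -> R[i]).

Definition biorthogonal_eigenvectors G lam
    (Rv : 'I_N -> 'cV[R[i]]_N) (Lv : 'I_N -> 'rV[R[i]]_N) : Prop :=
  [/\ forall j, G *m Rv j = lam j *: Rv j,
      forall j, Lv j *m G = lam j *: Lv j
    & forall i j, Lv i *m Rv j = (i == j)%:R%:M].

(* The set below is a singleton when lam enumerates a simple spectrum of G;
   otherwise it is empty and the overlap is 0. *)
Definition overlap G lam (i j : 'I_N) : R[i] :=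
  xget 0 [set o | injective lam /\
    exists Rv Lv, biorthogonal_eigenvectors G lam Rv Lv /\
      o = (Lv i *m (Lv j)^t*) 0 0 * ((Rv j)^t* *m Rv i) 0 0].

End overlap.

Section truncated_unitary_schur.
Context (R : realType).

(* In R[i], 0 < z means that z is real and positive; A is then Hermitian. *)
Definition posdefmx N (A : 'M[R[i]]_N) : Prop :=
  forall v : 'rV[R[i]]_N, v != 0 -> 0 < (v *m A *m v^t*) 0 0.

(* Unnormalized. The argument of Re is a real number, seen in R[i]; only the
   case N <= M, where M - N is the exact difference, is meaningful. *)
Definition schur_density N M (T : 'M[R[i]]_N) : R :=
  if `[< posdefmx (1%:M - T *m T^t*) >] then
    complex.Re ((\prod_(i < N) \prod_(j < N | (i < j)%N)
                   `|T i i - T j j| ^+ 2)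
                * \det (1%:M - T *m T^t*) ^+ (M - N))
  else 0.

(* Positions of the upper-triangular entries other than the (0, 0) entry, which
   carries the eigenvalue lambda_1. *)
Definition free_entry N : Type :=
  {p : 'I_N * 'I_N | (p.1 <= p.2)%N && ~~ ((p.1 == 0 :> nat) && (p.2 == 0 :> nat))}.

Definition free_entries N : Type :=
  #|{: free_entry N}|.-tuple (measurableTypeR R * measurableTypeR R)%type.

Definition schur_matrix N (t : free_entries N) : 'M[R[i]]_N :=
  \matrix_(i, j)
    if insub (i, j) : option (free_entry N) is Some e then
      let z := tnth t (enum_rank e) in Complex z.1 z.2
    else 0.

(* T is distributed as the triangular Schur factor of a TUE(N, M) matrix
   conditioned on lambda_1 = 0: T 0 0 = 0, and the remaining upper-triangular
   entries have density proportional to schur_density with T 0 0 set to 0. *)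
Definition conditioned_schur_law N M d (Omega : measurableType d)
    (P : probability Omega R) (T : Omega -> 'M[R[i]]_N) : Prop :=
  exists X : {RV P >-> free_entries N},
    (forall w, T w = schur_matrix (X w)) /\
    has_density_propto X
      (power_measure (complex_lebesgue R) #|{: free_entry N}|)
      (fun t => schur_density M (schur_matrix t)).

End truncated_unitary_schur.

(* Main.v *)
(* Write O for the overlap and lambda_1 = 0, lambda_2, .., lambda_N for the
   diagonal of the triangular matrix T. Then O is the squared norm of the left
   null vector of T with first coordinate 1.

   Let T_n be the top-left n x n block of T, A_n = I - T_n T_n^*, O_n the
   overlap of T_n and t the column of T above lambda_(n+1), so that
   det A_(n+1) = det A_n (1 - |lambda_(n+1)|^2 - t^* A_n^-1 t) and, b being the
   null vector of T_n, O_(n+1) = O_n + |b t|^2 / |lambda_(n+1)|^2. Because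
   b A_n b^* = O_n, integrating out the part of t on which b t does not depend
   leaves a single complex variable z with
   O_(n+1) = O_n (1 + |z|^2 / |lambda_(n+1)|^2) and the weight
   (1 - |lambda_(n+1)|^2 - |z|^2)^(M-2), whatever n is. Hence 1/O becomes the
   product of the ratios |lambda_j|^2 / (|lambda_j|^2 + |z_j|^2).

   These ratios are invariant under rotations of the eigenvalues, so that
   averaging over rotations replaces the squared Vandermonde determinant by a
   sum over permutations s of the products of the |lambda_j|^(2 s(j)),
   s(j) = 1, .., N-1. Each term contributes, up to a constant, the law of a
   product of independent variables with densities proportional to r^e on
   ]0, 1[, e = 1, .., N-1, that is the density proportional to u (1 - u)^(N-2).
   Thus 1/O has this law, for every M, and N/O converges to gamma_2 by
   dominated convergence. *)

Require Import Defs.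
From HB Require Import structures.
From mathcomp Require Import all_boot all_order all_algebra zify.
From mathcomp Require Import all_classical all_reals all_analysis.
From mathcomp Require Import complex ring lra measurable_realfun fingroup perm spectral.
From mathcomp Require cyclic separable cyclotomic.
Set Implicit Arguments.
Unset Strict Implicit.
Unset Printing Implicit Defensive.
Import Order.TTheory GRing.Theory Num.Theory.
Import numFieldNormedType.Exports.
Local Open Scope classical_set_scope.
Local Open Scope ring_scope.

(** * Integrals over the complex plane *)

(** No normalizing constant is evaluated along the way. The identities that reduce the density
    provide a factor [k >= 0] in the extended reals, the same for all nonnegative measurable test
    functions. Such factors are multiplied from stage to stage without any integrability check, and
    nonnegativity lets Tonelli's theorem reorder integrations freely. At the end the constant
    function 1 yields [1 = k * b], which forces both factors to be finite and nonzero.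

    The weight has the same power in every column because integrating out a column releases one
    determinant of the smaller block: the power of that block goes up by one while the height of the
    next column goes down by one.

    The average over rotations is a finite one, over roots of unity of an order larger than all
    exponents. Orthogonality is then an exact finite sum, and no angular variable is introduced.

    The exponents start at 1 because the eigenvalue 0 contributes the squared moduli of all the
    others to the squared Vandermonde determinant. The factor [u] in the density of 1/O, hence the
    index 2 of the gamma law, comes from there. *)

Section lebesgue_affine.
Context (R : realType).
Local Notation leb := (@lebesgue_measure R).
Implicit Types (f : measurableTypeR R -> \bar R).
Local Open Scope ereal_scope.

Let affine (c a : R) (x : measurableTypeR R) : measurableTypeR R := (c * x + a)%R.

Let measurable_affine c a : measurable_fun setT (affine c a).
Proof. by apply: measurable_funD => //; exact: measurable_funM. Qed.

(** Uniqueness of Lebesgue measure: [c] times its image under the affine map gives every interval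
    []u, v]] its length. *)
Lemma ge0_integral_affine (c a : R) f : (0 < c)%R -> measurable_fun setT f ->
  (forall x, 0 <= f x) ->
  \int[leb]_x f (c * x + a)%R = (c^-1)%:E * \int[leb]_x f x.
Proof.
move=> c0 mf f0.
have cV0 : (0 <= c^-1)%R by rewrite invr_ge0 ltW.
rewrite -(@ge0_integral_mscale _ _ _ leb setT measurableT (NngNum cV0) f)//=.
transitivity (\int[pushforward leb (affine c a)]_x f x).
  by rewrite ge0_integral_pushforward.
apply: eq_measure_integral => /= A mA _.
pose nu := mscale (NngNum (ltW c0)) (pushforward leb (affine c a)).
have E : leb A = nu (measurable_affine c a) A.
  apply: lebesgue_measure_unique => // _ [[u v]] _ <- /=.
  rewrite /nu /mscale/= /pushforward.
  have -> : affine c a @^-1` `]u, v] = `](u - a)%R / c, (v - a)%R / c]%classic%R.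
    apply/seteqP; split => x /=; rewrite !in_itv/= /affine ltr_pdivrMr// ler_pdivlMr//;
      by rewrite (mulrC x c) ltrBlDr lerBrDr.
  rewrite !lebesgue_measure_itv/= !lte_fin ltr_pM2r ?invr_gt0// ltrBlDr subrK.
  case: ifP => _; rewrite ?mule0// -EFinD -EFinM; congr EFin.
  by field; rewrite gt_eqF.
rewrite /mscale/= E /nu /mscale/= muleA -EFinM mulVf ?gt_eqF// mul1e.
by [].
Qed.

End lebesgue_affine.

Section complex_lebesgue.
Context (R : realType).
Local Notation CC := (measurableTypeR R * measurableTypeR R)%type.
Local Notation leb := (@lebesgue_measure R).
Local Notation leb2 := (complex_lebesgue R).
Implicit Types (f : CC -> \bar R).
Local Open Scope ereal_scope.

Lemma complex_integralE f : measurable_fun setT f -> (forall z, 0 <= f z) ->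
  \int[leb2]_z f z = \int[leb]_x \int[leb]_y f (x, y).
Proof. by move=> mf f0; exact: (fubini_tonelli1 f). Qed.

Lemma complex_integralE2 f : measurable_fun setT f -> (forall z, 0 <= f z) ->
  \int[leb2]_z f z = \int[leb]_y \int[leb]_x f (x, y).
Proof. by move=> mf f0; exact: (fubini_tonelli2 f). Qed.

Lemma ge0_complex_integral_affine (c a b : R) f : (0 < c)%R ->
  measurable_fun setT f -> (forall z, 0 <= f z) ->
  \int[leb2]_z f (c * z.1 + a, c * z.2 + b)%R = ((c ^+ 2)^-1)%:E * \int[leb2]_z f z.
Proof.
move=> c0 mf f0.
have mg : measurable_fun setT (fun z : CC => f (c * z.1 + a, c * z.2 + b)%R).
  apply: measurableT_comp => //; apply: measurable_fun_pair.
    by apply: measurable_funD => //; exact: measurable_funM.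
  by apply: measurable_funD => //; exact: measurable_funM.
rewrite (complex_integralE mg) => [|z]; last exact: f0.
rewrite (complex_integralE mf f0) /=.
transitivity (\int[leb]_x ((c^-1)%:E * \int[leb]_y f ((c * x + a)%R, y))).
  apply: eq_integral => x _.
  rewrite -(ge0_integral_affine b c0)//.
  by apply: measurableT_comp => //; exact: measurable_fun_pair.
have m1 : measurable_fun setT (fun x : measurableTypeR R => \int[leb]_y f (x, y)).
  exact: (measurable_fun_fubini_tonelli_F f).
rewrite ge0_integralZl; [|by []| | |]; last 3 first.
- apply: (measurableT_comp m1) => //.
  by apply: measurable_funD => //; exact: measurable_funM.
- by move=> x _; exact: integral_ge0.
- by rewrite lee_fin invr_ge0 ltW.
rewrite (ge0_integral_affine a c0 m1); last by move=> x; exact: integral_ge0.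
by rewrite muleA -EFinM -invfM.
Qed.

Let shear1 (k : R) f : measurable_fun setT f -> (forall z, 0 <= f z) ->
  \int[leb2]_z f (z.1 + k * z.2, z.2)%R = \int[leb2]_z f z.
Proof.
move=> mf f0.
have mg : measurable_fun setT (fun z : CC => f (z.1 + k * z.2, z.2)%R).
  apply: measurableT_comp => //; apply: measurable_fun_pair => //.
  by apply: measurable_funD => //; exact: measurable_funM.
rewrite (complex_integralE2 mg) => [|z]; last exact: f0.
rewrite (complex_integralE2 mf f0) /=; apply: eq_integral => y _.
have := @ge0_integral_affine R 1 (k * y)%R (fun x => f (x, y)) ltr01.
rewrite invr1 mul1e => <-//.
  by apply: eq_integral => x _; rewrite mul1r.
by apply: measurableT_comp => //; exact: measurable_fun_pair.
Qed.

Let shear2 (k : R) f : measurable_fun setT f -> (forall z, 0 <= f z) ->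
  \int[leb2]_z f (z.1, z.2 + k * z.1)%R = \int[leb2]_z f z.
Proof.
move=> mf f0.
have mg : measurable_fun setT (fun z : CC => f (z.1, z.2 + k * z.1)%R).
  apply: measurableT_comp => //; apply: measurable_fun_pair => //.
  by apply: measurable_funD => //; exact: measurable_funM.
rewrite (complex_integralE mg) => [|z]; last exact: f0.
rewrite (complex_integralE mf f0) /=; apply: eq_integral => x _.
have := @ge0_integral_affine R 1 (k * x)%R (fun y => f (x, y)) ltr01.
rewrite invr1 mul1e => <-//.
  by apply: eq_integral => y _; rewrite mul1r.
by apply: measurableT_comp => //; exact: measurable_fun_pair.
Qed.

Definition rotate (a b : R) (z : CC) : CC := (a * z.1 - b * z.2, b * z.1 + a * z.2)%R.

Lemma measurable_rotate a b : measurable_fun setT (rotate a b).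
Proof.
apply: measurable_fun_pair.
  by apply: measurable_funB; exact: measurable_funM.
by apply: measurable_funD; exact: measurable_funM.
Qed.

(* A rotation with nonzero sine is a product of three shears. *)
Let rotate_neq0 a b f : b != 0%R -> (a ^+ 2 + b ^+ 2 = 1)%R ->
  measurable_fun setT f -> (forall z, 0 <= f z) ->
  \int[leb2]_z f (rotate a b z) = \int[leb2]_z f z.
Proof.
move=> b0 ab mf f0.
(* With [a] the cosine and [b] the sine of an angle, [k] is minus the tangent of the half angle. *)
pose k := ((a - 1) / b)%R.
have m1 : measurable_fun setT (fun z : CC => f (z.1 + k * z.2, z.2)%R).
  apply: measurableT_comp => //; apply: measurable_fun_pair => //.
  by apply: measurable_funD => //; exact: measurable_funM.
have m2 : measurable_fun setT (fun z : CC => f (z.1 + k * (z.2 + b * z.1), z.2 + b * z.1)%R).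
  have mh : measurable_fun setT (fun z : CC => (z.1, z.2 + b * z.1)%R : CC).
    apply: measurable_fun_pair => //.
    by apply: measurable_funD => //; exact: measurable_funM.
  exact: (measurableT_comp m1 mh).
rewrite -(shear1 k mf f0) -(shear2 b m1) => [|z]; last exact: f0.
rewrite -(shear1 k m2) => [/=|z]; last exact: f0.
have E (x y : R) : (a * x - b * y = x + k * y + k * (y + b * (x + k * y)))%R.
  rewrite (_ : (x + k * y + k * (y + b * (x + k * y)) =
    a * x + (a ^+ 2 - 1) / b * y)%R); last by rewrite /k; field.
  by rewrite -ab; field.
have E' (x y : R) : (b * x + a * y = y + b * (x + k * y))%R by rewrite /k; field.
by apply: eq_integral => -[x y] _; congr (f (_, _)); [exact: E|exact: E'].
Qed.

Lemma ge0_integral_rotate a b f : (a ^+ 2 + b ^+ 2 = 1)%R ->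
  measurable_fun setT f -> (forall z, 0 <= f z) ->
  \int[leb2]_z f (rotate a b z) = \int[leb2]_z f z.
Proof.
have [->|b0] := eqVneq b 0%R; last exact: rotate_neq0.
rewrite expr0n addr0 => /eqP; rewrite sqrf_eq1 => /orP[]/eqP-> mf f0.
  by apply: eq_integral => -[x y] _; rewrite /rotate/= !mul1r !mul0r subr0 add0r.
(* What remains is the half turn, [a = -1] and [b = 0], which is the square of the quarter turn
   [rotate 0 1]. *)
have i0 : (0 ^+ 2 + 1 ^+ 2 = 1 :> R)%R by rewrite expr0n add0r expr1n.
rewrite -[RHS](rotate_neq0 (oner_neq0 _) i0)//.
rewrite -[RHS](rotate_neq0 (oner_neq0 _) i0)//; last first.
  by apply: measurableT_comp => //; exact: measurable_rotate.
apply: eq_integral => -[x y] _; rewrite /rotate/= !mul0r !mul1r; congr (f (_, _)).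
  by rewrite mulN1r subr0 addr0 sub0r.
by rewrite mulN1r addr0.
Qed.

End complex_lebesgue.

Section radial.
Context (R : realType).
Local Notation CC := (measurableTypeR R * measurableTypeR R)%type.
Local Notation leb := (@lebesgue_measure R).
Local Notation leb2 := (complex_lebesgue R).
Local Open Scope ereal_scope.

Definition nrm2 (z : CC) : measurableTypeR R := ((z.1 : R) ^+ 2 + (z.2 : R) ^+ 2)%R.

Lemma nrm2_ge0 z : (0 <= nrm2 z :> R)%R.
Proof. by rewrite addr_ge0 ?sqr_ge0. Qed.

Lemma measurable_nrm2 : measurable_fun setT nrm2.
Proof. by apply: measurable_funD; exact: measurable_funX. Qed.

Lemma ge0_integral_nrm2_scale (g : measurableTypeR R -> \bar R) (x : R) :
  measurable_fun setT g -> (forall r, 0 <= g r) -> (0 < x)%R ->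
  \int[leb2]_z g (nrm2 z / x)%R = x%:E * \int[leb2]_z g (nrm2 z).
Proof.
move=> mg g0 x0.
have s0 : (0 < (Num.sqrt x)^-1)%R by rewrite invr_gt0 sqrtr_gt0.
have mf := measurableT_comp mg measurable_nrm2.
have := ge0_complex_integral_affine 0 0 s0 mf (fun z => g0 (nrm2 z)).
rewrite exprVn sqr_sqrtr ?ltW// invrK => <-.
apply: eq_integral => z _ /=; congr g.
by rewrite /nrm2/= !addr0 !exprMn exprVn sqr_sqrtr ?ltW// -mulrDr mulrC.
Qed.

Let disc := leb2 (nrm2 @^-1` `]-oo, 1%R[).

Let measurable_disc (r : R) : measurable (nrm2 @^-1` `]-oo, r[).
Proof. by rewrite -[X in measurable X]setTI; exact: measurable_nrm2. Qed.

Let disc_fin : disc \is a fin_num.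
Proof.
rewrite ge0_fin_numE ?measure_ge0//.
pose I : set (measurableTypeR R) := `](-1)%R, 1%R[%classic.
have mI : measurable I by exact: measurable_itv.
have : disc <= leb2 (I `*` I).
  apply: le_measure; rewrite ?in_setE//; first exact: measurableX.
  move=> [x y] /=; rewrite in_itv/= /nrm2/= => xy.
  have H (u v : R) : (u ^+ 2 + v ^+ 2 < 1 -> (-1 < u < 1))%R.
    move=> uv; rewrite -ltr_norml -(@expr_lt1 _ 2)// -normrX ger0_norm ?sqr_ge0//.
    by rewrite (le_lt_trans _ uv)// lerDl sqr_ge0.
  by rewrite /I/= !in_itv/=; split; [exact: H xy|apply: (H _ x); rewrite addrC].
move=> /le_lt_trans; apply.
rewrite (_ : leb2 _ = leb I * leb I); last exact: product_measure1E.
by rewrite /I lebesgue_measure_itv/=; case: ifP => _; rewrite ?mule0// -EFinD -EFinM ltry.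
Qed.

Let disc_ge0 : (0 <= fine disc)%R. Proof. by rewrite fine_ge0 ?measure_ge0. Qed.

Let D : set (measurableTypeR R) := `]0%R, +oo[%classic.
Let mD : measurable D. Proof. exact: measurable_itv. Qed.

Let disc_scale (r : R) : (0 < r)%R ->
  leb2 (nrm2 @^-1` `]-oo, r[) = r%:E * disc.
Proof.
move=> r0.
pose g (x : measurableTypeR R) : \bar R := (\1_(`]-oo, 1%R[ : set R) x)%:E.
have mg : measurable_fun setT g by apply/measurable_EFinP; exact: measurable_indic.
have := ge0_integral_nrm2_scale mg (fun x => _) r0.
have -> : \int[leb2]_z g (nrm2 z) = disc.
  rewrite /g (_ : (fun z => _) = fun z => (\1_(nrm2 @^-1` `]-oo, 1%R[) z)%:E)//.
  by rewrite integral_indic ?setIT.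
have -> : \int[leb2]_z g (nrm2 z / r)%R = leb2 (nrm2 @^-1` `]-oo, r[).
  rewrite /g (_ : (fun z => _) = fun z => (\1_(nrm2 @^-1` `]-oo, r[) z)%:E).
    by rewrite integral_indic ?setIT.
  apply/funext => z; rewrite !indicE; congr ((nat_of_bool _)%:R%:E); apply/idP/idP;
    by rewrite !in_setE/= !in_itv/= ltr_pdivrMr// mul1r.
by apply => x; rewrite lee_fin.
Qed.

Let mnrm2 := measurable_nrm2.

Let nrm2_law (A : set (measurableTypeR R)) : measurable A ->
  leb2 (nrm2 @^-1` A) = (fine disc)%:E * leb (A `&` D).
Proof.
pose nu : {measure set (measurableTypeR R) -> \bar R} := pushforward leb2 nrm2.
pose mu := mscale (NngNum disc_ge0) (mrestr leb mD).
move=> mA.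
have := @measure_unique _ R (measurableTypeR R) (@RGenInftyO.G R)
  (fun n => `]-oo, n%:R[%classic) _ _ _ _ (nu mnrm2) mu.
rewrite /nu /mu /mscale /mrestr /pushforward/=; apply => //.
- exact: RGenInftyO.measurableE.
- move=> _ _ [x ->] [y ->]; exists (Num.min x y).
  by apply/seteqP; split => z /=; rewrite !in_itv/= lt_min; [move=> [-> ->]|move=> /andP].
- by move=> i; exists i%:R.
- rewrite -subTset => x _; exists (Num.bound `|x : R|) => //=.
  by rewrite in_itv/= (le_lt_trans (ler_norm (x : R)))// archi_boundP.
- move=> _ [x ->]; rewrite /mscale /pushforward/= /mrestr.
  have [x0|x0] := ltP 0%R x.
    rewrite disc_scale// muleC fineK//; congr (_ * _).
    rewrite (_ : _ `&` _ = `]0%R, x[%classic); last first.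
      by apply/seteqP; split => z /=; rewrite /D/= !in_itv/= andbT; [move=> [-> ->]|move=> /andP[]].
    by rewrite lebesgue_measure_itv/= lte_fin x0 oppr0 adde0.
  rewrite (_ : _ @^-1` _ = set0).
    rewrite (_ : _ `&` _ = set0) ?measure0 ?mule0//.
    rewrite -subset0 => z [] /=; rewrite /D/= !in_itv/= andbT => zx z0.
    by have := lt_trans z0 zx; rewrite ltNge x0.
  rewrite -subset0 => z /=; rewrite in_itv/= => zx.
  by have := le_lt_trans (nrm2_ge0 z) zx; rewrite ltNge x0.
- rewrite /pushforward; case=> [|n]; last by rewrite disc_scale// -(fineK disc_fin) -EFinM ltry.
  rewrite (_ : _ @^-1` _ = set0) ?measure0//.
  rewrite -subset0 => z /=; rewrite in_itv/= => zx.
  by have := le_lt_trans (nrm2_ge0 z) zx; rewrite ltxx.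
Qed.

(* The image of Lebesgue measure on C under |z|^2 scales linearly, hence is a
   multiple of Lebesgue measure on the half-line. *)
Lemma ge0_integral_nrm2 : exists2 k : \bar R, 0 <= k &
  forall g : measurableTypeR R -> \bar R,
    measurable_fun setT g -> (forall r, 0 <= g r) ->
  \int[leb2]_z g (nrm2 z) = k * \int[leb]_(x in D) g x.
Proof.
exists (fine disc)%:E; first by rewrite lee_fin.
move=> g mg g0.
transitivity (\int[pushforward leb2 nrm2]_x g x).
  by rewrite ge0_integral_pushforward.
have mDC : measurable (~` D) by exact: measurableC.
pose nu : {measure set (measurableTypeR R) -> \bar R} := pushforward leb2 nrm2.
have -> : \int[pushforward leb2 nrm2]_x g x =
    \int[nu mnrm2]_(x in setT `\` ~` D) g x.
  rewrite -ge0_negligible_integral//.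
  by rewrite /nu/= /pushforward nrm2_law// setICl measure0 mule0.
rewrite setTD setCK.
rewrite -(@ge0_integral_mscale _ _ _ leb D mD (NngNum disc_ge0) g)//; last exact: measurable_funTS.
apply: eq_measure_integral => A mA AD.
by rewrite /nu/= /pushforward nrm2_law// /mscale/= setIidl.
Qed.

End radial.

Section measurable_operations.
Context (R : realType) d (T : measurableType d).
Implicit Types f g : T -> R.

Lemma measurable_inv f : measurable_fun setT f -> measurable_fun setT (fun t => (f t)^-1).
Proof.
move=> mf.
(* Where [f] vanishes both sides are 0, the inverse of 0 being 0; elsewhere this is
   [x^-1 = x * (x^2)^-1]. *)
have -> : (fun t => (f t)^-1) = (fun t => f t * ((f t ^+ 2) `^ (-1))).
  apply/funext => t; rewrite powR_inv1 ?sqr_ge0//.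
  have [->|f0] := eqVneq (f t) 0; first by rewrite invr0 mul0r.
  by rewrite expr2 invfM mulrA mulfV// mul1r.
apply: measurable_funM => //.
apply: (measurableT_comp (measurable_powR _)).
exact: measurable_funX.
Qed.

Lemma measurable_if_lt f g (h k : T -> R) : measurable_fun setT f ->
  measurable_fun setT g -> measurable_fun setT h -> measurable_fun setT k ->
  measurable_fun setT (fun t => if f t < g t then h t else k t).
Proof. by move=> mf mg mh mk; apply: measurable_fun_ifT => //; exact: measurable_fun_ltr. Qed.

Lemma measurable_nat_of_bool (b : T -> bool) : measurable_fun setT b ->
  measurable_fun setT (fun t => (b t)%:R : R).
Proof.
move=> mb; rewrite (_ : (fun t => _) = fun t => if b t then 1 else 0); last first.
  by apply/funext => t; case: (b t).
exact: measurable_fun_ifT.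
Qed.

End measurable_operations.

Lemma measurable_gt (R : realType) (a : R) :
  measurable_fun setT (fun x : measurableTypeR R => (a < (x : R))%R).
Proof. by apply: (@measurable_fun_ltr _ _ R _ (cst a) id). Qed.

Ltac mstep := first
 [ assumption
 | match goal with
   | |- measurable_fun _ (fun x => (_%:E * _)%E) => apply: emeasurable_funM
   | |- measurable_fun _ (fun x => (_ * _)%E) => apply: emeasurable_funM
   | |- measurable_fun _ (fun x => (_)%:E) => apply/measurable_EFinP
   | |- measurable_fun _ (fun x => (_ + _)%R) => apply: measurable_funD
   | |- measurable_fun _ (fun x => (- _)%R) => apply: measurable_funN
   | |- measurable_fun _ (fun x => (_ * _)%R) => apply: measurable_funM
   | |- measurable_fun _ (fun x => (_ ^-1)%R) => apply: measurable_inv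
   | |- measurable_fun _ (fun x => (_ ^+ _)%R) => apply: measurable_funX
   | |- measurable_fun _ (fun x => (if (_ < _)%R then _ else _)) => apply: measurable_if_lt
   | |- measurable_fun _ (fun x => (nat_of_bool _)%:R) => apply: measurable_nat_of_bool
   | |- measurable_fun _ (fun x => _ && _) => apply: measurable_and
   | |- measurable_fun _ (fun x => (_ < _)%R) => apply: measurable_fun_ltr
   | |- measurable_fun _ (fun x => (_, _)) => apply: measurable_fun_pair
   | |- measurable_fun _ (fun x => (_).1) => apply: (measurableT_comp measurable_fst)
   | |- measurable_fun _ (fun x => (_).2) => apply: (measurableT_comp measurable_snd)
   end
 | by []
 | exact: measurable_gt | exact: measurable_id | exact: measurable_cst
 | exact: measurable_fst | exact: measurable_snd ].
Ltac msolve := repeat mstep.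

Section truncated_power.
Context (R : realType).
Local Notation CC := (measurableTypeR R * measurableTypeR R)%type.
Local Notation leb := (@lebesgue_measure R).
Local Notation leb2 := (complex_lebesgue R).
Local Open Scope ereal_scope.

(** The strict test keeps the support condition when [p = 0], which occurs for [M = N]: the
    constraint and the weight are carried by one function. *)
Definition pospow (p : nat) (r : R) : R := if (0 < r)%R then (r ^+ p)%R else 0%R.

Lemma pospow_ge0 p r : (0 <= pospow p r)%R.
Proof. by rewrite /pospow; case: ifP => // r0; rewrite exprn_ge0// ltW. Qed.

Lemma measurable_pospow p : measurable_fun setT (pospow p).
Proof. rewrite /pospow; msolve. Qed.

Lemma pospowM p (r s : R) : (0 < r)%R -> pospow p (r * s)%R = (r ^+ p * pospow p s)%R.
Proof.
by move=> r0; rewrite /pospow pmulr_rgt0//; case: ifP => _; rewrite ?mulr0// exprMn.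
Qed.

(** Translating the centre [l] to 0 and scaling by the square root of [d] extracts [d^-1]; scaling
    by the square root of [r] then extracts [r ^+ p.+1], one power more than [p] because the real
    dimension is two. *)
Lemma ge0_integral_pospow (p : nat) : exists2 k : \bar R, 0 <= k &
  forall (r d : R) (l : CC), (0 < d)%R ->
  \int[leb2]_z (pospow p (r - d * nrm2 (z.1 - l.1, z.2 - l.2)%R)%R)%:E =
  (d^-1 * pospow p.+1 r)%:E * k.
Proof.
pose g (x : measurableTypeR R) := (pospow p (1 - (x : R)))%:E.
have mg : measurable_fun setT g.
  apply/measurable_EFinP; apply: (measurableT_comp (measurable_pospow p)); msolve.
have g0 x : 0 <= g x by rewrite lee_fin pospow_ge0.
exists (\int[leb2]_z g (nrm2 z)); first by apply: integral_ge0 => z _; exact: g0.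
move=> r d l d0.
pose f (z : CC) := (pospow p (r - nrm2 z)%R)%:E.
have mf : measurable_fun setT f.
  apply/measurable_EFinP; apply: (measurableT_comp (measurable_pospow p)).
  apply: measurable_funB => //; exact: measurable_nrm2.
have f0 z : 0 <= f z by rewrite lee_fin pospow_ge0.
have s0 : (0 < Num.sqrt d)%R by rewrite sqrtr_gt0.
have := ge0_complex_integral_affine (- Num.sqrt d * l.1)%R (- Num.sqrt d * l.2)%R s0 mf f0.
rewrite sqr_sqrtr ?ltW// => E.
transitivity ((d^-1)%:E * \int[leb2]_z f z).
  rewrite -E; apply: eq_integral => z _; rewrite /f; congr (pospow p (r - _))%:E.
  by rewrite /nrm2/= !mulNr -!mulrBr !exprMn sqr_sqrtr ?ltW// -mulrDr.
rewrite EFinM -muleA; congr (_ * _).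
have [r0|r0] := ltP 0%R r; last first.
  rewrite /pospow ltNge r0/= mul0e; apply: integral0_eq => z _.
  rewrite /f /pospow ifF//; apply/negbTE; rewrite -leNgt subr_le0.
  by rewrite (le_trans r0)// nrm2_ge0.
transitivity (\int[leb2]_z ((r ^+ p)%:E * g (nrm2 z / r)%R)).
  apply: eq_integral => z _; rewrite /f /g -EFinM -pospowM//.
  by rewrite mulrBr mulr1 mulrCA mulfV ?gt_eqF// mulr1.
rewrite ge0_integralZl//; last 2 first.
- apply: (measurableT_comp mg).
  by apply: measurable_funM => //; exact: measurable_nrm2.
- by rewrite lee_fin exprn_ge0// ltW.
by rewrite ge0_integral_nrm2_scale// muleA -EFinM /pospow r0 exprSr.
Qed.

End truncated_power.

Lemma measurable_curry1 d1 d2 d3 (T1 : measurableType d1) (T2 : measurableType d2)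
  (T3 : measurableType d3) (f : T1 -> T2 -> T3) x :
  measurable_fun setT (fun p => f p.1 p.2) -> measurable_fun setT (f x).
Proof. by move=> mf; have := measurableT_comp mf (pair1_measurable x). Qed.

Lemma measurable_curry2 d1 d2 d3 (T1 : measurableType d1) (T2 : measurableType d2)
  (T3 : measurableType d3) (f : T1 -> T2 -> T3) y :
  measurable_fun setT (fun p => f p.1 p.2) -> measurable_fun setT (f^~ y).
Proof. by move=> mf; have := measurableT_comp mf (pair2_measurable y). Qed.

(** * Laws of ratios of squared moduli *)

Section dirichlet_pair.
Context (R : realType).
Local Notation CC := (measurableTypeR R * measurableTypeR R)%type.
Local Notation RR := (measurableTypeR R).
Local Notation leb := (@lebesgue_measure R).
Local Notation leb2 := (complex_lebesgue R).
Local Open Scope ereal_scope.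

Lemma integral_pos_indic (f : RR -> \bar R) :
  \int[leb]_(x in `]0%R, +oo[) f x = \int[leb]_x ((0 < (x : R))%R%:R%:E * f x).
Proof.
rewrite integral_mkcond; apply: eq_integral => x _.
by rewrite patchE mem_setE in_itv/= andbT; case: ifP => xi; rewrite ?mul1e ?mul0e.
Qed.

(** Up to normalization, the mean of [g (o * r)] for a variable [r] with density proportional to
    [r ^+ e] on the unit interval. Multiplying independent variables of this kind amounts to
    composing these operators. *)
Definition pow_average (e : nat) (g : RR -> \bar R) (o : R) : \bar R :=
  \int[leb]_r ((((0 < r) && (r < 1))%R%:R * r ^+ e)%:E * g (o * r)%R).

(** Only [x = nrm2 u] and [y = nrm2 z] matter. The substitution [s = x + y], [r = x / s] has
    Jacobian [s] and separates the variables: [r] keeps the weight [r ^+ e], and [s] contributes the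
    constant [J]. *)
Lemma ge0_integral_dirichlet (e q : nat) : exists2 k : \bar R, 0 <= k &
  forall (g : RR -> \bar R) (o : R), measurable_fun setT g -> (forall r, 0 <= g r) ->
  \int[leb2]_u \int[leb2]_z
     (((nrm2 u : R) ^+ e * pospow q (1 - nrm2 u - nrm2 z))%:E *
      g (o * (nrm2 u / (nrm2 u + nrm2 z)))%R)
  = k * pow_average e g o.
Proof.
have [k k0 kE] := ge0_integral_nrm2 R.
pose J := \int[leb]_s ((((0 < s)%R%:R * s ^+ e.+1 * pospow q (1 - s))%R)%:E).
have J0 : 0 <= J.
  apply: integral_ge0 => s _; rewrite lee_fin; have [s0|] := ltP 0%R (s : R).
    by rewrite mul1r mulr_ge0 ?pospow_ge0// exprn_ge0// ltW.
  by rewrite !mul0r.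
exists (k * k * J); first by rewrite !mule_ge0.
move=> g o mg g0.
(* The absolute value makes the integrand nonnegative on the whole line; it disappears once [x] is a
   squared modulus. *)
pose f (x y : RR) : \bar R :=
  (`|x : R| ^+ e * pospow q (1 - x - y))%:E * g (o * (x / (x + y)))%R.
have mf : measurable_fun setT (fun p : RR * RR => f p.1 p.2).
  rewrite /f; msolve; last by apply: (measurableT_comp mg); msolve.
    by apply: measurableT_comp => //; exact: measurable_fst.
  by apply: (measurableT_comp (measurable_pospow q)); msolve.
have f0 x y : 0 <= f x y by rewrite mule_ge0// lee_fin mulr_ge0 ?pospow_ge0 ?exprn_ge0.
have mfx x : measurable_fun setT (f x).
  exact: measurable_curry1.
pose phi (s x : RR) : \bar R :=
  (((0 < x) && (x < s))%R%:R * `|x : R| ^+ e * pospow q (1 - s))%:E * g (o * (x / s))%R.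
have mphi : measurable_fun setT (fun p : RR * RR => phi p.1 p.2).
  rewrite /phi; msolve; last by apply: (measurableT_comp mg); msolve.
    by apply: measurableT_comp => //; exact: measurable_snd.
  by apply: (measurableT_comp (measurable_pospow q)); msolve.
have phi0 s x : 0 <= phi s x.
  by rewrite /phi mule_ge0// lee_fin !mulr_ge0 ?pospow_ge0 ?exprn_ge0.
have mphis s : measurable_fun setT (phi s).
  exact: measurable_curry1.
have mphix x : measurable_fun setT (phi^~ x).
  exact: measurable_curry2.
pose h (x : RR) := \int[leb]_(y in `]0%R, +oo[) f x y.
have E1 u : \int[leb2]_z (((nrm2 u : R) ^+ e * pospow q (1 - nrm2 u - nrm2 z))%:E *
      g (o * (nrm2 u / (nrm2 u + nrm2 z)))%R) =
    k * h (nrm2 u).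
  rewrite -(kE _ (mfx (nrm2 u)) (f0 _)); apply: eq_integral => z _.
  by rewrite /f ger0_norm ?nrm2_ge0.
under eq_integral do rewrite E1.
have h0 x : 0 <= h x by apply: integral_ge0 => y _; exact: f0.
have mh : measurable_fun setT h.
  rewrite /h; under eq_fun do rewrite integral_pos_indic.
  have := measurable_fun_fubini_tonelli_F (m2 := leb)
     (fun p : RR * RR => (0 < (p.2 : R))%R%:R%:E * f p.1 p.2).
  apply; last by move=> p; rewrite mule_ge0// lee_fin.
  apply: emeasurable_funM => //; apply/measurable_EFinP.
  msolve.
rewrite ge0_integralZl//; last exact: (measurableT_comp mh (@measurable_nrm2 R)).
rewrite (kE h mh h0) -!muleA; congr (_ * (_ * _)).
transitivity (\int[leb]_x \int[leb]_s phi s x).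
  rewrite integral_pos_indic; apply: eq_integral => x _.
  rewrite /h integral_pos_indic.
  have [x0|x0] := ltP 0%R (x : R); last first.
    rewrite mul0e integral0_eq// => s _.
    by rewrite /phi ltNge x0/= !mul0r mul0e.
  rewrite mul1e.
  have := @ge0_integral_affine R 1 (- x)%R
    (fun y => (0 < (y : R))%R%:R%:E * f x y) ltr01.
  rewrite invr1 mul1e => <-; last 2 first.
  - apply: emeasurable_funM => //; apply/measurable_EFinP.
    msolve.
  - by move=> y; rewrite mule_ge0// lee_fin.
  apply: eq_integral => s _; rewrite mul1r subr_gt0 /f /phi x0/=.
  by rewrite subrKC opprB addrA subrK !EFinM !muleA.
have := fubini_tonelli (m1 := leb) (m2 := leb) (fun p : RR * RR => phi p.1 p.2) mphi
  (fun p => phi0 p.1 p.2).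
move=> /= <-.
have pa0 : 0 <= pow_average e g o.
  apply: integral_ge0 => r _; rewrite mule_ge0// lee_fin.
  by have [r0|] := ltP 0%R (r : R); rewrite ?mul0r// mulr_ge0// exprn_ge0// ltW.
rewrite muleC -ge0_integralZl//; last 2 first.
- apply/measurable_EFinP; msolve.
  by apply: (measurableT_comp (measurable_pospow q)); msolve.
- move=> s _; rewrite lee_fin mulr_ge0 ?pospow_ge0//.
  by have [s0|] := ltP 0%R (s : R); rewrite ?mul0r// mul1r exprn_ge0// ltW.
apply: eq_integral => s _.
have [s0|s0] := ltP 0%R (s : R); last first.
  rewrite !mul0r mule0; apply: integral0_eq => x _.
  rewrite /phi; have [x0|] := ltP 0%R (x : R); last by rewrite !mul0r mul0e.
  by rewrite ltNge (le_trans s0 (ltW x0))/= !mul0r mul0e.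
have := @ge0_integral_affine R s 0%R (phi s) s0 (mphis s) (phi0 s).
move=> /(congr1 (fun t => s%:E * t)).
rewrite muleA -EFinM mulfV ?gt_eqF// mul1e => <-.
rewrite -ge0_integralZl//; last 2 first.
- apply: (measurableT_comp (mphis s)); msolve.
- by rewrite lee_fin ltW.
rewrite [RHS]muleC /pow_average -ge0_integralZl//; last 3 first.
- apply: emeasurable_funM; first by apply/measurable_EFinP; msolve.
  by apply: (measurableT_comp mg); msolve.
- move=> r _; rewrite mule_ge0// lee_fin.
  by have [r0|] := ltP 0%R (r : R); rewrite ?mul0r// mulr_ge0// exprn_ge0// ltW.
- by rewrite lee_fin !mulr_ge0 ?pospow_ge0// exprn_ge0// ltW.
apply: eq_integral => r _; rewrite addr0 /phi.
rewrite pmulr_rgt0// gtr_pMr// muleA muleA -!EFinM.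
have -> : (s * r / s = r :> R)%R by rewrite mulrAC mulfV ?gt_eqF// mul1r.
congr (_%:E * _); rewrite normrM exprMn (gtr0_norm s0) exprS.
have [r0|] := ltP 0%R (r : R); last by rewrite !mul0r !mulr0.
by rewrite (gtr0_norm r0)/= mul1r; ring.
Qed.

End dirichlet_pair.

(** * Products of independent power variables *)

Section beta_product.
Context (R : realType).
Local Notation RR := (measurableTypeR R).
Local Notation leb := (@lebesgue_measure R).
Local Open Scope ereal_scope.
Implicit Types (g : RR -> \bar R) (e m : nat) (s : seq nat).

Fixpoint pow_averages s g : RR -> \bar R :=
  if s is e :: s' then pow_average e (pow_averages s' g) else g.

Lemma pow_average_ge0 e g o : (forall r, 0 <= g r) -> 0 <= pow_average e g o.
Proof.
move=> g0; apply: integral_ge0 => r _; rewrite mule_ge0// lee_fin.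
by have [r0|] := ltP 0%R (r : R); rewrite ?mul0r// mulr_ge0// exprn_ge0// ltW.
Qed.

Let measurable_pow_average_in e g : measurable_fun setT g ->
  measurable_fun setT (fun p : RR * RR =>
    (((0 < p.2) && (p.2 < 1))%R%:R * p.2 ^+ e)%:E * g (p.1 * p.2)%R).
Proof. by move=> mg; msolve; apply: (measurableT_comp mg); msolve. Qed.

Lemma measurable_pow_average e g : measurable_fun setT g -> (forall r, 0 <= g r) ->
  measurable_fun setT (pow_average e g).
Proof.
move=> mg g0.
apply: (measurable_fun_fubini_tonelli_F _ (measurable_pow_average_in e mg)) => p.
rewrite mule_ge0// lee_fin/=; case: p => o r /=.
by have [r0|] := ltP 0%R (r : R); rewrite ?mul0r// mulr_ge0// exprn_ge0// ltW.
Qed.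

Lemma pow_averages_ge0 s g : (forall r, 0 <= g r) -> forall o, 0 <= pow_averages s g o.
Proof. by move=> g0; elim: s => //= e s ih o; exact: pow_average_ge0. Qed.

Lemma measurable_pow_averages s g : measurable_fun setT g -> (forall r, 0 <= g r) ->
  measurable_fun setT (pow_averages s g).
Proof.
move=> mg g0; elim: s => //= e s ih; apply: measurable_pow_average => //.
exact: pow_averages_ge0.
Qed.

Lemma pow_averagesM s g (o r : R) :
  pow_averages s g (r * o)%R = pow_averages s (fun x => g (r * x)%R) o.
Proof.
elim: s o => //= e s ih o; apply: eq_integral => x _.
by rewrite -mulrA ih.
Qed.

Lemma pow_averageC e1 e2 g o : measurable_fun setT g -> (forall r, 0 <= g r) ->
  pow_average e1 (pow_average e2 g) o = pow_average e2 (pow_average e1 g) o.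
Proof.
move=> mg g0.
pose w e (x : RR) : R := (((0 < x) && (x < 1))%R%:R * x ^+ e)%R.
have w0 e x : (0 <= w e x)%R.
  by rewrite /w; have [x0|] := ltP 0%R (x : R); rewrite ?mul0r// mulr_ge0// exprn_ge0// ltW.
have E a b : pow_average a (pow_average b g) o =
    \int[leb]_x \int[leb]_y ((w a x)%:E * ((w b y)%:E * g (o * x * y)%R)).
  apply: eq_integral => x _; rewrite -ge0_integralZl//.
  - by msolve; apply: (measurableT_comp mg); msolve.
  - by move=> y _; rewrite mule_ge0// lee_fin w0.
  - by rewrite lee_fin w0.
rewrite !E (fubini_tonelli (fun p : RR * RR =>
  (w e1 p.1)%:E * ((w e2 p.2)%:E * g (o * p.1 * p.2)%R)))/=; last 2 first.
- by rewrite /w; msolve; apply: (measurableT_comp mg); msolve.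
- by move=> p; rewrite !mule_ge0// lee_fin.
apply: eq_integral => x _; apply: eq_integral => y _.
by rewrite muleCA mulrAC.
Qed.

(** Multiplication of the variables is commutative, and Tonelli's theorem exchanges two neighbouring
    averages. This is what identifies the contributions of different permutations of the
    exponents. *)
Lemma pow_averages_perm s1 s2 g o : measurable_fun setT g -> (forall r, 0 <= g r) ->
  perm_eq s1 s2 -> pow_averages s1 g o = pow_averages s2 g o.
Proof.
move=> mg g0; elim: s1 s2 o => [|e s1 ih] s2 o.
  by rewrite perm_sym => /perm_nilP ->.
move=> s12; have es2 : e \in s2 by rewrite -(perm_mem s12) mem_head.
have [t1 [t2 t12]] : exists t1 t2, s2 = t1 ++ e :: t2.
  by case/splitPr: es2 => t1 t2; exists t1, t2.
have {}s12 : perm_eq s1 (t1 ++ t2).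
  by rewrite -(perm_cons e) (perm_trans s12)// t12 -cat1s perm_catCA.
transitivity (pow_averages (e :: t1 ++ t2) g o).
  by rewrite /=; congr pow_average; apply/funext => x; exact: ih.
rewrite t12 /=; elim: t1 o {t12 s12} => //= a t1 ih1 o.
rewrite pow_averageC.
- by congr pow_average; apply/funext => x; exact: ih1.
- exact: measurable_pow_averages.
- exact: pow_averages_ge0.
Qed.

Definition beta_integral e m g : \bar R :=
  \int[leb]_u ((((0 < u) && (u < 1))%R%:R * (u ^+ e * (1 - u) ^+ m))%:E * g u).

Let beta_weight_ge0 e m (u : R) :
  (0 <= ((0 < u) && (u < 1))%R%:R * (u ^+ e * (1 - u) ^+ m))%R.
Proof.
have [/andP[u0 u1]|] := boolP (0 < u < 1)%R; last by rewrite mul0r.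
by rewrite mul1r mulr_ge0// exprn_ge0// ?subr_ge0 ltW.
Qed.

Lemma beta_integral_ge0 e m g : (forall r, 0 <= g r) -> 0 <= beta_integral e m g.
Proof.
by move=> g0; apply: integral_ge0 => u _; rewrite mule_ge0// lee_fin beta_weight_ge0.
Qed.

Lemma measurable_beta_integral e m g : measurable_fun setT g -> (forall r, 0 <= g r) ->
  measurable_fun setT (fun r : RR => beta_integral e m (fun u => g (r * u)%R)).
Proof.
move=> mg g0.
apply: (measurable_fun_fubini_tonelli_F (fun p : RR * RR =>
  (((0 < p.2) && (p.2 < 1))%R%:R * (p.2 ^+ e * (1 - p.2) ^+ m))%:E * g (p.1 * p.2)%R)).
  by msolve; apply: (measurableT_comp mg); msolve.
by move=> p; rewrite mule_ge0// lee_fin beta_weight_ge0.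
Qed.

(* A product of independent variables with densities proportional to
   u^(e+1) (1 - u)^m and y^e has density proportional to u^e (1 - u)^(m+1). *)
Lemma beta_integralS e m : exists2 k : \bar R, 0 <= k &
  forall g, measurable_fun setT g -> (forall r, 0 <= g r) ->
  pow_average e (fun r => beta_integral e.+1 m (fun u => g (r * u)%R)) 1 =
  k * beta_integral e m.+1 g.
Proof.
exists (\int[leb]_t (((0 < t) && (t < 1))%R%:R * (1 - t) ^+ m)%R%:E).
  apply: integral_ge0 => t _; rewrite lee_fin.
  have [t1|] := ltP t 1%R; last by rewrite andbF mul0r.
  by rewrite mulr_ge0// exprn_ge0// subr_ge0 ltW.
move=> g mg g0.
pose b (x : RR) : R := ((0 < x) && (x < 1))%R%:R.
have bE (x : RR) (w : RR -> R) : ((0 < x < 1)%R -> (0 <= w x)%R) -> (0 <= b x * w x)%R.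
  by rewrite /b; have [_ /(_ isT)|] := boolP (0 < (x : R) < 1)%R; rewrite ?mul1r ?mul0r.
have mb : measurable_fun setT b by rewrite /b; msolve.
(* Integrand after the substitution [v = r * u]. For fixed [v], the second substitution
   [u = v + (1 - v) * t] then separates [v] from [t]; its Jacobian [1 - v] supplies the additional
   power. *)
pose psi (u v : RR) : \bar R :=
  (b u * ((0 < v) && (v < u))%R%:R * (`|v : R| ^+ e * `|1 - u : R|%R ^+ m))%:E * g v.
have psi0 u v : 0 <= psi u v.
  by rewrite /psi mule_ge0// lee_fin !mulr_ge0// ?exprn_ge0// /b.
have mpsi : measurable_fun setT (fun p : RR * RR => psi p.1 p.2).
  rewrite /psi; msolve.
  - exact: (measurableT_comp mb measurable_fst).
  - by apply: measurableT_comp => //; exact: measurable_snd.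
  - by apply: measurableT_comp => //; msolve.
  - exact: (measurableT_comp mg measurable_snd).
pose F (r u : RR) : \bar R := (b r * r ^+ e)%:E *
  ((b u * (u ^+ e.+1 * (1 - u) ^+ m))%:E * g (r * u)%R).
have F0 r u : 0 <= F r u.
  rewrite /F !mule_ge0// lee_fin.
    by apply: (bE r (fun r => r ^+ e)%R) => /andP[r0 _]; rewrite exprn_ge0// ltW.
  apply: (bE u (fun u => u ^+ e.+1 * (1 - u) ^+ m)%R) => /andP[u0 u1].
  by rewrite mulr_ge0// exprn_ge0// ?subr_ge0 ltW.
have mF : measurable_fun setT (fun p : RR * RR => F p.1 p.2).
  rewrite /F; msolve.
  - exact: (measurableT_comp mb measurable_fst).
  - exact: (measurableT_comp mb measurable_snd).
  - by apply: (measurableT_comp mg); msolve.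
transitivity (\int[leb]_r \int[leb]_u F r u).
  apply: eq_integral => r _; rewrite mul1r /F -ge0_integralZl//.
  - by msolve; apply: (measurableT_comp mg); msolve.
  - move=> u _; rewrite mule_ge0// lee_fin.
    apply: (bE u (fun u => u ^+ e.+1 * (1 - u) ^+ m)%R) => /andP[u0 u1].
    by rewrite mulr_ge0// exprn_ge0// ?subr_ge0 ltW.
  - rewrite lee_fin.
    by apply: (bE r (fun r => r ^+ e)%R) => /andP[r0 _]; rewrite exprn_ge0// ltW.
rewrite (fubini_tonelli (fun p : RR * RR => F p.1 p.2) mF)/=; last by move=> p; exact: F0.
transitivity (\int[leb]_u \int[leb]_v psi u v).
  apply: eq_integral => u _; rewrite /F /psi /b.
  have [/andP[u0 u1]|] := boolP ((0 < (u : R)) && ((u : R) < 1))%R; last first.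
    move=> _; rewrite !integral0_eq// => x _; first by rewrite !mul0r mul0e.
    by rewrite mul0r mul0e mule0.
  have mv : measurable_fun setT (psi u) by exact: measurable_curry1.
  have := @ge0_integral_affine R u 0%R (psi u) u0 mv (psi0 u).
  move=> /(congr1 (fun t => (u : R)%:E * t)).
  rewrite muleA -EFinM mulfV ?gt_eqF// mul1e.
  rewrite {2}/psi /b u0 u1/= => <-.
  rewrite -ge0_integralZl//; last 2 first.
  - by apply: (measurableT_comp mv); msolve.
  - by rewrite lee_fin ltW.
  apply: eq_integral => r _; rewrite addr0 /psi /b u0 u1/= pmulr_rgt0// gtr_pMr//.
  rewrite (mulrC r u) !muleA -!EFinM; congr (_%:E * _).
  have [r0|] := ltP 0%R (r : R); last by rewrite !(mul0r, mulr0).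
  rewrite normrM (gtr0_norm u0) (gtr0_norm r0) (@ger0_norm _ (1 - u)%R) ?subr_ge0 ?ltW//.
  by rewrite exprMn exprS /=; ring.
rewrite (fubini_tonelli (fun p : RR * RR => psi p.1 p.2) mpsi)/=; last by move=> p; exact: psi0.
rewrite /beta_integral -ge0_integralZl//; last 3 first.
- by msolve.
- move=> u _; rewrite mule_ge0// lee_fin.
  apply: (bE u (fun u => u ^+ e * (1 - u) ^+ m.+1)%R) => /andP[u0 u1].
  by rewrite mulr_ge0// exprn_ge0// ?subr_ge0 ltW.
- apply: integral_ge0 => t _; rewrite lee_fin.
  apply: (bE t (fun t => (1 - t) ^+ m)%R) => /andP[t0 t1].
  by rewrite exprn_ge0// subr_ge0 ltW.
apply: eq_integral => v _.
have [/andP[v0 v1]|] := boolP ((0 < (v : R)) && ((v : R) < 1))%R; last first.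
  move=> v01; rewrite mul0r mul0e mule0; apply: integral0_eq => u _.
  rewrite /psi /b; have [/andP[v0 vu]|] := boolP ((0 < (v : R)) && (v < (u : R)))%R.
    have [/andP[u0 u1]|] := boolP ((0 < (u : R)) && ((u : R) < 1))%R.
      by move: v01; rewrite v0 (lt_trans vu).
    by rewrite !mul0r mul0e.
  by rewrite mulr0 mul0r mul0e.
have v1' : (0 < 1 - v)%R by rewrite subr_gt0.
have := @ge0_integral_affine R (1 - v)%R v (psi^~ v) v1' (measurable_curry2 _ mpsi) (psi0^~ v).
move=> /(congr1 (fun t => (1 - v)%:E * t)).
rewrite muleA -EFinM mulfV ?gt_eqF// mul1e => <-.
rewrite mul1r [RHS]muleC -[RHS]ge0_integralZl//; last 3 first.
- by msolve.
- move=> t _; rewrite lee_fin.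
  apply: (bE t (fun t => (1 - t) ^+ m)%R) => /andP[t0 t1].
  by rewrite exprn_ge0// subr_ge0 ltW.
- by rewrite mule_ge0// lee_fin mulr_ge0// exprn_ge0// ltW.
rewrite -ge0_integralZl//; last 2 first.
- by apply: (measurableT_comp (measurable_curry2 _ mpsi)); msolve.
- by rewrite lee_fin ltW.
apply: eq_integral => t _; rewrite /psi /b v0/=.
rewrite muleA [RHS]muleAC -!EFinM; congr (_%:E * _).
have E : (1 - ((1 - v) * t + v) = (1 - v) * (1 - t))%R by ring.
have -> : ((1 - v) * t + v < 1 = (t < 1))%R.
  by rewrite -subr_gt0 E pmulr_rgt0// subr_gt0.
rewrite ltrDr pmulr_rgt0//.
have [t0|] := ltP 0%R (t : R); last by rewrite !(mul0r, mulr0, andbF).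
have [t1|] := ltP (t : R) 1%R; last by rewrite !(mul0r, mulr0, andbF).
rewrite addr_gt0 ?mulr_gt0//= E normrM (gtr0_norm v0) (gtr0_norm v1').
by rewrite (@gtr0_norm _ (1 - t)%R) ?subr_gt0// exprMn exprS; ring.
Qed.

(** A single factor is the case [m = 0]. Each further exponent is smaller by one than the previous
    ones and enters through [beta_integralS], which lowers the first parameter of the beta weight
    and raises the second. *)
Lemma pow_averages_iota e m : exists2 k : \bar R, 0 <= k &
  forall g, measurable_fun setT g -> (forall r, 0 <= g r) ->
  pow_averages (iota e m.+1) g 1%R = k * beta_integral e m g.
Proof.
elim: m e => [|m ih] e.
  exists 1 => // g mg g0; rewrite mul1e /= /beta_integral.
  by apply: eq_integral => u _; rewrite expr0 mulr1 mul1r.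
have [k k0 kE] := ih e.+1; have [l l0 lE] := beta_integralS e m.
exists (k * l); first by rewrite mule_ge0.
move=> g mg g0; rewrite -muleA -lE//.
have E r : pow_averages (iota e.+1 m.+1) g r =
    k * beta_integral e.+1 m (fun u => g (r * u)%R).
  rewrite -kE//; last by apply: (measurableT_comp mg); msolve.
  by rewrite -pow_averagesM mulr1.
transitivity (pow_average e (fun r => k * beta_integral e.+1 m (fun u => g (r * u)%R)) 1).
  by rewrite -(funext E).
rewrite /pow_average -ge0_integralZl//; last 2 first.
- apply: emeasurable_funM; first by msolve.
  by under eq_fun do rewrite mul1r; exact: measurable_beta_integral.
- move=> r _; rewrite mule_ge0//; last exact: beta_integral_ge0.
  rewrite lee_fin.
  by have [r0|] := ltP 0%R (r : R); rewrite ?mul0r// mulr_ge0// exprn_ge0// ltW.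
by apply: eq_integral => r _; rewrite muleCA.
Qed.
End beta_product.

(** * Iterated integrals over families of coordinates *)

Section iterated_integral.
Context (R : realType) (K : eqType) d (T : measurableType d).
Variable mu : {sigma_finite_measure set T -> \bar R}.
Local Open Scope ereal_scope.
Implicit Types (x y : K -> T) (s : seq K) (F G : (K -> T) -> \bar R).

(* K -> T carries no sigma-algebra when K is infinite: measurability is tested
   along all measurable families of points. *)
Definition pmeasurable d' (E : measurableType d') (F : (K -> T) -> E) : Prop :=
  forall d1 (U : measurableType d1) (x : U -> K -> T),
    (forall k, measurable_fun setT (fun t => x t k)) ->
    measurable_fun setT (fun t => F (x t)).

Definition update x k z : K -> T := fun k' => if k' == k then z else x k'.

(** Coordinates outside [s] are parameters read from [x]. Naming the coordinates by keys turns
    Tonelli's theorem into a permutation of the list [s]. *)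
Fixpoint iint s F x : \bar R :=
  if s is k :: s' then \int[mu]_z iint s' F (update x k z) else F x.

Lemma measurable_update d1 (U : measurableType d1) (x : U -> K -> T) (z : U -> T) k :
  (forall k, measurable_fun setT (fun t => x t k)) -> measurable_fun setT z ->
  forall k', measurable_fun setT (fun t => update (x t) k (z t) k').
Proof. by move=> mx mz k'; rewrite /update; case: eqP. Qed.

Lemma measurable_update_fst d1 (U : measurableType d1) (x : U -> K -> T) k :
  (forall k, measurable_fun setT (fun t => x t k)) ->
  forall k', measurable_fun setT (fun p : U * T => update (x p.1) k p.2 k').
Proof.
move=> mx; apply: measurable_update; last exact: measurable_snd.
by move=> k'; exact: (measurableT_comp (mx k') measurable_fst).
Qed.

Lemma iint_ge0 s F : (forall x, 0 <= F x) -> forall x, 0 <= iint s F x.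
Proof. by move=> F0; elim: s => //= k s ih x; apply: integral_ge0 => z _. Qed.

Lemma pmeasurable_iint s F : pmeasurable F -> (forall x, 0 <= F x) ->
  pmeasurable (iint s F).
Proof.
move=> mF F0; elim: s => //= k s ih d1 U x mx.
apply: (measurable_fun_fubini_tonelli_F (fun p : U * T => iint s F (update (x p.1) k p.2))).
  by apply: (ih _ (U * T)%type (fun p => update (x p.1) k p.2)); exact: measurable_update_fst.
by move=> p; exact: iint_ge0.
Qed.

Lemma measurable_iint_update s F x k : pmeasurable F -> (forall x, 0 <= F x) ->
  measurable_fun setT (fun z => iint s F (update x k z)).
Proof.
move=> mF F0; apply: (@pmeasurable_iint s F mF F0 _ T (fun z => update x k z)).
by apply: (measurable_update (x := fun=> x)) => // k'; exact: measurable_cst.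
Qed.

Lemma iint_cat s1 s2 F x : iint (s1 ++ s2) F x = iint s1 (iint s2 F) x.
Proof. by elim: s1 x => //= k s1 ih x; apply: eq_integral => z _. Qed.

Lemma eq_iint s F G x :
  (forall y, (forall k, k \notin s -> y k = x k) -> F y = G y) ->
  iint s F x = iint s G x.
Proof.
elim: s x => [|k s ih] x FG /=; first exact: FG.
apply: eq_integral => z _; apply: ih => y yx; apply: FG => k'.
by rewrite inE negb_or => /andP[k'k k's]; rewrite yx// /update (negbTE k'k).
Qed.

Lemma iint_agree s F x y : (forall k, k \notin s -> x k = y k) ->
  iint s F x = iint s F y.
Proof.
elim: s x y => [|k s ih] x y xy /=; first by congr F; apply/funext => k; exact: xy.
apply: eq_integral => z _; apply: ih => k' k's; rewrite /update.
by case: eqP => // /eqP k'k; apply: xy; rewrite inE negb_or k'k.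
Qed.

Lemma updateC x k k' z z' : k != k' ->
  update (update x k z) k' z' = update (update x k' z') k z.
Proof.
move=> kk'; apply/funext => l; rewrite /update.
by have [->|//] := eqVneq l k'; rewrite eq_sym (negbTE kk').
Qed.

Lemma iint_swap k k' s F x : pmeasurable F -> (forall x, 0 <= F x) ->
  iint (k :: k' :: s) F x = iint (k' :: k :: s) F x.
Proof.
move=> mF F0; have [<-//|kk'] := eqVneq k k'.
rewrite /= (fubini_tonelli (fun p : T * T => iint s F (update (update x k p.1) k' p.2)))/=.
- by apply: eq_integral => z _; apply: eq_integral => z' _; rewrite updateC.
- apply: (@pmeasurable_iint s F mF F0 _ (T * T)%type
    (fun p => update (update x k p.1) k' p.2)).
  apply: (measurable_update_fst (x := fun t => update x k t)).
  by apply: (measurable_update (x := fun=> x)) => // l; exact: measurable_cst.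
- by move=> p; exact: iint_ge0.
Qed.

Lemma perm_iint s1 s2 F x : pmeasurable F -> (forall x, 0 <= F x) ->
  perm_eq s1 s2 -> iint s1 F x = iint s2 F x.
Proof.
move=> mF F0; elim: s1 s2 x => [|e s1 ih] s2 x.
  by rewrite perm_sym => /perm_nilP ->.
move=> s12; have es2 : e \in s2 by rewrite -(perm_mem s12) mem_head.
have [t1 [t2 t12]] : exists t1 t2, s2 = t1 ++ e :: t2.
  by case/splitPr: es2 => t1 t2; exists t1, t2.
have {}s12 : perm_eq s1 (t1 ++ t2).
  by rewrite -(perm_cons e) (perm_trans s12)// t12 -cat1s perm_catCA.
transitivity (iint (e :: t1 ++ t2) F x); first by apply: eq_integral => z _; exact: ih.
rewrite {}t12; elim: t1 x {s12} => //= a t1 ih1 x.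
rewrite -[LHS]/(iint (e :: a :: t1 ++ t2) F x) iint_swap//.
by apply: eq_integral => z _; exact: ih1.
Qed.

Lemma iintZl s (c : \bar R) F x : pmeasurable F -> (forall x, 0 <= F x) -> 0 <= c ->
  iint s (fun y => c * F y) x = c * iint s F x.
Proof.
move=> mF F0 c0; elim: s x => //= k s ih x.
rewrite -ge0_integralZl//.
- by apply: eq_integral => z _; exact: ih.
- exact: measurable_iint_update.
- by move=> z _; exact: iint_ge0.
Qed.

Lemma iint_sum I (r : seq I) s (F : I -> (K -> T) -> \bar R) x :
  (forall i, pmeasurable (F i)) -> (forall i x, 0 <= F i x) ->
  iint s (fun y => \sum_(i <- r) F i y) x = \sum_(i <- r) iint s (F i) x.
Proof.
move=> mF F0; elim: s x => //= k s ih x.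
rewrite -ge0_integral_sum//.
- by apply: eq_integral => z _; exact: ih.
- by move=> i; exact: measurable_iint_update.
- by move=> i z _; exact: iint_ge0.
Qed.

Lemma iint_map s (phi : K -> T -> T) F x : pmeasurable F -> (forall x, 0 <= F x) ->
  (forall k, measurable_fun setT (phi k)) ->
  (forall k f, measurable_fun setT f -> (forall z, 0 <= f z) ->
     \int[mu]_z f (phi k z) = \int[mu]_z f z) ->
  iint s (fun y => F (fun k => phi k (y k))) x = iint s F (fun k => phi k (x k)).
Proof.
move=> mF F0 mphi phiE; elim: s x => //= k s ih x.
rewrite -[RHS](phiE k); last 2 first.
- exact: measurable_iint_update.
- by move=> z; exact: iint_ge0.
apply: eq_integral => z _; rewrite ih; congr (iint s F _).
by apply/funext => l; rewrite /update; case: eqP => // ->.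
Qed.

(** A key outside [s] has index [size s], past the end of a tuple of that length, so [nth] falls
    back on [x]. *)
Definition fill s x (t : seq T) : K -> T := fun k => nth (x k) t (index k s).

Lemma measurable_fill s x n k : measurable_fun setT (fun t : n.-tuple T => fill s x t k).
Proof.
rewrite /fill; have [kn|kn] := ltnP (index k s) n.
  rewrite (_ : (fun _ => _) = (fun t : n.-tuple T => tnth t (Ordinal kn))).
    exact: measurable_tnth.
  by apply/funext => t; rewrite (tnth_nth (x k)).
rewrite (_ : (fun _ => _) = cst (x k)); first exact: measurable_cst.
by apply/funext => t; rewrite nth_default// size_tuple.
Qed.

Lemma integral_power_measure n s F x : uniq s -> size s = n ->
  pmeasurable F -> (forall x, 0 <= F x) ->
  \int[power_measure mu n]_t F (fill s x t) = iint s F x.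
Proof.
move=> + + mF F0; elim: s n x => [|k s ih] [|n] x //=.
  move=> _ _; rewrite integral_dirac//; last first.
    by apply: mF => l; exact: (measurable_fill [::] x (n := 0)).
  by rewrite diracT mul1e; congr F.
move=> /andP[ks us] [sn].
have mG y : measurable_fun setT (fun t : n.-tuple T => F (fill s y t)).
  by apply: mF => l; exact: measurable_fill.
rewrite -[LHS]/(\int[pushforward (prod_measure mu (power_measure mu n)) (@tuple_cons _ T n)]_t
   F (fill (k :: s) x t)).
rewrite ge0_integral_pushforward//; last 2 first.
- exact: measurable_cons.
- by apply: mF => l; exact: (measurable_fill (k :: s) x (n := n.+1)).
rewrite preimage_setT.
have fE (p : T * n.-tuple T) :
    fill (k :: s) x (tuple_cons p) = fill s (update x k p.1) p.2.
  apply/funext => l; rewrite /fill /tuple_cons /update /=.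
  have [->|//] := eqVneq l k.
  by rewrite /= nth_default// size_tuple memNindex ?sn.
transitivity (\int[(mu \x power_measure mu n)%E]_p F (fill s (update x k p.1) p.2)).
  by apply: eq_integral => p _; rewrite /= fE.
rewrite (fubini_tonelli1 (fun p : T * n.-tuple T => F (fill s (update x k p.1) p.2)))//.
  by apply: eq_integral => z _; rewrite /fubini_F/= ih.
under eq_fun do rewrite -fE.
apply: mF => l.
apply: (measurableT_comp (measurable_fill (k :: s) x (n := n.+1) l)).
exact: measurable_cons.
Qed.

End iterated_integral.

(** * Positive definite matrices *)

Section positive_definite.
Context (C : numClosedFieldType).
Local Open Scope sesquilinear_scope.

Definition posdef n (A : 'M[C]_n) : Prop :=
  forall v : 'rV[C]_n, v != 0 -> 0 < (v *m A *m v^t*) 0 0.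

Lemma adjmxM m n p (A : 'M[C]_(m, n)) (B : 'M[C]_(n, p)) :
  (A *m B)^t* = B^t* *m A^t*.
Proof. by rewrite trmx_mul map_mxM. Qed.

Lemma adjmxD m n (A B : 'M[C]_(m, n)) : (A + B)^t* = A^t* + B^t*.
Proof. by rewrite linearD/= map_mxD. Qed.

Lemma adjmxN m n (A : 'M[C]_(m, n)) : (- A)^t* = - A^t*.
Proof. by rewrite linearN/= map_mxN. Qed.

Lemma adjmxZ m n a (A : 'M[C]_(m, n)) : (a *: A)^t* = a^* *: A^t*.
Proof. by rewrite linearZ/= map_mxZ. Qed.

Lemma adj_scalar_mx n (a : C) : (a%:M : 'M[C]_n)^t* = (a^*)%:M.
Proof. by rewrite tr_scalar_mx map_scalar_mx. Qed.

Lemma adj_row_mx m n1 n2 (A : 'M[C]_(m, n1)) (B : 'M[C]_(m, n2)) :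
  (row_mx A B)^t* = col_mx (A^t*) (B^t*).
Proof. by rewrite tr_row_mx map_col_mx. Qed.

Lemma adj_col_mx m1 m2 n (A : 'M[C]_(m1, n)) (B : 'M[C]_(m2, n)) :
  (col_mx A B)^t* = row_mx (A^t*) (B^t*).
Proof. by rewrite tr_col_mx map_row_mx. Qed.

Lemma adjmx_inv n (A : 'M[C]_n) : (invmx A)^t* = invmx (A^t*).
Proof. by rewrite trmx_inv map_invmx. Qed.

Lemma adjmx11 (A : 'M[C]_1) : A^t* 0 0 = (A 0 0)^*.
Proof. by rewrite !mxE. Qed.

Lemma mul_mx11 (A B : 'M[C]_1) : (A *m B) 0 0 = A 0 0 * B 0 0.
Proof. by rewrite mxE big_ord1. Qed.

Lemma nrm_rV_ge0 n (v : 'rV[C]_n) : 0 <= (v *m v^t*) 0 0.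
Proof. by rewrite mxE; apply: sumr_ge0 => i _; rewrite !mxE mul_conjC_ge0. Qed.

Lemma nrm_rV_gt0 n (v : 'rV[C]_n) : v != 0 -> 0 < (v *m v^t*) 0 0.
Proof.
move=> v0; rewrite lt0r nrm_rV_ge0 andbT mxE.
rewrite psumr_eq0; last by move=> i _; rewrite !mxE mul_conjC_ge0.
apply: contra v0 => /allP v0; apply/eqP/rowP => i.
by have := v0 i (mem_index_enum _); rewrite !mxE mul_conjC_eq0 => /eqP ->.
Qed.

Lemma posdef_scalar1 n : posdef (1%:M : 'M[C]_n).
Proof. by move=> v v0; rewrite mulmx1 nrm_rV_gt0. Qed.

Lemma posdef_unit n (A : 'M[C]_n) : posdef A -> A \in unitmx.
Proof.
move=> pA; rewrite -row_free_unit -kermx_eq0; apply/eqP/row_matrixP => i.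
rewrite row0; apply/eqP/negPn/negP => /pA.
by rewrite -row_mul mulmx_ker row0 mul0mx mxE ltxx.
Qed.

Lemma posdef_conj n (A P : 'M[C]_n) : P \in unitmx -> posdef A -> posdef (P *m A *m P^t*).
Proof.
move=> uP pA v v0; rewrite !mulmxA -mulmxA -adjmxM; apply: pA.
by apply: contra v0 => /eqP vP; rewrite -(mulmxK uP v) vP mul0mx.
Qed.

Lemma hermitian_form_real n (A : 'M[C]_n) (v : 'cV[C]_n) : A^t* = A ->
  (v^t* *m A *m v) 0 0 \is Num.real.
Proof.
by move=> hA; apply/CrealP; rewrite -adjmx11 !adjmxM trmxCK hA mulmxA.
Qed.

Lemma posdef_form_ge0 n (A : 'M[C]_n) (v : 'rV[C]_n) : posdef A ->
  0 <= (v *m A *m v^t*) 0 0.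
Proof.
move=> pA; have [->|/pA/ltW//] := eqVneq v 0.
by rewrite !mul0mx mxE.
Qed.

Lemma det_schur_block n (A : 'M[C]_n) (u : 'cV[C]_n) (w : 'rV[C]_n) (a : 'M[C]_1) :
  A \in unitmx ->
  \det (block_mx A u w a) = \det A * (a 0 0 - (w *m invmx A *m u) 0 0).
Proof.
move=> uA.
have -> : block_mx A u w a =
    block_mx 1%:M 0 (w *m invmx A) 1%:M *m block_mx A u 0 (a - w *m invmx A *m u).
  by rewrite mulmx_block !mul1mx !mul0mx !addr0 mulmxKV// subrKC.
rewrite det_mulmx det_lblock !det1 !mul1r det_ublock; congr (_ * _).
by rewrite [X in \det X]mx11_scalar det_scalar1 !mxE.
Qed.

Section rank_one.
Variables (n : nat) (A : 'M[C]_n) (c : 'cV[C]_n).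

(** The matrix bordered by [c], its adjoint and a corner 1 is reduced in two ways, eliminating
    either the block [A] or the corner. *)
Lemma det_rank_one : A \in unitmx ->
  \det (A - c *m c^t*) = \det A * (1 - (c^t* *m invmx A *m c) 0 0).
Proof.
move=> uA; have := det_schur_block c (c^t*) 1%:M uA; rewrite mxE eqxx => <-.
have -> : block_mx A c (c^t*) 1%:M =
    block_mx (A - c *m c^t*) c 0 1%:M *m block_mx 1%:M 0 (c^t*) 1%:M.
  by rewrite mulmx_block !mulmx1 !mul0mx !mul1mx mulmx0 !add0r subrK.
by rewrite det_mulmx det_ublock det_lblock !det1 !mulr1.
Qed.

Hypothesis hA : A^t* = A.

Let form_rank_one (v : 'rV[C]_n) : (v *m (A - c *m c^t*) *m v^t*) 0 0 =
  (v *m A *m v^t*) 0 0 - `|(v *m c) 0 0| ^+ 2.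
Proof.
rewrite mulmxBr mulmxBl !mulmxA -(mulmxA (v *m c)) -adjmxM mxE [X in _ + X]mxE.
by rewrite mul_mx11 adjmx11 normCK.
Qed.

(* The second condition comes from testing the form on c^* A^-1; conversely,
   it suffices by the Cauchy-Schwarz inequality for the form A. *)
Lemma posdef_rank_one : posdef (A - c *m c^t*) <->
  posdef A /\ (c^t* *m invmx A *m c) 0 0 < 1.
Proof.
split=> [pB|[pA q1] v v0].
  have pA : posdef A.
    move=> v v0; have := pB v v0; rewrite form_rank_one subr_gt0.
    by apply: le_lt_trans; rewrite exprn_ge0.
  split=> //; have uA := posdef_unit pA.
  set w := c^t* *m invmx A.
  have [c0|c0] := eqVneq c 0; first by rewrite c0 mulmx0 mxE ltr01.
  have w0 : w != 0.
    apply: contra c0 => /eqP w0; rewrite -[c]trmxCK -[c^t*](mulmxKV uA) -/w w0 mul0mx.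
    by rewrite trmx0 map_mx0.
  have := pB w w0; rewrite form_rank_one mulmxKV// adjmxM trmxCK adjmx_inv hA mulmxA.
  rewrite -/w; set q := (w *m c) 0 0.
  have qE : (w *m A *m w^t*) 0 0 = q.
    by rewrite /w mulmxKV// adjmxM trmxCK adjmx_inv hA mulmxA.
  have q0 : 0 < q by rewrite -qE; exact: pA.
  by rewrite ger0_norm ?ltW// expr2 -{1}[q]mulr1 -mulrBr pmulr_rgt0// subr_gt0.
have uA := posdef_unit pA.
rewrite form_rank_one subr_gt0.
have [vc0|vc0] := eqVneq ((v *m c) 0 0) 0.
  by rewrite vc0 normr0 expr0n pA.
set w := c^t* *m invmx A; set q := (w *m c) 0 0 in q1 *.
have qE : (w *m A *m w^t*) 0 0 = q.
  by rewrite /w mulmxKV// adjmxM trmxCK adjmx_inv hA mulmxA.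
have c0 : c != 0 by apply: contra vc0 => /eqP ->; rewrite mulmx0 mxE.
have w0 : w != 0.
  apply: contra c0 => /eqP w0; rewrite -[c]trmxCK -[c^t*](mulmxKV uA) -/w w0 mul0mx.
  by rewrite trmx0 map_mx0.
have q0 : 0 < q by rewrite -qE; exact: pA.
(* Coefficient of the orthogonal projection of [v] on [w] for the form [A]: nonnegativity of the
   form at [v - a *: w] is the Cauchy-Schwarz inequality. *)
pose a := (v *m c) 0 0 / q.
have := posdef_form_ge0 (v - a *: w) pA.
have Aw : A *m w^t* = c by rewrite /w adjmxM trmxCK adjmx_inv hA mulKVmx.
have wA : w *m A = c^t* by rewrite /w mulmxKV.
have mxD (X Y : 'M[C]_1) : (X + Y) 0 0 = X 0 0 + Y 0 0 by rewrite mxE.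
have mxN (X : 'M[C]_1) : (- X) 0 0 = - X 0 0 by rewrite mxE.
have mxZ k (X : 'M[C]_1) : (k *: X) 0 0 = k * X 0 0 by rewrite mxE.
rewrite adjmxD adjmxN adjmxZ mulmxDr mulmxN -scalemxAr !mulmxBl.
rewrite -!scalemxAl wA -!(mulmxA v) Aw mulmxA.
rewrite !(mxD, mxN, mxZ) -/q.
have cv : (c^t* *m v^t*) 0 0 = ((v *m c) 0 0)^* by rewrite -adjmxM adjmx11.
have -> : (c^t* *m w^t*) 0 0 = q by rewrite -adjmxM adjmx11 conj_Creal// gtr0_real.
rewrite cv; set s := (v *m c) 0 0 in a *.
have aE : a^* = s^* / q by rewrite /a rmorphM/= fmorphV/= [X in _ / X]conj_Creal// gtr0_real.
have -> : (v *m A *m v^t*) 0 0 - a * s^* - a^* * (s - a * q) = (v *m A *m v^t*) 0 0 - `|s| ^+ 2 / q.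
  by rewrite aE /a divfK ?gt_eqF// subrr mulr0 subr0 normCK mulrAC.
rewrite subr_ge0; apply: lt_le_trans.
by rewrite ltr_pdivlMr// gtr_pMr// exprn_gt0// normr_gt0.
Qed.
End rank_one.

End positive_definite.

(** * Schur complements and inverse forms of leading blocks *)

Section schur_complement.
Context (C : numClosedFieldType).
Local Open Scope sesquilinear_scope.

Section block.
Variables (n : nat) (A : 'M[C]_n) (u : 'cV[C]_n) (a : 'M[C]_1).
Let B : 'M[C]_(n + 1) := block_mx A u (u^t*) a.
Hypotheses (hA : A^t* = A) (pB : posdef B).

Lemma posdef_ulblock : posdef A.
Proof.
move=> v v0; have := @pB (row_mx v 0).
rewrite /B mul_row_block adj_row_mx mul_row_col !mul0mx !addr0.
rewrite trmx0 map_mx0 mulmx0 addr0; apply.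
by apply: contra v0 => /eqP; rewrite -row_mx0 => /eq_row_mx[->].
Qed.

Let uA : A \in unitmx := posdef_unit posdef_ulblock.
Let s := a 0 0 - (u^t* *m invmx A *m u) 0 0.

Lemma schur_complement_gt0 : 0 < s.
Proof.
(* The product of this row with [B] vanishes on the first block, so the form takes the value [s]
   there. *)
have := @pB (row_mx (- (u^t* *m invmx A)) 1%:M).
rewrite /B mul_row_block adj_row_mx mul_row_col adj_scalar_mx conjC1 mulmx1 mul1mx.
rewrite mulNmx mulmxKV// mul1mx addNr mul0mx add0r mulNmx mxE addrC [X in _ + X]mxE; apply.
apply/eqP; rewrite -row_mx0 => /eq_row_mx[_] /matrixP/(_ 0 0)/eqP.
by rewrite !mxE eqxx oner_eq0.
Qed.

(** Block elimination solves the linear system explicitly: the residual of the last coordinate,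
    after its linear prediction from [t], is divided by the Schur complement. *)
Lemma form_schur_complement (t : 'cV[C]_n) (b : 'M[C]_1) :
  ((col_mx t b)^t* *m invmx B *m col_mx t b) 0 0 =
  (t^t* *m invmx A *m t) 0 0 + `|b 0 0 - (u^t* *m invmx A *m t) 0 0| ^+ 2 / s.
Proof.
have uB := posdef_unit pB.
have s0 := schur_complement_gt0.
pose r := b - u^t* *m invmx A *m t.
pose y := s^-1 *: r.
have E : B *m col_mx (invmx A *m (t - u *m y)) y = col_mx t b.
  rewrite /B mul_block_col mulKVmx// subrK; congr col_mx.
  rewrite mulmxA mulmxBr mulmxA -addrA (addrC (- _)).
  have -> : a *m y - u^t* *m invmx A *m u *m y = r.
    rewrite -mulmxBl [X in X *m _]mx11_scalar mul_scalar_mx.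
    have -> : (a - u^t* *m invmx A *m u) 0 0 = s by rewrite mxE [X in _ + X]mxE.
    by rewrite scalerA mulfV ?scale1r ?gt_eqF.
  by rewrite /r subrKC.
rewrite -{2}E -mulmxA mulKmx// adj_col_mx mul_row_col mulmxBr mulmxBr.
rewrite -addrA mxE -mulmxA; congr (_ + _).
rewrite (mulmxA _ _ (u *m y)) (mulmxA _ u) -[X in - X]mulmxA addrC.
have -> : b^t* *m y - t^t* *m invmx A *m (u *m y) = r^t* *m y.
  by rewrite mulmxA -mulmxBl /r adjmxD adjmxN !adjmxM trmxCK adjmx_inv hA mulmxA.
rewrite -scalemxAr mxE mul_mx11 adjmx11 (mulrC (_^*)) -normCK mulrC.
by congr (`|_| ^+ 2 / _); rewrite /r mxE [X in _ + X]mxE.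
Qed.

End block.

(** Entries are indexed by natural numbers so that the leading blocks of all sizes are read off one
    function. *)
Definition mxn n (a : nat -> nat -> C) : 'M[C]_n := \matrix_(i, j) a i j.
Definition cvn n (t : nat -> C) : 'cV[C]_n := \col_i t i.

Lemma mxn_block n a :
  mxn (n + 1) a = block_mx (mxn n a) (cvn n (a^~ n)) (\row_j a n j) (a n n)%:M.
Proof.
apply/matrixP => i j; rewrite -(splitK i) -(splitK j).
case: (fintype.split i) => k; case: (fintype.split j) => l /=.
- by rewrite block_mxEul !mxE.
- by rewrite block_mxEur !mxE /= (ord1 l) addn0.
- by rewrite block_mxEdl !mxE /= (ord1 k) addn0.
- by rewrite block_mxEdr !mxE /= (ord1 k) (ord1 l) addn0 eqxx.
Qed.

Lemma cvn_block n t : cvn (n + 1) t = col_mx (cvn n t) (t n)%:M.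
Proof.
apply/colP => i; rewrite -(splitK i); case: (fintype.split i) => k /=.
  by rewrite col_mxEu !mxE.
by rewrite col_mxEd !mxE /= (ord1 k) addn0 eqxx.
Qed.

Definition hermitian (a : nat -> nat -> C) := forall i j, (a i j)^* = a j i.

Lemma mxn_hermitian n a : hermitian a -> (mxn n a)^t* = mxn n a.
Proof. by move=> ha; apply/matrixP => i j; rewrite !mxE. Qed.

Definition qform n (a : nat -> nat -> C) (t : nat -> C) : C :=
  ((cvn n t)^t* *m invmx (mxn n a) *m cvn n t) 0 0.

Definition lform n (a : nat -> nat -> C) (t : nat -> C) : C :=
  ((\row_j a n j : 'rV_n) *m invmx (mxn n a) *m cvn n t) 0 0.

Section extend.
Variables (n : nat) (a : nat -> nat -> C).
Hypotheses (ha : hermitian a) (pa : posdef (mxn n.+1 a)).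

Let rE : (\row_(j < n) a n j) = (cvn n (a^~ n))^t*.
Proof. by apply/rowP => j; rewrite !mxE ha. Qed.

Let pB : posdef (block_mx (mxn n a) (cvn n (a^~ n)) ((cvn n (a^~ n))^t*) (a n n)%:M).
Proof. by rewrite -rE -mxn_block addn1. Qed.

Lemma posdef_mxn_pred : posdef (mxn n a).
Proof. exact: posdef_ulblock pB. Qed.

Let s := (((a n n)%:M : 'M[C]_1) 0 0 -
  ((cvn n (a^~ n))^t* *m invmx (mxn n a) *m cvn n (a^~ n)) 0 0).

Let s_gt0 : 0 < s.
Proof. by apply: schur_complement_gt0 pB; exact: mxn_hermitian. Qed.

Let detS : \det (mxn n.+1 a) = \det (mxn n a) * s.
Proof.
by rewrite -addn1 mxn_block det_schur_block ?(posdef_unit posdef_mxn_pred)// rE.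
Qed.

Lemma det_mxnS_ratio_gt0 : 0 < \det (mxn n.+1 a) / \det (mxn n a).
Proof.
have := posdef_unit posdef_mxn_pred; rewrite unitmxE unitfE => d0.
by rewrite detS mulrAC mulfV// mul1r.
Qed.

(** Completion of the square in the last coordinate, with centre [lform]. Writing the Schur
    complement as a ratio of consecutive determinants prepares a telescoping product. *)
Lemma qformS t : qform n.+1 a t =
  qform n a t + `|t n - lform n a t| ^+ 2 / (\det (mxn n.+1 a) / \det (mxn n a)).
Proof.
have := posdef_unit posdef_mxn_pred; rewrite unitmxE unitfE => d0.
rewrite detS [_ * s / _]mulrAC mulfV// mul1r.
rewrite -(addn1 n) /qform cvn_block mxn_block rE.
rewrite (form_schur_complement (mxn_hermitian n ha) pB) /lform rE.
by rewrite [X in `|X - _|]mxE eqxx.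
Qed.

End extend.

Lemma posdef_mxn_le n m a : hermitian a -> posdef (mxn n a) -> (m <= n)%N ->
  posdef (mxn m a).
Proof.
move=> ha; elim: n => [|n ih] p; first by rewrite leqn0 => /eqP ->.
by rewrite leq_eqVlt => /predU1P[->//|]; apply: ih; exact: posdef_mxn_pred.
Qed.

Lemma det_mxn_gt0 n a : hermitian a -> posdef (mxn n a) -> 0 < \det (mxn n a).
Proof.
move=> ha; elim: n => [|n ih] p; first by rewrite det_mx00 ltr01.
have d := ih (posdef_mxn_pred ha p).
by have := det_mxnS_ratio_gt0 ha p; rewrite pmulr_lgt0// invr_gt0.
Qed.

Lemma qform1 a t : qform 1 a t = `|t 0%N| ^+ 2 / a 0%N 0%N.
Proof.
have -> : qform 1 a t = ((t 0%N)^* * (a 0%N 0%N)^-1) * t 0%N.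
  rewrite /qform !mul_mx11 adjmx11 !mxE; congr (_ * _ * _).
  rewrite [mxn 1 a](_ : _ = (a 0%N 0%N)%:M); last by apply/matrixP => i j; rewrite !ord1 !mxE.
  by rewrite invmx_scalar mxE.
by rewrite normCK mulrAC (mulrC (_^*)).
Qed.

Lemma eq_lform n a t t' : (forall i, (i < n)%N -> t i = t' i) -> lform n a t = lform n a t'.
Proof.
by move=> tt'; rewrite /lform; congr ((_ *m _) 0 0); apply/colP => i; rewrite !mxE tt'.
Qed.

Lemma eq_qform n a t t' : (forall i, (i < n)%N -> t i = t' i) -> qform n a t = qform n a t'.
Proof.
by move=> tt'; rewrite /qform (_ : cvn n t = cvn n t')//; apply/colP => i; rewrite !mxE tt'.
Qed.

End schur_complement.

(** * The gap I - T T^* as columns of T are added *)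

Section gram_recursion.
Context (C : numClosedFieldType).
Local Open Scope sesquilinear_scope.
Implicit Types (tau : nat -> nat -> C).

(** Only the first [n] columns of [tau] enter, whatever the size of the block that is extracted. *)
Definition contraction_gap tau n (i j : nat) : C :=
  (i == j)%:R - \sum_(k < n) tau i k * (tau j k)^*.

Lemma contraction_gap_hermitian tau n : hermitian (contraction_gap tau n).
Proof.
move=> i j; rewrite /contraction_gap rmorphB rmorph_nat rmorph_sum eq_sym/=.
by congr (_ - _); apply: eq_bigr => k _; rewrite rmorphM/= conjCK mulrC.
Qed.

Lemma mxn_contraction_gap tau n :
  mxn n (contraction_gap tau n) = 1%:M - mxn n tau *m (mxn n tau)^t*.
Proof.
apply/matrixP => i j; rewrite !mxE; congr (_ - _).
by apply: eq_bigr => k _; rewrite !mxE.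
Qed.

Section step.
Variables (tau : nat -> nat -> C) (n : nat).
Hypothesis tau0 : forall k, (k < n)%N -> tau n k = 0.
Let a := contraction_gap tau n.
Let ha : hermitian a := contraction_gap_hermitian tau n.

Let gapS : mxn n.+1 (contraction_gap tau n.+1) =
  mxn n.+1 a - cvn n.+1 (tau^~ n) *m (cvn n.+1 (tau^~ n))^t*.
Proof.
apply/matrixP => i j; rewrite !mxE big_ord1 !mxE /a /contraction_gap.
by rewrite big_ord_recr/= opprD addrA.
Qed.

Let a_last i : a i n = (i == n)%:R.
Proof.
rewrite /a /contraction_gap big1 ?subr0// => k _.
by rewrite (tau0 (ltn_ord k)) conjC0 mulr0.
Qed.

Let a_lastr i : a n i = (i == n)%:R.
Proof.
by rewrite -[a n i]conjCK (ha n i) a_last conjC_nat.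
Qed.

Let gap_block : mxn (n + 1) a = block_mx (mxn n a) 0 0 1%:M.
Proof.
rewrite mxn_block; congr block_mx.
- by apply/colP => i; rewrite !mxE a_last ltn_eqF.
- by apply/rowP => i; rewrite !mxE a_lastr ltn_eqF.
- by rewrite a_last eqxx.
Qed.

Let posdef_block : posdef (mxn n a) -> posdef (mxn n.+1 a).
Proof.
rewrite -[n.+1]addn1 gap_block => pA v v0.
rewrite -[v]hsubmxK mul_row_block !mulmx0 mulmx1 addr0 add0r adj_row_mx mul_row_col mxE.
have [l0|l0] := eqVneq (lsubmx v) 0.
  rewrite l0 mul0mx mul0mx mxE add0r; apply: nrm_rV_gt0.
  by apply: contra v0 => /eqP r0; rewrite -[v]hsubmxK l0 r0 row_mx0.
by apply: ltr_wpDr; [exact: nrm_rV_ge0|exact: pA].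
Qed.

Let det_block : \det (mxn n.+1 a) = \det (mxn n a).
Proof. by rewrite -[n.+1]addn1 gap_block det_ublock det1 mulr1. Qed.

Let qform_block t : posdef (mxn n a) -> qform n.+1 a t = qform n a t + `|t n| ^+ 2.
Proof.
move=> pA; have pB := posdef_block pA.
rewrite (qformS ha pB) det_block divff ?gt_eqF ?det_mxn_gt0// divr1.
rewrite /lform (_ : (\row_j a n j) = 0) ?mul0mx ?mxE ?subr0//.
by apply/rowP => j; rewrite !mxE a_lastr ltn_eqF.
Qed.

(** Row [n] of [tau] vanishes before the diagonal, so the gap of the first [n] columns is its [n] by
    [n] block bordered by zeros and a corner 1. Column [n] then subtracts a matrix of rank one. *)
Lemma posdef_contraction_gapS : posdef (mxn n.+1 (contraction_gap tau n.+1)) <->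
  posdef (mxn n a) /\ qform n a (tau^~ n) + `|tau n n| ^+ 2 < 1.
Proof.
rewrite gapS posdef_rank_one ?mxn_hermitian//.
split=> [[pB q1]|[pA q1]].
  have pA := posdef_mxn_pred ha pB; split=> //.
  by rewrite -qform_block.
by split; [exact: posdef_block|rewrite -qform_block in q1].
Qed.

Lemma det_contraction_gapS : posdef (mxn n a) ->
  \det (mxn n.+1 (contraction_gap tau n.+1)) =
  \det (mxn n a) * (1 - (qform n a (tau^~ n) + `|tau n n| ^+ 2)).
Proof.
move=> pA; have pB := posdef_block pA.
by rewrite gapS det_rank_one ?posdef_unit// det_block -qform_block.
Qed.

End step.

Section shear.
Variables (n : nat) (w : nat -> C).
Hypothesis w0 : w 0%N = 1.

Let W : 'M[C]_n.+1 := \matrix_(i, j) if i == 0 then w j else (i == j)%:R.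

(** Inverse of [W] on the first [n.+1] coordinates: the combination of the entries of [shear t] with
    weights [w] is the plain coordinate [t 0]. As [w 0 = 1], it only translates that coordinate. *)
Definition shear (t : nat -> C) : nat -> C :=
  fun i => if i == 0%N then t 0%N - \sum_(1 <= j < n.+1) w j * t j else t i.

(** The entries of [W a W^*]; the corner entry is the value of the form [a] at the row [w]. *)
Definition shear_conj (a : nat -> nat -> C) : nat -> nat -> C := fun i j =>
  \sum_(k < n.+1) \sum_(l < n.+1)
     (if i == 0%N then w k else (i == k)%:R) * a k l *
     (if j == 0%N then w l else (j == l)%:R)^*.

Lemma shear_conj_hermitian a : hermitian a -> hermitian (shear_conj a).
Proof.
move=> ha i j; rewrite /shear_conj exchange_big rmorph_sum; apply: eq_bigr => k _.
rewrite rmorph_sum; apply: eq_bigr => l _.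
by rewrite !rmorphM/= conjCK ha mulrC (mulrC (_^*)) mulrA.
Qed.

Lemma mxn_shear_conj a : mxn n.+1 (shear_conj a) = W *m mxn n.+1 a *m W^t*.
Proof.
apply/matrixP => i j; rewrite !mxE /shear_conj exchange_big; apply: eq_bigr => l _.
rewrite !mxE mulr_suml; apply: eq_bigr => k _.
by rewrite !mxE.
Qed.

Let detW : \det W = 1.
Proof.
rewrite -det_tr det_trig; last first.
  apply/is_trig_mxP => i j ij; rewrite !mxE.
  have -> : (j == 0) = false by apply/negbTE; rewrite -val_eqE/= -lt0n (leq_ltn_trans _ ij).
  by rewrite -val_eqE/= gtn_eqF.
by apply: big1 => i _; rewrite !mxE; case: eqP => [->|]; rewrite ?w0 ?eqxx.
Qed.

Let unitW : W \in unitmx. Proof. by rewrite unitmxE detW unitr1. Qed.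

Lemma posdef_shear_conj a : posdef (mxn n.+1 a) -> posdef (mxn n.+1 (shear_conj a)).
Proof. by move=> pa; rewrite mxn_shear_conj; exact: posdef_conj. Qed.

Lemma det_shear_conj a : \det (mxn n.+1 (shear_conj a)) = \det (mxn n.+1 a).
Proof.
by rewrite mxn_shear_conj !det_mulmx detW mul1r det_map_mx det_tr detW rmorph1 mulr1.
Qed.

Lemma sum_shear t : \sum_(j < n.+1) w j * shear t j = t 0%N.
Proof.
rewrite big_ord_recl /shear/= w0 mul1r big_add1 big_mkord/=.
by rewrite subrK.
Qed.

Let W_shear t : W *m cvn n.+1 (shear t) = cvn n.+1 t.
Proof.
apply/colP => i; rewrite !mxE.
have [->|i0] := eqVneq i 0.
  by rewrite -(sum_shear t); apply: eq_bigr => j _; rewrite !mxE eqxx.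
rewrite (bigD1 i)//= big1 ?addr0; last first.
  by move=> j ji; rewrite !mxE (negbTE i0) eq_sym (negbTE ji) mul0r.
rewrite !mxE (negbTE i0) eqxx mul1r /shear.
by rewrite -val_eqE/= in i0; rewrite (negbTE i0).
Qed.

Lemma qform_shear a t : mxn n.+1 a \in unitmx ->
  qform n.+1 a (shear t) = qform n.+1 (shear_conj a) t.
Proof.
move=> ua; rewrite /qform mxn_shear_conj -[cvn _ t]W_shear.
have invM (X Y : 'M[C]_n.+1) : X \in unitmx -> Y \in unitmx ->
  invmx (X *m Y) = invmx Y *m invmx X by exact: invrM.
have uWs : W^t* \in unitmx by rewrite unitmxE det_map_mx det_tr detW rmorph1 unitr1.
rewrite !invM ?unitmx_mul ?unitW ?ua// adjmxM !mulmxA.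
by rewrite mulmxK// mulmxKV.
Qed.

(** When [w] annihilates all columns that have entered the gap, only the identity part contributes
    to the form at [w]. *)
Lemma shear_conj_gap tau m : (forall k, (k < m)%N -> \sum_(j < n.+1) w j * tau j k = 0) ->
  shear_conj (contraction_gap tau m) 0%N 0%N = \sum_(j < n.+1) `|w j| ^+ 2.
Proof.
move=> wt; rewrite /shear_conj/= /contraction_gap.
apply: eq_bigr => k _.
transitivity (\sum_(l < n.+1) w k * (k == l :> nat)%:R * (w l)^* -
   \sum_(i < m) w k * tau k i * (\sum_(l < n.+1) w l * tau l i)^*).
  transitivity (\sum_(l < n.+1) (w k * (k == l :> nat)%:R * (w l)^* -
      \sum_(i < m) w k * tau k i * (w l * tau l i)^*)).
    apply: eq_bigr => l _; rewrite mulrBr mulrBl mulr_sumr mulr_suml; congr (_ - _).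
    by apply: eq_bigr => i _; rewrite rmorphM/= !mulrA mulrAC.
  rewrite sumrB exchange_big/=; congr (_ - _); apply: eq_bigr => i _.
  by rewrite rmorph_sum mulr_sumr.
rewrite [X in _ - X]big1 ?subr0; last by move=> i _; rewrite wt// conjC0 mulr0.
rewrite (bigD1 k)//= big1 ?addr0; first by rewrite eqxx mulr1 normCK.
move=> l lk; rewrite (_ : (k == l :> nat) = false) ?mulr0 ?mul0r//.
by apply/negbTE; rewrite val_eqE eq_sym.
Qed.

End shear.

End gram_recursion.

(** * Measurability of complex and matrix functions *)

Section complex_measurable.
Context (R : realType).
Local Open Scope sesquilinear_scope.
Local Notation C := R[i].

Definition complex_of_pair (z : measurableTypeR R * measurableTypeR R) : C :=
  Complex (z.1 : R) (z.2 : R).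

Lemma ReD (x y : C) : complex.Re (x + y) = complex.Re x + complex.Re y.
Proof. by case: x y => [? ?] [? ?]. Qed.
Lemma ImD (x y : C) : complex.Im (x + y) = complex.Im x + complex.Im y.
Proof. by case: x y => [? ?] [? ?]. Qed.
Lemma ReN (x : C) : complex.Re (- x) = - complex.Re x. Proof. by case: x. Qed.
Lemma ImN (x : C) : complex.Im (- x) = - complex.Im x. Proof. by case: x. Qed.
Lemma ReM (x y : C) :
  complex.Re (x * y) = complex.Re x * complex.Re y - complex.Im x * complex.Im y.
Proof. by case: x y => [? ?] [? ?]. Qed.
Lemma ImM (x y : C) :
  complex.Im (x * y) = complex.Re x * complex.Im y + complex.Im x * complex.Re y.
Proof. by case: x y => [? ?] [? ?]. Qed.
Lemma Re_conj (x : C) : complex.Re (x^*)%R = complex.Re x. Proof. by case: x. Qed.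
Lemma Im_conj (x : C) : complex.Im (x^*)%R = - complex.Im x. Proof. by case: x. Qed.
Lemma Re_inv (x : C) :
  complex.Re (x^-1) = complex.Re x / (complex.Re x ^+ 2 + complex.Im x ^+ 2).
Proof. by case: x. Qed.
Lemma Im_inv (x : C) :
  complex.Im (x^-1) = - (complex.Im x / (complex.Re x ^+ 2 + complex.Im x ^+ 2)).
Proof. by case: x. Qed.
Lemma complex_eq0 (x : C) : (x == 0) = (complex.Re x == 0) && (complex.Im x == 0).
Proof. by rewrite eq_complex. Qed.
Lemma Re_realM (x y : C) : x \is Num.real -> complex.Re (x * y) = complex.Re x * complex.Re y.
Proof. by case: x => a b; rewrite complex_real => /eqP ->; rewrite ReM mul0r subr0. Qed.

Lemma normC_pair z : `|complex_of_pair z| ^+ 2 = (nrm2 z : R)%:C%C.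
Proof. by rewrite -add_Re2_Im2. Qed.

Section closure.
Context d (U : measurableType d).
Implicit Types (f g : U -> C).

Definition cmeasurable f : Prop :=
  measurable_fun setT (fun t => complex.Re (f t)) /\
  measurable_fun setT (fun t => complex.Im (f t)).

Lemma cmeasurable_cst c : cmeasurable (fun=> c).
Proof. by split; exact: measurable_cst. Qed.

Lemma cmeasurable_pair (z : U -> measurableTypeR R * measurableTypeR R) :
  measurable_fun setT z -> cmeasurable (fun t => complex_of_pair (z t)).
Proof.
by move=> mz; split; [exact: (measurableT_comp measurable_fst mz)|
  exact: (measurableT_comp measurable_snd mz)].
Qed.

Lemma cmeasurableD f g : cmeasurable f -> cmeasurable g -> cmeasurable (fun t => f t + g t).
Proof.
move=> [f1 f2] [g1 g2]; split; [under eq_fun do rewrite ReD|under eq_fun do rewrite ImD];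
  exact: measurable_funD.
Qed.

Lemma cmeasurableN f : cmeasurable f -> cmeasurable (fun t => - f t).
Proof.
move=> [f1 f2]; split; [under eq_fun do rewrite ReN|under eq_fun do rewrite ImN];
  exact: measurable_funN.
Qed.

Lemma cmeasurableM f g : cmeasurable f -> cmeasurable g -> cmeasurable (fun t => f t * g t).
Proof.
move=> [f1 f2] [g1 g2]; split.
  by under eq_fun do rewrite ReM; apply: measurable_funB; exact: measurable_funM.
by under eq_fun do rewrite ImM; apply: measurable_funD; exact: measurable_funM.
Qed.

Lemma cmeasurable_conj f : cmeasurable f -> cmeasurable (fun t => (f t)^*).
Proof.
move=> [f1 f2]; split; [by under eq_fun do rewrite Re_conj|under eq_fun do rewrite Im_conj].
exact: measurable_funN.
Qed.

Lemma cmeasurableV f : cmeasurable f -> cmeasurable (fun t => (f t)^-1).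
Proof.
move=> [f1 f2].
have mV : measurable_fun setT
    (fun t => (complex.Re (f t) ^+ 2 + complex.Im (f t) ^+ 2)^-1).
  by apply: measurable_inv; apply: measurable_funD; exact: measurable_funX.
split; [under eq_fun do rewrite Re_inv|under eq_fun do rewrite Im_inv].
  exact: measurable_funM.
by apply: measurable_funN; exact: measurable_funM.
Qed.

Lemma cmeasurable_sum I (r : seq I) (P : pred I) (f : I -> U -> C) :
  (forall i, cmeasurable (f i)) -> cmeasurable (fun t => \sum_(i <- r | P i) f i t).
Proof.
move=> mf; elim: r => [|i r ih].
  by under eq_fun do rewrite big_nil; exact: cmeasurable_cst.
under eq_fun do rewrite big_cons.
by case: (P i) => //; exact: cmeasurableD.
Qed.

Lemma cmeasurable_prod I (r : seq I) (P : pred I) (f : I -> U -> C) :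
  (forall i, cmeasurable (f i)) -> cmeasurable (fun t => \prod_(i <- r | P i) f i t).
Proof.
move=> mf; elim: r => [|i r ih].
  by under eq_fun do rewrite big_nil; exact: cmeasurable_cst.
under eq_fun do rewrite big_cons.
by case: (P i) => //; exact: cmeasurableM.
Qed.

Lemma measurable_eq0 f : cmeasurable f -> measurable_fun setT (fun t => f t == 0).
Proof.
move=> [f1 f2]; under eq_fun do rewrite complex_eq0.
by apply: measurable_and; apply: measurable_fun_eqr => //; exact: measurable_cst.
Qed.

Lemma cmeasurable_if (b : U -> bool) f g : measurable_fun setT b ->
  cmeasurable f -> cmeasurable g -> cmeasurable (fun t => if b t then f t else g t).
Proof.
move=> mb [f1 f2] [g1 g2]; split.
  under eq_fun do rewrite (fun_if (@complex.Re R)).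
  exact: measurable_fun_ifT.
under eq_fun do rewrite (fun_if (@complex.Im R)).
exact: measurable_fun_ifT.
Qed.

Definition mxmeasurable m n (A : U -> 'M[C]_(m, n)) : Prop :=
  forall i j, cmeasurable (fun t => A t i j).

Lemma mxmeasurableM m n p (A : U -> 'M[C]_(m, n)) (B : U -> 'M[C]_(n, p)) :
  mxmeasurable A -> mxmeasurable B -> mxmeasurable (fun t => A t *m B t).
Proof.
move=> mA mB i j; under eq_fun do rewrite mxE.
by apply: cmeasurable_sum => k; exact: cmeasurableM.
Qed.

Lemma mxmeasurable_adj m n (A : U -> 'M[C]_(m, n)) :
  mxmeasurable A -> mxmeasurable (fun t => (A t)^t*).
Proof. by move=> mA i j; under eq_fun do rewrite !mxE; exact: cmeasurable_conj. Qed.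

Lemma cmeasurable_det n (A : U -> 'M[C]_n) : mxmeasurable A ->
  cmeasurable (fun t => \det (A t)).
Proof.
move=> mA; apply: cmeasurable_sum => s; apply: cmeasurableM.
  exact: cmeasurable_cst.
by apply: cmeasurable_prod.
Qed.

Lemma mxmeasurable_inv n (A : U -> 'M[C]_n) : mxmeasurable A ->
  mxmeasurable (fun t => invmx (A t)).
Proof.
move=> mA i j.
(* [invmx] returns a singular matrix unchanged, hence the distinction on the determinant. *)
rewrite (_ : (fun _ => _) = fun t => if \det (A t) == 0 then A t i j else
   (\det (A t))^-1 * \adj (A t) i j); last first.
  apply/funext => t; rewrite /invmx unitmxE unitfE.
  by case: eqP => //= _; rewrite mxE.
have md := cmeasurable_det mA.
apply: cmeasurable_if => //; first exact: measurable_eq0.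
apply: cmeasurableM; first exact: cmeasurableV.
under eq_fun do rewrite mxE; apply: cmeasurableM; first exact: cmeasurable_cst.
apply: cmeasurable_det => k l.
by under eq_fun do rewrite !mxE; exact: mA.
Qed.

Lemma cmeasurable_qform n (a : U -> nat -> nat -> C) (t : U -> nat -> C) :
  (forall i j, cmeasurable (fun u => a u i j)) -> (forall i, cmeasurable (fun u => t u i)) ->
  cmeasurable (fun u => qform n (a u) (t u)).
Proof.
move=> ma mt.
have mc : mxmeasurable (fun u => cvn n (t u)).
  by move=> i j; under eq_fun do rewrite mxE.
apply: (@mxmeasurableM _ _ _ (fun u => (cvn n (t u))^t* *m invmx (mxn n (a u)))) => //.
apply: mxmeasurableM; first exact: mxmeasurable_adj.
by apply: mxmeasurable_inv => i j; under eq_fun do rewrite mxE.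
Qed.

Lemma cmeasurable_contraction_gap n (tau : U -> nat -> nat -> C) i j :
  (forall i j, cmeasurable (fun u => tau u i j)) ->
  cmeasurable (fun u => contraction_gap (tau u) n i j).
Proof.
move=> mt; apply: cmeasurableD; first exact: cmeasurable_cst.
apply: cmeasurableN; apply: cmeasurable_sum => k.
by apply: cmeasurableM => //; exact: cmeasurable_conj.
Qed.

End closure.

End complex_measurable.

(** * Integration over a column *)

(** Tonelli's theorem makes [k] the innermost variable, where equality of the integrals in that
    coordinate is enough. *)
Lemma iint_inner (R : realType) (K : eqType) d (T : measurableType d)
    (mu : {sigma_finite_measure set T -> \bar R}) k (s : seq K) (F G : (K -> T) -> \bar R) x :
  pmeasurable F -> (forall y, 0 <= F y)%E -> pmeasurable G -> (forall y, 0 <= G y)%E ->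
  (forall y, (\int[mu]_z F (update y k z) = \int[mu]_z G (update y k z))%E) ->
  iint mu (k :: s) F x = iint mu (k :: s) G x.
Proof.
move=> mF F0 mG G0 FG.
have ks : perm_eq (k :: s) (s ++ [:: k]) by rewrite -cat1s perm_catC.
rewrite (perm_iint mu x mF F0 ks) (perm_iint mu x mG G0 ks) !iint_cat.
by apply: eq_iint => y _; exact: FG.
Qed.

Section column_integral.
Local Opaque qform lform.
Context (R : realType) (K : eqType) (key : nat -> K).
Hypothesis key_inj : injective key.
Local Notation C := R[i].
Local Notation CC := (measurableTypeR R * measurableTypeR R)%type.
Local Notation leb2 := (complex_lebesgue R).
Local Open Scope ereal_scope.
Implicit Types (a : nat -> nat -> C) (x y : K -> CC).

Definition sqnorm (c : C) : R := (complex.Re c ^+ 2 + complex.Im c ^+ 2)%R.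

Definition coords x : nat -> C := fun i => complex_of_pair (x (key i)).

Lemma sqnormE (c : C) : (`|c| ^+ 2)%R = (sqnorm c)%:C%C.
Proof. by rewrite -add_Re2_Im2. Qed.

Lemma complex_gt0 (c : C) : (0 < c)%R -> (0 < complex.Re c)%R /\ c = (complex.Re c)%:C%C.
Proof. by case: c => u v; rewrite ltcE/= => /andP[/eqP -> ->]. Qed.

Lemma real_complexV (u : R) : (u%:C%C)^-1%R = (u^-1)%:C%C.
Proof. exact/esym/(fmorphV (real_complex R)). Qed.

Lemma real_complexM (u v : R) : (u * v)%R%:C%C = (u%:C%C * v%:C%C)%R.
Proof. exact: rmorphM. Qed.

Let key_neq i j : i != j -> (key i == key j) = false.
Proof. by move=> ij; apply/negbTE; apply: contra ij => /eqP/key_inj ->. Qed.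

Let pospow_qform p m a (r : R) y : \bar R :=
  (pospow p (r - complex.Re (qform m a (coords y))))%:E.

Lemma pmeasurable_pospow_qform p m a r : pmeasurable (pospow_qform p m a r).
Proof.
move=> d U x mx; apply/measurable_EFinP; apply: (measurableT_comp (measurable_pospow _)).
apply: measurable_funB; first exact: measurable_cst.
apply: (cmeasurable_qform m (a := fun=> a) (t := fun u => coords (x u)) _ _).1.
  by move=> i j; exact: cmeasurable_cst.
by move=> i; exact: cmeasurable_pair.
Qed.

(** With the other coordinates frozen the form is a shifted squared modulus in the last one, so
    [ge0_integral_pospow] applies, with scale the inverse of the determinant ratio. *)
Lemma integral_last_coord p m a (r : R) y k : hermitian a -> posdef (mxn m.+2 a) ->
  (forall (r d : R) (l : CC), (0 < d)%R ->
  \int[leb2]_z (pospow p (r - d * nrm2 (z.1 - l.1, z.2 - l.2)%R)%R)%:E =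
  (d^-1 * pospow p.+1 r)%:E * k) ->
  \int[leb2]_z pospow_qform p m.+2 a r (update y (key m.+1) z) =
  (complex.Re (\det (mxn m.+2 a) / \det (mxn m.+1 a))%R)%:E * k * pospow_qform p.+1 m.+1 a r y.
Proof.
move=> ha pa kE.
have [rho0 rhoE] := complex_gt0 (det_mxnS_ratio_gt0 ha pa).
set rho := complex.Re _ in rho0 rhoE *.
pose l := lform m.+1 a (coords y).
have E z : qform m.+2 a (coords (update y (key m.+1) z)) =
    (qform m.+1 a (coords y) +
     (rho^-1 * nrm2 ((z.1 : R) - complex.Re l, (z.2 : R) - complex.Im l))%R%:C%C)%R.
  rewrite (qformS ha pa) rhoE.
  have agree i : (i < m.+1)%N -> coords (update y (key m.+1) z) i = coords y i.
    by move=> im; rewrite /coords /update key_neq// ltn_eqF.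
  rewrite (eq_qform _ agree) (eq_lform _ agree) -/l; congr (_ + _)%R.
  rewrite sqnormE real_complexV -real_complexM mulrC; congr (_ * _)%:C%C.
  by rewrite /sqnorm /coords /update eqxx ReD ReN ImD ImN.
transitivity (\int[leb2]_z (pospow p (r - complex.Re (qform m.+1 a (coords y)) - rho^-1 *
    nrm2 ((z.1 : R) - complex.Re l, (z.2 : R) - complex.Im l)%R)%R)%:E).
  apply: eq_integral => z _; rewrite /pospow_qform E ReD/=.
  by rewrite opprD addrA.
rewrite (kE _ _ (complex.Re l, complex.Im l)) ?invr_gt0// invrK.
by rewrite EFinM -!muleA; congr (_ * _); rewrite muleC.
Qed.

(** Coordinates are removed from the last down to coordinate 1. The determinant ratios telescope,
    and each of the [m] removals raises the power by one. *)
Lemma integral_column_tail m p : exists2 k : \bar R, 0 <= k &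
  forall a (r : R) x, hermitian a -> posdef (mxn m.+1 a) ->
  iint leb2 [seq key i | i <- iota 1 m] (pospow_qform p m.+1 a r) x =
  (complex.Re (\det (mxn m.+1 a) / a 0%N 0%N)%R *
   pospow (p + m) (r - nrm2 (x (key 0%N)) / complex.Re (a 0%N 0%N))%R)%:E * k.
Proof.
elim: m p => [|m ih] p.
  exists 1 => // a r x ha pa; rewrite mule1 /= /pospow_qform.
  have d1 : \det (mxn 1 a) = a 0%N 0%N by rewrite det_mx11 mxE.
  have := det_mxn_gt0 ha pa; rewrite d1 => a0; have [a0' aE] := complex_gt0 a0.
  rewrite divff ?gt_eqF// mul1r addn0 qform1 sqnormE aE real_complexV -real_complexM/=.
  by [].
have [k k0 kE] := ge0_integral_pospow R p; have [l l0 lE] := ih p.+1.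
exists (k * l); first by rewrite mule_ge0.
move=> a r x ha pa; have pa1 := posdef_mxn_pred ha pa.
have [rho0 rhoE] := complex_gt0 (det_mxnS_ratio_gt0 ha pa).
have -> : iota 1 m.+1 = iota 1 m ++ [:: m.+1] by have := iotaD 1 m 1; rewrite addn1 add1n.
rewrite map_cat iint_cat.
set rho := complex.Re _ in rho0 rhoE.
transitivity (iint leb2 [seq key i | i <- iota 1 m]
    (fun y => rho%:E * k * pospow_qform p.+1 m.+1 a r y) x).
  apply: eq_iint => y _; exact: integral_last_coord.
rewrite iintZl; last 3 first.
- exact: pmeasurable_pospow_qform.
- by move=> y; rewrite lee_fin pospow_ge0.
- by rewrite mule_ge0// lee_fin ltW.
rewrite lE// addnS addSn.
rewrite (_ : complex.Re (\det (mxn m.+2 a) / a 0%N 0%N)%R =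
    (rho * complex.Re (\det (mxn m.+1 a) / a 0%N 0%N))%R).
  by rewrite -(mulrA rho) [in RHS]EFinM -!muleA; congr (_ * _); rewrite muleCA.
have := posdef_unit pa1; rewrite unitmxE unitfE => d0.
have -> : (\det (mxn m.+2 a) / a 0%N 0%N = rho%:C%C * (\det (mxn m.+1 a) / a 0%N 0%N))%R.
  by rewrite -rhoE mulrA divfK.
by rewrite Re_realM ?complex_real.
Qed.

Let column_fun (g : measurableTypeR R -> \bar R) (w : nat -> C) p m a r y : \bar R :=
  g (sqnorm (\sum_(j < m.+1) w j * coords y j)%R) * pospow_qform p m.+1 a r y.

Lemma pmeasurable_column_fun g w p m a r : measurable_fun setT g ->
  pmeasurable (column_fun g w p m a r).
Proof.
move=> mg d U x mx; apply: emeasurable_funM; last exact: pmeasurable_pospow_qform.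
apply: (measurableT_comp mg).
have [m1 m2] : cmeasurable (fun u => \sum_(j < m.+1) w j * coords (x u) j)%R.
  apply: cmeasurable_sum => j; apply: cmeasurableM; first exact: cmeasurable_cst.
  exact: cmeasurable_pair.
by apply: measurable_funD; exact: measurable_funX.
Qed.

Let keys n := [seq key i | i <- iota 0 n].

(** [g] sees the column through a single linear combination. Since [w 0 = 1], translating coordinate
    0 turns this combination into the coordinate itself, at the price of conjugating [a]; the other
    [m] coordinates can then be integrated out. *)
Lemma integral_column m p : exists2 k : \bar R, 0 <= k &
  forall (g : measurableTypeR R -> \bar R) a (w : nat -> C) (r : R) x,
  measurable_fun setT g -> (forall s, 0 <= g s) ->
  hermitian a -> posdef (mxn m.+1 a) -> w 0%N = 1%R ->
  iint leb2 (keys m.+1) (column_fun g w p m a r) x =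
  (complex.Re (\det (mxn m.+1 a)))%:E * k *
  \int[leb2]_z (g (complex.Re (shear_conj m w a 0%N 0%N) * nrm2 z)%R *
    (pospow (p + m) (r - nrm2 z))%:E).
Proof.
have [k k0 kE] := integral_column_tail m p; exists k => // g a w r x mg g0 ha pa w0.
have cf0 w' a' y : 0 <= column_fun g w' p m a' r y.
  by rewrite mule_ge0// lee_fin pospow_ge0.
pose a' := shear_conj m w a.
have ha' : hermitian a' := shear_conj_hermitian _ _ ha.
have pa' : posdef (mxn m.+1 a') := posdef_shear_conj w0 pa.
pose e0 (i : nat) : C := ((i == 0%N)%:R)%R.
have a'0 : (0 < a' 0%N 0%N)%R.
  have := det_mxn_gt0 ha' (posdef_mxn_le ha' pa' (isT : (1 <= m.+1)%N)).
  by rewrite det_mx11 mxE.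
have [c0_gt0 c0E] := complex_gt0 a'0.
set c0 := complex.Re _ in c0_gt0 c0E.
pose rest := [seq key i | i <- iota 1 m].
have e0E y : (\sum_(j < m.+1) e0 j * coords y j = coords y 0%N)%R.
  by rewrite big_ord_recl/= mul1r big1 ?addr0// => j _; rewrite mul0r.
transitivity (iint leb2 (keys m.+1) (column_fun g e0 p m a' r) x).
  apply: (iint_inner _ _ (pmeasurable_column_fun w p m a r mg) (cf0 w a)
    (pmeasurable_column_fun e0 p m a' r mg) (cf0 e0 a')) => y.
  (* For frozen coordinates 1 to [m], the shear is the translation of coordinate 0 by [- c]. *)
  pose c := (\sum_(1 <= j < m.+1) w j * coords y j)%R.
  pose f z := column_fun g w p m a r (update y (key 0%N) z).
  have mf : measurable_fun setT f.
    apply: (pmeasurable_column_fun w p m a r mg (x := fun z => update y (key 0%N) z)).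
    by apply: (measurable_update (x := fun=> y)) => // l; exact: measurable_cst.
  have H := ge0_complex_integral_affine (- complex.Re c) (- complex.Im c) ltr01 mf
    (fun z => cf0 _ _ _).
  rewrite expr1n invr1 mul1e in H.
  apply: (eq_trans (esym H)); apply: eq_integral => z _; rewrite /f !mul1r.
  set y1 := update _ _ _; set y2 := update _ _ _.
  have agree i : (i < m.+1)%N -> coords y1 i = shear m w (coords y2) i.
    move=> im; rewrite /shear; have [->|i0] := eqVneq i 0%N; last first.
      by rewrite /coords /y1 /y2 /update key_neq.
    rewrite {1}/coords {1}/y1 {1}/update eqxx.
    rewrite {1}/coords {1}/y2 {1}/update eqxx.
    have -> : (\sum_(1 <= j < m.+1) w j * coords y2 j = c)%R.
      rewrite /c !big_add1 !big_mkord; apply: eq_bigr => j _.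
      by rewrite /coords /y2 /update key_neq.
    by apply/eqP; rewrite eq_complex/= ReD ImD ReN ImN/= !eqxx.
  have E1 : qform m.+1 a (coords y1) = qform m.+1 a' (coords y2).
    rewrite (eq_qform a agree); exact: (qform_shear w0 (coords y2) (posdef_unit pa)).
  have E2 : (\sum_(j < m.+1) w j * coords y1 j = \sum_(j < m.+1) e0 j * coords y2 j)%R.
    rewrite e0E -(sum_shear m w0 (coords y2)); apply: eq_bigr => j _.
    by rewrite agree.
  by rewrite /column_fun /pospow_qform E1 E2.
rewrite -[keys _]/(key 0%N :: rest) /=.
have detE : (complex.Re (\det (mxn m.+1 a') / a' 0%N 0%N) * c0 = complex.Re (\det (mxn m.+1 a)))%R.
  rewrite c0E mulrC -[X in (X * _)%R]/(complex.Re (c0%:C%C)) -Re_realM ?complex_real//.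
  by rewrite mulrC divfK ?det_shear_conj// -c0E gt_eqF.
set D := complex.Re (_ / _)%R in detE.
have D0 : (0 <= D)%R.
  have := divr_gt0 (det_mxn_gt0 ha' pa') a'0.
  by move=> /complex_gt0[/ltW].
pose h (s : measurableTypeR R) : \bar R := g (c0 * (s : R))%R * (pospow (p + m) (r - (s : R)))%:E.
have mh : measurable_fun setT h.
  rewrite /h; msolve; first by apply: (measurableT_comp mg); msolve.
  by apply: (measurableT_comp (measurable_pospow _)); msolve.
have h0 s : 0 <= h s by rewrite mule_ge0// lee_fin pospow_ge0.
transitivity (\int[leb2]_z ((D%:E * k) * h (nrm2 z / c0)%R)).
  apply: eq_integral => z _.
  transitivity (iint leb2 rest (fun y => g (nrm2 z) * pospow_qform p m.+1 a' r y)
      (update x (key 0%N) z)).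
    apply: eq_iint => y yx; rewrite /column_fun e0E; congr (g _ * _).
    rewrite /coords yx /update ?eqxx//.
    apply/mapP => -[j]; rewrite mem_iota => /andP[j0 _] /key_inj E.
    by rewrite -E in j0.
  rewrite iintZl//; last 2 first.
  - exact: pmeasurable_pospow_qform.
  - by move=> y; rewrite lee_fin pospow_ge0.
  rewrite kE// -/c0 -/D {1}/update eqxx /h mulrCA mulfV ?gt_eqF// mulr1.
  by rewrite EFinM (muleAC D%:E) muleCA.
have mhO : measurable_fun setT (fun z : CC => h (nrm2 z / c0)%R).
  apply: (measurableT_comp mh); apply: measurable_funM; last exact: measurable_cst.
  exact: measurable_nrm2.
rewrite ge0_integralZl//; last by rewrite mule_ge0// lee_fin.
rewrite ge0_integral_nrm2_scale// -detE EFinM -!muleA; congr (_ * _).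
by rewrite muleCA.
Qed.

End column_integral.

(** * Overlaps of triangular matrices *)

Section vandermonde_average.
Context (C : numClosedFieldType).

Lemma primitive_root_norm1 L (w : C) : (0 < L)%N -> L.-primitive_root w -> `|w| = 1.
Proof.
move=> L0 /prim_expr_order wL; apply/eqP.
by rewrite -(@pexpr_eq1 _ _ L)// -normrX wL normr1.
Qed.

Lemma primitive_root_orthogonality L (w : C) (k l : nat) : L.-primitive_root w ->
  (k < L)%N -> (l < L)%N ->
  \sum_(a < L) (w ^+ a) ^+ k * ((w ^+ a) ^+ l)^* = (k == l)%:R * L%:R.
Proof.
move=> wP kL lL.
have L0 : (0 < L)%N by exact: leq_ltn_trans kL.
have w1 := primitive_root_norm1 L0 wP.
have w0 : w != 0 by rewrite -normr_eq0 w1 oner_eq0.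
have wc : w^* = w^-1 by rewrite invC_norm w1 expr1n invr1 mul1r.
pose z := w ^+ k * w^-1 ^+ l.
transitivity (\sum_(a < L) z ^+ a).
  apply: eq_bigr => a _; rewrite !rmorphXn/= wc /z exprMn -!exprM.
  by rewrite (mulnC a k) (mulnC a l).
have [kl|kl] := eqVneq k l.
  rewrite mul1r (_ : z = 1); last by rewrite /z kl -exprMn divff ?expr1n.
  by under eq_bigr do rewrite expr1n; rewrite sumr_const card_ord.
rewrite mul0r; have z1 : z != 1.
  apply: contra kl => /eqP zE.
  have : w ^+ k = w ^+ l by rewrite -[RHS]mul1r -zE /z -mulrA -exprMn mulVf ?expr1n ?mulr1.
  by move/eqP; rewrite (eq_prim_root_expr wP) !modn_small.
apply: (mulfI (_ : z - 1 != 0)); first by rewrite subr_eq0.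
rewrite mulr0 -subrX1 /z exprMn !(exprAC _ _ L).
by rewrite exprVn (prim_expr_order wP) invr1 !expr1n mulr1 subrr.
Qed.

(** Leibniz's formula is expanded for the determinant and its conjugate. If the two permutations
    differ at [j], the sum over the rotation of index [j] is zero; all exponents being below [L], no
    other coincidence modulo [L] can occur. *)
Lemma vandermonde_average m L (w : C) (x : 'I_m -> C) : L.-primitive_root w -> (m <= L)%N ->
  \sum_(a : {ffun 'I_m -> 'I_L})
    `|\det (\matrix_(j, i) (w ^+ a j * x j) ^+ i : 'M[C]_m)| ^+ 2 =
  (L%:R ^+ m) * \sum_(s : {perm 'I_m}) \prod_j (`|x j| ^+ 2) ^+ s j.
Proof.
move=> wP mL.
transitivity (\sum_(a : {ffun 'I_m -> 'I_L}) \sum_(s : {perm 'I_m}) \sum_(t : {perm 'I_m})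
    ((-1) ^+ s * (-1) ^+ t) *
    \prod_j ((w ^+ a j * x j) ^+ s j * ((w ^+ a j * x j) ^+ t j)^*)).
  apply: eq_bigr => a _; rewrite normCK /determinant rmorph_sum mulr_suml.
  apply: eq_bigr => s _; rewrite mulr_sumr; apply: eq_bigr => t _.
  rewrite rmorphM/= rmorphXn rmorphN1 rmorph_prod mulrACA; congr (_ * _).
  by rewrite -big_split/=; apply: eq_bigr => j _; rewrite !mxE.
rewrite exchange_big mulr_sumr; apply: eq_bigr => s _ /=.
rewrite exchange_big /= (bigD1 s)//= [X in _ + X]big1 ?addr0; last first.
  move=> t ts; rewrite -mulr_sumr.
  rewrite -(bigA_distr_bigA
    (fun j (a : 'I_L) => (w ^+ a * x j) ^+ s j * ((w ^+ a * x j) ^+ t j)^*)).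
  have [j stj] : exists j, s j != t j.
    apply/existsP; apply: contraNT ts; rewrite negb_exists => /forallP st.
    by apply/eqP/permP => j; have := st j; rewrite negbK => /eqP.
  rewrite (bigD1 j)//= (_ : \sum_a _ = 0) ?mul0r ?mulr0//.
  transitivity (x j ^+ s j * (x j ^+ t j)^* * \sum_(a < L) (w ^+ a) ^+ s j * ((w ^+ a) ^+ t j)^*).
    rewrite mulr_sumr; apply: eq_bigr => a _.
    by rewrite !exprMn rmorphM/= mulrACA mulrC.
  rewrite primitive_root_orthogonality ?(leq_trans (ltn_ord _))//.
  by rewrite val_eqE (negbTE stj) mul0r mulr0.
rewrite -mulr_sumr -signr_addb addbb expr0 mul1r.
rewrite -(bigA_distr_bigA (fun j (a : 'I_L) => (w ^+ a * x j) ^+ s j * ((w ^+ a * x j) ^+ s j)^*)).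
transitivity (\prod_(j < m) (L%:R * (`|x j| ^+ 2) ^+ s j)); last first.
  by rewrite big_split/= prodr_const card_ord.
apply: eq_bigr => j _.
transitivity (x j ^+ s j * (x j ^+ s j)^* * \sum_(a < L) (w ^+ a) ^+ s j * ((w ^+ a) ^+ s j)^*).
  rewrite mulr_sumr; apply: eq_bigr => a _.
  by rewrite !exprMn rmorphM/= mulrACA mulrC.
rewrite primitive_root_orthogonality ?(leq_trans (ltn_ord _))// eqxx mul1r mulrC.
by rewrite -normCK normrX exprAC.
Qed.

End vandermonde_average.

(** * The overlap as the norm of a null vector *)

Section overlap_triangular.
Context (R : realType).
Local Notation C := R[i].
Local Open Scope sesquilinear_scope.
Variables (n : nat) (T : 'M[C]_n.+1).
Hypothesis T_upper : forall i j : 'I_n.+1, (j < i)%N -> T i j = 0.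
Let lam (i : 'I_n.+1) : C := T i i.

Let lam_eigenvalue i : exists2 v : 'rV[C]_n.+1, v *m T = lam i *: v & v != 0.
Proof.
apply/eigenvalueP; rewrite /eigenvalue /eigenspace kermx_eq0 row_free_unit unitmxE unitfE.
rewrite negbK -det_tr det_trig; last first.
  apply/is_trig_mxP => k l kl; rewrite !mxE T_upper//.
  by rewrite -val_eqE/= gtn_eqF// subr0.
by rewrite (bigD1 i)//= !mxE eqxx mulr1n subrr mul0r.
Qed.

(** Left eigenvectors for distinct eigenvalues are independent, so they are the rows of an
    invertible matrix; the columns of its inverse are right eigenvectors with the required
    normalization. *)
Lemma triangular_biorthogonal : injective lam ->
  exists Rv Lv, biorthogonal_eigenvectors T lam Rv Lv.
Proof.
move=> lam_inj.
have [v vT] := choice (fun i => let: ex_intro2 v P Q := lam_eigenvalue i in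
  ex_intro (fun v => v *m T = lam i *: v /\ v != 0) v (conj P Q)).
pose P : 'M[C]_n.+1 := \matrix_i v i.
have Pfree : row_free P.
  apply: inj_row_free => c cP; apply/rowP => i; rewrite [RHS]mxE.
  have dx : mxdirect (\sum_i eigenspace T (lam i))%MS.
    by apply: mxdirect_sum_eigenspace; exact: in2W.
  have vE j : (v j <= eigenspace T (lam j))%MS by apply/eigenspaceP; exact: (vT j).1.
  have cvi : c 0 i *: v i = - \sum_(j | j != i) c 0 j *: v j.
    have : \sum_j c 0 j *: v j = 0.
      transitivity (c *m P); last exact: cP.
      by rewrite mulmx_sum_row; apply: eq_bigr => j _; rewrite rowK.
    by rewrite (bigD1 i)//= => /eqP; rewrite addr_eq0 => /eqP.
  have : (c 0 i *: v i <= eigenspace T (lam i) :&: \sum_(j | j != i) eigenspace T (lam j))%MS.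
    rewrite sub_capmx scalemx_sub//= cvi eqmx_opp.
    by apply: summx_sub_sums => j _; exact: scalemx_sub.
  have -> : (eigenspace T (lam i) :&: \sum_(j | j != i) eigenspace T (lam j) = 0)%MS.
    by move/mxdirect_sumsP: dx => /(_ i isT).
  by rewrite submx0 scalemx_eq0 (negbTE (vT i).2) orbF => /eqP.
have Punit : P \in unitmx by rewrite -row_free_unit.
have PT : P *m T = diag_mx (\row_i lam i) *m P.
  by apply/row_matrixP => i; rewrite !row_mul rowK (vT i).1 row_diag_mx -scalemxAl -rowE rowK mxE.
exists (fun j => col j (invmx P)), (fun i => row i P); split.
- move=> j; have TP : T *m invmx P = invmx P *m diag_mx (\row_i lam i).
    by rewrite -[in LHS](mulKmx Punit T) PT -mulmxA mulmxK.
  have -> : T *m col j (invmx P) = col j (T *m invmx P) by rewrite !colE mulmxA.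
  by rewrite TP; apply/colP => k; rewrite mxE mul_mx_diag !mxE mulrC.
- by move=> j; rewrite rowK (vT j).1.
- move=> i j; apply/matrixP => a b; rewrite !ord1 mxE.
  transitivity ((P *m invmx P) i j); last by rewrite mulmxV// !mxE eqxx mulr1n.
  by rewrite mxE; apply: eq_bigr => k _; rewrite !mxE.
Qed.

Variables (w : 'rV[C]_n.+1).
Hypotheses (T_col0 : col 0 T = 0) (wT : w *m T = 0) (w0 : w 0 0 = 1).

Let lam0 : lam 0 = 0.
Proof. by have /colP/(_ 0) := T_col0; rewrite !mxE. Qed.

Let e0 : 'cV[C]_n.+1 := delta_mx 0 0.

Let Te0 : T *m e0 = 0. Proof. by rewrite -colE. Qed.

(** A null vector on one side pairs to zero with every eigenvector of nonzero eigenvalue on the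
    other. Hence [e0] and [w] are multiples of [Rv 0] and [Lv 0], and the two factors are mutually
    inverse because [w 0 0 = 1]. *)
Lemma triangular_overlap Rv Lv : injective lam -> biorthogonal_eigenvectors T lam Rv Lv ->
  (Lv 0 *m (Lv 0)^t*) 0 0 * ((Rv 0)^t* *m Rv 0) 0 0 = (w *m w^t*) 0 0.
Proof.
move=> lam_inj [TR LT LR].
pose L : 'M[C]_n.+1 := \matrix_i Lv i.
pose V : 'M[C]_n.+1 := \matrix_(i, j) Rv j i 0.
have LV1 : L *m V = 1%:M.
  apply/matrixP => i j; have /matrixP/(_ 0 0) := LR i j.
  rewrite !mxE eqxx mulr1n => <-; apply: eq_bigr => k _.
  by rewrite !mxE.
have VL1 := mulmx1C LV1.
have VLE : V *m L = \sum_j Rv j *m Lv j.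
  apply/matrixP => i k; rewrite mxE summxE; apply: eq_bigr => j _.
  by rewrite !mxE big_ord1.
have lamN0 j : j != 0 -> lam j != 0.
  by apply: contra => /eqP l0; apply/eqP/lam_inj; rewrite l0 lam0.
have Le0 j : j != 0 -> Lv j *m e0 = 0.
  move=> /lamN0 l0; have := congr1 (mulmx^~ e0) (LT j).
  rewrite -mulmxA Te0 mulmx0 -scalemxAl => /esym/eqP.
  by rewrite scaler_eq0 (negbTE l0) => /eqP.
have wR j : j != 0 -> w *m Rv j = 0.
  move=> /lamN0 l0; have := congr1 (mulmx w) (TR j).
  rewrite mulmxA wT mul0mx -scalemxAr => /esym/eqP.
  by rewrite scaler_eq0 (negbTE l0) => /eqP.
pose a := (Lv 0 *m e0) 0 0; pose b := (w *m Rv 0) 0 0.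
have e0E : e0 = a *: Rv 0.
  rewrite -[LHS]mul1mx -VL1 VLE mulmx_suml (bigD1 0)//= big1 ?addr0; last first.
    by move=> j /Le0 L0; rewrite -mulmxA L0 mulmx0.
  by rewrite -mulmxA [X in _ *m X]mx11_scalar mul_mx_scalar.
have wE : w = b *: Lv 0.
  rewrite -[LHS]mulmx1 -VL1 VLE mulmx_sumr (bigD1 0)//= big1 ?addr0; last first.
    by move=> j /wR R0; rewrite mulmxA R0 mul0mx.
  by rewrite mulmxA [X in X *m _]mx11_scalar mul_scalar_mx.
have ba : b * a = 1.
  have : (w *m e0) 0 0 = 1 by rewrite -colE mxE w0.
  rewrite wE {1}e0E -scalemxAl -scalemxAr scalerA LR mxE [X in _ * X]mxE.
  by rewrite eqxx mulr1n mulr1.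
have ee : (e0^t* *m e0) 0 0 = 1.
  by rewrite -colE !mxE eqxx conjC1.
rewrite -[RHS]mulr1 -ee {1 2}e0E wE !adjmxZ -!scalemxAl -!scalemxAr !scalerA.
rewrite [X in _ = X * _]mxE [X in _ = _ * X]mxE mulrACA.
have -> : b * b^* * (a^* * a) = 1.
  by rewrite (mulrC (a^*)) mulrACA ba -rmorphM/= ba rmorph1 mulr1.
by rewrite mul1r.
Qed.

(** Biorthogonal families of [T] and [G] are carried to each other by [U] with unchanged norms, so
    the set from which [overlap] selects has exactly one element. *)
Lemma overlap_conj_triangular (G U : 'M[C]_n.+1) : U \is unitarymx ->
  G = U *m T *m U^t* -> injective lam -> overlap G lam 0 0 = (w *m w^t*) 0 0.
Proof.
move=> uU GE lam_inj.
have UU : U *m U^t* = 1%:M by exact/unitarymxP.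
have UU' := mulmx1C UU.
apply: xget_unique.
  split=> //; have [Rv [Lv B]] := triangular_biorthogonal lam_inj.
  have [TR LT LR] := B.
  exists (fun j => U *m Rv j), (fun j => Lv j *m U^t*); split.
    split=> [j|j|i j].
    - by rewrite GE -!mulmxA (mulmxA (U^t*)) UU' mul1mx TR scalemxAr.
    - by rewrite GE !mulmxA -(mulmxA (Lv j)) UU' mulmx1 LT scalemxAl.
    - by rewrite mulmxA -(mulmxA (Lv i)) UU' mulmx1 LR.
  rewrite -(triangular_overlap lam_inj B) !adjmxM trmxCK !mulmxA.
  by rewrite -(mulmxA (Lv 0)) UU' mulmx1 -(mulmxA ((Rv 0)^t*)) UU' mulmx1.
move=> o [_ [Rv [Lv [[GR LG LR] ->]]]].
rewrite -(@triangular_overlap (fun j => U^t* *m Rv j) (fun j => Lv j *m U))//.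
  rewrite !adjmxM trmxCK !mulmxA -(mulmxA (Lv 0)) UU mulmx1.
  by rewrite -(mulmxA ((Rv 0)^t*)) UU mulmx1.
have TE : T = U^t* *m G *m U by rewrite GE !mulmxA UU' mul1mx -mulmxA UU' mulmx1.
split=> [j|j|i j].
- by rewrite TE -!mulmxA (mulmxA U) UU mul1mx GR -scalemxAr.
- by rewrite TE !mulmxA -(mulmxA (Lv j)) UU mulmx1 LG -scalemxAl.
- by rewrite mulmxA -(mulmxA (Lv i)) UU mulmx1 LR.
Qed.

End overlap_triangular.

Lemma overlap_noninjective (R : realType) N (G : 'M[R[i]]_N) (lam : 'I_N -> R[i]) i j :
  ~ injective lam -> overlap G lam i j = 0.
Proof. by move=> lamN; apply: xgetPN => o [/lamN]. Qed.

(** * Coordinates on triangular matrices *)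

Section triangular_coordinates.
Context (R : realType).
Local Notation C := R[i].
Local Notation CC := (measurableTypeR R * measurableTypeR R)%type.
Local Notation leb2 := (complex_lebesgue R).
Local Notation X := (nat * nat -> CC).
Implicit Types (x y : X).

(** The test [0 < j] makes column 0 vanish; its only upper triangular entry is the eigenvalue set to
    0. *)
Definition tri x (i j : nat) : C :=
  if (i <= j)%N && (0 < j)%N then complex_of_pair (x (i, j)) else 0.

(** The whole list is carried along because each coordinate depends on all previous ones. *)
Fixpoint bseq x (n : nat) : seq C :=
  if n is m.+1 then
    rcons (bseq x m) (- (\sum_(i < m.+1) nth 0 (bseq x m) i * tri x i m.+1) / tri x m.+1 m.+1)
  else [:: 1].

(* The left null vector of the matrix tri x with first coordinate 1. *)
Definition bvec x (j : nat) : C := nth 0 (bseq x j) j.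

Lemma size_bseq x n : size (bseq x n) = n.+1.
Proof. by elim: n => //= n ih; rewrite size_rcons ih. Qed.

Lemma nth_bseq x n j : (j <= n)%N -> nth 0 (bseq x n) j = bvec x j.
Proof.
elim: n => [|n ih]; first by rewrite leqn0 => /eqP ->.
by rewrite leq_eqVlt => /predU1P[->//|jn]; rewrite /= nth_rcons size_bseq jn ih.
Qed.

Lemma bvec0 x : bvec x 0 = 1. Proof. by []. Qed.

Lemma bvecS x n : bvec x n.+1 =
  - (\sum_(i < n.+1) bvec x i * tri x i n.+1) / tri x n.+1 n.+1.
Proof.
rewrite /bvec /= nth_rcons size_bseq ltnn eqxx; congr (- _ / _).
by apply: eq_bigr => i _; rewrite nth_bseq// -ltnS.
Qed.

(** The equation of column [k > 0] is the recursion that defines [bvec x k], the entries below the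
    diagonal being 0. *)
Lemma bvec_null x n k : (forall j, (0 < j < n)%N -> tri x j j != 0) -> (k < n)%N ->
  \sum_(j < n) bvec x j * tri x j k = 0.
Proof.
move=> l0 kn; case: k => [|k] in kn *.
  by rewrite big1// => j _; rewrite /tri andbF mulr0.
have -> : \sum_(j < n) bvec x j * tri x j k.+1 = \sum_(j < k.+2) bvec x j * tri x j k.+1.
  rewrite [RHS](big_ord_widen n (fun j => bvec x j * tri x j k.+1)) // [RHS]big_mkcond/=.
  apply: eq_bigr => j _; case: ltnP => // jk.
  by rewrite /tri leqNgt jk mulr0.
by rewrite big_ord_recr/= bvecS divfK ?subrr// l0.
Qed.

Lemma eq_tri x y i j : x (i, j) = y (i, j) -> tri x i j = tri y i j.
Proof. by rewrite /tri => ->. Qed.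

Lemma eq_bvec x y j : (forall i k, (k <= j)%N -> x (i, k) = y (i, k)) -> bvec x j = bvec y j.
Proof.
move=> xy; have : forall n, (n <= j)%N -> bseq x n = bseq y n.
  elim=> //= n ih nj; rewrite ih 1?ltnW//; congr rcons; congr (- _ / _).
    by apply: eq_bigr => i _; rewrite (eq_tri (xy _ _ nj)).
  exact/eq_tri/xy.
by rewrite /bvec => ->.
Qed.

Definition ov x n : R := \sum_(j < n) sqnorm (bvec x j).

Lemma sqnorm_ge0 (c : C) : 0 <= sqnorm c.
Proof. by rewrite addr_ge0 ?sqr_ge0. Qed.

Lemma ov_gt0 x n : 0 < ov x n.+1.
Proof.
rewrite /ov big_ord_recl ltr_wpDr//; first by apply: sumr_ge0 => i _; exact: sqnorm_ge0.
by rewrite bvec0 /sqnorm/= expr1n expr0n addr0.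
Qed.

Lemma ov1 x : ov x 1 = 1.
Proof. by rewrite /ov big_ord1 bvec0 /sqnorm/= expr1n expr0n addr0. Qed.

Definition gap x n := contraction_gap (tri x) n.

Lemma gap_hermitian x n : hermitian (gap x n).
Proof. exact: contraction_gap_hermitian. Qed.

Definition gapdens n (p : nat) x : R :=
  if `[< posdef (mxn n (gap x n)) >] then complex.Re (\det (mxn n (gap x n))) ^+ p else 0.

Lemma gapdens_ge0 n p x : 0 <= gapdens n p x.
Proof.
rewrite /gapdens; case: asboolP => // pA.
by rewrite exprn_ge0// ltW// (complex_gt0 (det_mxn_gt0 (gap_hermitian x n) pA)).1.
Qed.

Lemma gapdens1 p x : gapdens 1 p x = 1.
Proof.
have E : mxn 1 (gap x 1) = 1%:M.
  apply/matrixP => i j; rewrite !ord1 !mxE /gap /contraction_gap big_ord1 /tri/=.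
  by rewrite mul0r subr0.
rewrite /gapdens E det1 expr1n; case: asboolP => // -[].
exact: posdef_scalar1.
Qed.

Definition column_gap n x : R :=
  1 - nrm2 (x (n, n)) - complex.Re (qform n (gap x n) (tri x ^~ n)).

(** Positive definiteness and the determinant are governed by the same scalar [column_gap], so one
    [pospow] accounts for both. *)
Lemma gapdensS n p x :
  gapdens n.+2 p x = gapdens n.+1 p x * pospow p (column_gap n.+1 x).
Proof.
have t0 k : (k < n.+1)%N -> tri x n.+1 k = 0 by move=> kn; rewrite /tri leqNgt kn.
have ha := gap_hermitian x n.+1.
have q_real : qform n.+1 (gap x n.+1) (tri x ^~ n.+1) \is Num.real.
  apply: hermitian_form_real.
  by rewrite adjmx_inv mxn_hermitian.
have := posdef_contraction_gapS t0; have := det_contraction_gapS t0.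
rewrite -/(gap x n.+1) -/(gap x n.+2).
have -> : qform n.+1 (gap x n.+1) (tri x ^~ n.+1) + `|tri x n.+1 n.+1| ^+ 2 =
    (1 - column_gap n.+1 x)%:C%C.
  rewrite -(RRe_real q_real) sqnormE -rmorphD/= /column_gap /tri leqnn/=.
  have arith (q s : R) : q + s = 1 - (1 - s - q) by ring.
  by congr (_%:C%C); exact: arith.
have lt1 (c : R) : ((1 - c)%:C%C < 1 :> C) = (0 < c).
  by have -> : (1 : C) = 1%:C%C by []; rewrite ltcR ltrBlDr ltrDl.
rewrite lt1 => detE posE; rewrite /gapdens /pospow.
have [pB|npB] := asboolP (posdef (mxn n.+2 (gap x n.+2))).
  have [pA d0] := posE.1 pB.
  rewrite asboolT// d0 detE// -exprMn; congr (_ ^+ p).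
  rewrite -(rmorphB (real_complex R)) subKr.
  have [_ ->] := complex_gt0 (det_mxn_gt0 ha pA).
  by rewrite -real_complexM.
have [pA|npA] := asboolP (posdef (mxn n.+1 (gap x n.+1))); last by rewrite mul0r.
rewrite ifF ?mulr0//; apply/negP => d0; apply: npB; exact/posE.
Qed.

Section measurability.
Context d (U : measurableType d) (x : U -> X).
Hypothesis mx : forall k, measurable_fun setT (fun u => x u k).

Lemma cmeasurable_tri i j : cmeasurable (fun u => tri (x u) i j).
Proof.
rewrite /tri; case: ((i <= j)%N && (0 < j)%N); last exact: cmeasurable_cst.
exact: cmeasurable_pair.
Qed.

Lemma cmeasurable_bvec j : cmeasurable (fun u => bvec (x u) j).
Proof.
elim/ltn_ind: j => -[_|n ih]; first exact: cmeasurable_cst.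
under eq_fun do rewrite bvecS.
apply: cmeasurableM; last exact/cmeasurableV/cmeasurable_tri.
apply: cmeasurableN; apply: cmeasurable_sum => i.
by apply: cmeasurableM; [exact: ih|exact: cmeasurable_tri].
Qed.

Lemma measurable_ov n : measurable_fun setT (fun u => ov (x u) n).
Proof.
apply: measurable_sum => j; have [m1 m2] := cmeasurable_bvec j.
by apply: measurable_funD; exact: measurable_funX.
Qed.

Lemma measurable_gapdens n p : measurable_fun setT (fun u => gapdens n.+1 p (x u)).
Proof.
elim: n => [|n ih].
  by under eq_fun do rewrite gapdens1; exact: measurable_cst.
under eq_fun do rewrite gapdensS.
apply: measurable_funM => //; apply: (measurableT_comp (measurable_pospow p)).
apply: measurable_funB; last first.
  apply: (cmeasurable_qform n.+1 (a := fun u => gap (x u) n.+1)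
    (t := fun u => tri (x u) ^~ n.+1) _ _).1 => i; last exact: cmeasurable_tri.
  by move=> j; apply: cmeasurable_contraction_gap => k l; exact: cmeasurable_tri.
apply: measurable_funB; first exact: measurable_cst.
exact: (measurableT_comp (@measurable_nrm2 R)).
Qed.

End measurability.

End triangular_coordinates.

(** * Integrating out the strictly upper triangular entries *)

Section column_stage.
Context (R : realType).
Local Notation C := R[i].
Local Notation CC := (measurableTypeR R * measurableTypeR R)%type.
Local Notation leb2 := (complex_lebesgue R).
Local Notation X := (nat * nat -> CC).
Local Open Scope ereal_scope.
Implicit Types (x y : X) (F : measurableTypeR R -> \bar R).
Local Opaque qform lform.

Definition column_keys (n : nat) : seq (nat * nat) := [seq (i, n) | i <- iota 0 n].

Lemma mem_column_keys n i j : ((i, j) \in column_keys n) = (i < n)%N && (j == n).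
Proof.
apply/mapP/andP => [[k]|[ij /eqP ->]].
  by rewrite mem_iota => /andP[_ kn] [-> ->].
by exists i => //; rewrite mem_iota.
Qed.

Lemma sqnormN (c : C) : sqnorm (- c)%R = sqnorm c.
Proof. by rewrite /sqnorm ReN ImN !sqrrN. Qed.

Lemma sqnorm_div (c e : C) : sqnorm (c / e)%R = (sqnorm c / sqnorm e)%R.
Proof.
apply: complexI; rewrite real_complexM -real_complexV -!sqnormE.
by rewrite normrM exprMn normfV exprVn.
Qed.

Lemma sqnorm_eq0 (c : C) : (sqnorm c == 0%R) = (c == 0%R).
Proof. by rewrite paddr_eq0 ?sqr_ge0// !sqrf_eq0 complex_eq0. Qed.

Definition ratio (l s : R) : R := (l / (l + s))%R.

(** [integral_column] is applied with the null vector of the smaller block as [w]; the determinant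
    it releases turns [gapdens m.+1 p] into [gapdens m.+1 p.+1]. The eigenvalues are assumed nonzero
    because the null vector divides by them. *)
Lemma integral_column_stage m p : exists2 k : \bar R, 0 <= k &
  forall F x, measurable_fun setT F -> (forall r, 0 <= F r) ->
  (forall j, (0 < j < m.+1)%N -> tri x j j != 0%R) -> nrm2 (x (m.+1, m.+1)) != 0%R ->
  iint leb2 (column_keys m.+1)
    (fun y => F ((ov y m.+2)^-1)%R * (gapdens m.+2 p y)%:E) x =
  (gapdens m.+1 p.+1 x)%:E * (k * \int[leb2]_z
    (F ((ov x m.+1)^-1 * ratio (nrm2 (x (m.+1, m.+1))) (nrm2 z))%R *
     (pospow (p + m) (1 - nrm2 (x (m.+1, m.+1)) - nrm2 z))%:E)).
Proof.
pose key (i : nat) := (i, m.+1).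
have key_inj : injective key by move=> i j [].
have [k k0 kE] := @integral_column R _ key key_inj m p; exists k => // F x mF F0 xl l0.
set l := nrm2 _ in l0 *.
pose a := gap x m.+1; pose w := bvec x.
pose q y : R := complex.Re (qform m.+1 a (coords key y)).
pose g (s : measurableTypeR R) : \bar R := F ((ov x m.+1 + (s : R) / l)^-1)%R.
have agree y : (forall k, k \notin column_keys m.+1 -> y k = x k) ->
  F ((ov y m.+2)^-1)%R * (gapdens m.+2 p y)%:E =
  (gapdens m.+1 p x)%:E * (g (sqnorm (\sum_(j < m.+1) w j * coords key y j)%R) *
    (pospow p (1 - l - q y))%:E).
  move=> yx.
  have yx' i j : (j <= m)%N -> y (i, j) = x (i, j).
    by move=> jm; apply: yx; rewrite mem_column_keys ltn_eqF ?andbF.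
  have gE : gap y m.+1 = gap x m.+1.
    apply/funext => i; apply/funext => j; congr (_ - _)%R; apply: eq_bigr => c _.
    have cm : (c <= m)%N by rewrite -ltnS.
    by rewrite (eq_tri (yx' i c cm)) (eq_tri (yx' j c cm)).
  have bE j : (j <= m)%N -> bvec y j = bvec x j.
    by move=> jm; apply: eq_bvec => i c cj; rewrite yx'// (leq_trans cj).
  have oE : ov y m.+1 = ov x m.+1.
    apply: eq_bigr => j _; have jm : (j <= m)%N by rewrite -ltnS.
    by rewrite (bE j jm).
  have tE j : (j <= m.+1)%N -> tri y j m.+1 = coords key y j.
    by move=> jm; rewrite /tri jm.
  have lE : nrm2 (y (m.+1, m.+1)) = l.
    by rewrite yx// mem_column_keys ltnn.
  have -> : ov y m.+2 = (ov x m.+1 + sqnorm (\sum_(j < m.+1) w j * coords key y j) / l)%R.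
    rewrite /ov big_ord_recr/= -[X in (X + _)%R]/(ov y m.+1) oE; congr (_ + _)%R.
    rewrite bvecS sqnorm_div sqnormN -lE; congr (sqnorm _ / _)%R.
      apply: eq_bigr => j _; have jm : (j <= m)%N by rewrite -ltnS.
      by rewrite (bE j jm) (tE j (leqW jm)).
    by rewrite /tri leqnn.
  have dE : gapdens m.+1 p y = gapdens m.+1 p x by rewrite /gapdens gE.
  have -> : gapdens m.+2 p y = (gapdens m.+1 p x * pospow p (1 - l - q y))%R.
    rewrite gapdensS dE /column_gap lE gE /q -/a.
    rewrite (eq_qform a (t' := coords key y))// => i im.
    by rewrite (tE i (ltnW im)).
  by rewrite EFinM muleCA.
rewrite (eq_iint leb2 agree).
have mg : measurable_fun setT g.
  by apply: (measurableT_comp mF); apply: measurable_inv; msolve.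
rewrite iintZl; last 3 first.
- exact: pmeasurable_column_fun.
- by move=> y; rewrite mule_ge0// ?F0// lee_fin pospow_ge0.
- by rewrite lee_fin gapdens_ge0.
have [pa|npa] := asboolP (posdef (mxn m.+1 a)); last first.
  by rewrite /gapdens asboolF// !mul0e.
rewrite [X in _ * X](kE g a w (1 - l)%R x mg (fun s => F0 _) (gap_hermitian x m.+1) pa (bvec0 x)).
have -> : complex.Re (shear_conj m w a 0%N 0%N) = ov x m.+1.
  rewrite /a /gap shear_conj_gap; last by move=> c cm; exact: bvec_null.
  rewrite /ov (eq_bigr (fun j : 'I_m.+1 => (sqnorm (w j))%:C%C)); last first.
    by move=> j _; rewrite sqnormE.
  by rewrite -rmorph_sum.
rewrite !muleA /gapdens asboolT// -EFinM -exprSr; congr (_ * _ * _).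
apply: eq_integral => z _; congr (F _ * _).
have o0 := ov_gt0 x m.
rewrite /ratio.
have s0 : (l + nrm2 z != 0 :> R)%R.
  by rewrite paddr_eq0 ?nrm2_ge0// negb_and l0.
rewrite (_ : (_ + _)%R = (ov x m.+1 * ((l + nrm2 z) / l))%R); first by rewrite invfM invf_div.
by rewrite mulrDl mulfV// mulrDr mulr1 mulrA.
Qed.

End column_stage.

Section stages.
Context (R : realType).
Local Notation C := R[i].
Local Notation CC := (measurableTypeR R * measurableTypeR R)%type.
Local Notation leb2 := (complex_lebesgue R).
Local Notation X := (nat * nat -> CC).
Local Open Scope ereal_scope.
Implicit Types (x y : X) (F : measurableTypeR R -> \bar R).

Fixpoint upper_keys m : seq (nat * nat) :=
  if m is n.+1 then upper_keys n ++ column_keys n.+1 else [::].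

Definition top_keys m : seq (nat * nat) := [seq (0%N, j) | j <- iota 1 m].

Definition diag_keys m : seq (nat * nat) := [seq (j, j) | j <- iota 1 m].

Definition ratios m y : R :=
  (\prod_(1 <= j < m.+1) ratio (nrm2 (y (j, j))) (nrm2 (y (0%N, j))))%R.

Definition pospows q m y : R :=
  (\prod_(1 <= j < m.+1) pospow q (1 - nrm2 (y (j, j)) - nrm2 (y (0%N, j))))%R.

Lemma mem_upper_keys m i j : ((i, j) \in upper_keys m) = (i < j <= m)%N.
Proof.
elim: m => [|m ih] /=; first by rewrite in_nil; lia.
by rewrite mem_cat ih mem_column_keys; lia.
Qed.

Lemma mem_diag_keys m i j : ((i, j) \in diag_keys m) = (i == j) && (0 < i <= m)%N.
Proof.
apply/mapP/idP => [[k]|/andP[/eqP <- im]].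
  by rewrite mem_iota => km [-> ->]; lia.
by exists i => //; rewrite mem_iota; lia.
Qed.

Lemma mem_top_keys m i j : ((i, j) \in top_keys m) = (i == 0%N) && (0 < j <= m)%N.
Proof.
apply/mapP/idP => [[k]|/andP[/eqP -> im]].
  by rewrite mem_iota => km [-> ->]; lia.
by exists j => //; rewrite mem_iota; lia.
Qed.

Lemma top_keysS m : top_keys m.+1 = rcons (top_keys m) (0%N, m.+1).
Proof. by rewrite /top_keys -(addn1 m) iotaD map_cat cats1 add1n addn1. Qed.

Lemma diag_keysS m : diag_keys m.+1 = rcons (diag_keys m) (m.+1, m.+1).
Proof. by rewrite /diag_keys -(addn1 m) iotaD map_cat cats1 add1n addn1. Qed.

Lemma pospows_ge0 q m y : (0 <= pospows q m y)%R.
Proof. by apply: prodr_ge0 => j _; exact: pospow_ge0. Qed.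

Lemma ratiosS m y : ratios m.+1 y =
  (ratios m y * ratio (nrm2 (y (m.+1, m.+1))) (nrm2 (y (0%N, m.+1))))%R.
Proof. by rewrite /ratios big_nat_recr. Qed.

Lemma pospowsS q m y : pospows q m.+1 y =
  (pospows q m y * pospow q (1 - nrm2 (y (m.+1, m.+1)) - nrm2 (y (0%N, m.+1))))%R.
Proof. by rewrite /pospows big_nat_recr. Qed.

Lemma eq_ratios m y y' : (forall j, (0 < j <= m)%N -> nrm2 (y (j, j)) = nrm2 (y' (j, j))) ->
  (forall j, (0 < j <= m)%N -> y (0%N, j) = y' (0%N, j)) -> ratios m y = ratios m y'.
Proof. by move=> h1 h2; rewrite /ratios; apply: eq_big_nat => j jm; rewrite h1 ?h2. Qed.

Lemma eq_pospows q m y y' : (forall j, (0 < j <= m)%N -> nrm2 (y (j, j)) = nrm2 (y' (j, j))) ->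
  (forall j, (0 < j <= m)%N -> y (0%N, j) = y' (0%N, j)) -> pospows q m y = pospows q m y'.
Proof. by move=> h1 h2; rewrite /pospows; apply: eq_big_nat => j jm; rewrite h1 ?h2. Qed.

Section measurability.
Context d (U : measurableType d) (x : U -> X).
Hypothesis mx : forall k, measurable_fun setT (fun u => x u k).

Lemma measurable_nrm2_key k : measurable_fun setT (fun u => nrm2 (x u k)).
Proof. exact: (measurableT_comp (@measurable_nrm2 R) (mx k)). Qed.

Lemma measurable_ratios m : measurable_fun setT (fun u => ratios m (x u)).
Proof.
elim: m => [|m ih].
  by rewrite (_ : (fun _ => _) = cst 1%R)//; apply/funext => u; rewrite /ratios big_geq.
under eq_fun do rewrite ratiosS.
have h1 := measurable_nrm2_key (m.+1, m.+1).
have h2 := measurable_nrm2_key (0%N, m.+1).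
apply: measurable_funM => //; apply: measurable_funM => //.
by apply: measurable_inv; exact: measurable_funD.
Qed.

Lemma measurable_pospows q m : measurable_fun setT (fun u => pospows q m (x u)).
Proof.
elim: m => [|m ih].
  by rewrite (_ : (fun _ => _) = cst 1%R)//; apply/funext => u; rewrite /pospows big_geq.
under eq_fun do rewrite pospowsS.
have h1 := measurable_nrm2_key (m.+1, m.+1).
have h2 := measurable_nrm2_key (0%N, m.+1).
apply: measurable_funM => //; apply: (measurableT_comp (measurable_pospow q)); msolve.
Qed.

End measurability.

Lemma pmeasurable_comp F (f : X -> R) : measurable_fun setT F ->
  pmeasurable (f : X -> measurableTypeR R) -> pmeasurable (F \o f).
Proof. by move=> mF mf d U x mx; exact: (measurableT_comp mF (mf _ _ _ mx)). Qed.

Lemma pmeasurableM (K : eqType) d (T : measurableType d) (f g : (K -> T) -> \bar R) :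
  pmeasurable f -> pmeasurable g -> pmeasurable (fun y : K -> T => f y * g y).
Proof. by move=> mf mg d1 U x mx; apply: emeasurable_funM; [exact: mf|exact: mg]. Qed.

Definition pair_weight F q m y : \bar R := F (ratios m y) * (pospows q m y)%:E.

Lemma pair_weight_ge0 F q m y : (forall r, 0 <= F r) -> 0 <= pair_weight F q m y.
Proof. by move=> F0; rewrite mule_ge0// lee_fin pospows_ge0. Qed.

Lemma pmeasurable_pair_weight F q m : measurable_fun setT F -> pmeasurable (pair_weight F q m).
Proof.
move=> mF; apply: pmeasurableM.
  apply: pmeasurable_comp => //; move=> d U x mx; exact: measurable_ratios.
by move=> d U x mx; apply/measurable_EFinP; exact: measurable_pospows.
Qed.

Definition upper_weight F p m y : \bar R := F ((ov y m.+1)^-1)%R * (gapdens m.+1 p y)%:E.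

Lemma upper_weight_ge0 F p m y : (forall r, 0 <= F r) -> 0 <= upper_weight F p m y.
Proof. by move=> F0; rewrite mule_ge0// lee_fin gapdens_ge0. Qed.

Lemma pmeasurable_upper_weight F p m : measurable_fun setT F -> pmeasurable (upper_weight F p m).
Proof.
move=> mF; apply: pmeasurableM.
  apply: (pmeasurable_comp (f := fun y => (ov y m.+1)^-1%R)) => //; move=> d U x mx.
  by apply: measurable_inv; exact: measurable_ov.
by move=> d U x mx; apply/measurable_EFinP; exact: measurable_gapdens.
Qed.

(** Induction from the last column, for all [F] at once: the variable left by that column is
    absorbed into a new test function [G], to which the induction hypothesis applies. The sum
    [p + m] is invariant, which is why one power [q] serves all columns. *)
Lemma integral_upper m p q : (p + m = q.+1)%N -> exists2 k : \bar R, 0 <= k &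
  forall F x, measurable_fun setT F -> (forall r, 0 <= F r) ->
  (forall j, (0 < j <= m)%N -> nrm2 (x (j, j)) != 0%R) ->
  iint leb2 (upper_keys m) (upper_weight F p m) x =
  k * iint leb2 (top_keys m) (pair_weight F q m) x.
Proof.
elim: m p => [|m ih] p pq.
  exists 1 => // F x mF F0 _; rewrite /= /upper_weight /pair_weight mul1e ov1 gapdens1.
  by rewrite /ratios /pospows !big_geq// invr1.
have {}pq : (p + m = q)%N by move: pq; rewrite addnS => -[].
have [k k0 kE] := integral_column_stage R m p.
have [//|k' k'0 k'E] := ih p.+1; first by rewrite addSn pq.
exists (k * k') => [|F x mF F0 l0]; first exact: mule_ge0.
set l := nrm2 (x (m.+1, m.+1)).
pose G (u : measurableTypeR R) : \bar R := \int[leb2]_z (F ((u : R) * ratio l (nrm2 z))%R *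
     (pospow q (1 - l - nrm2 z))%:E).
have mH : measurable_fun setT (fun p : measurableTypeR R * CC =>
    F ((p.1 : R) * ratio l (nrm2 p.2))%R * (pospow q (1 - l - nrm2 p.2))%:E).
  have m2 : measurable_fun setT (fun p : measurableTypeR R * CC => nrm2 p.2).
    exact: (measurableT_comp (@measurable_nrm2 R) measurable_snd).
  apply: emeasurable_funM; first by apply: (measurableT_comp mF); rewrite /ratio; msolve.
  by apply/measurable_EFinP; apply: (measurableT_comp (measurable_pospow q)); msolve.
have H0 (v : measurableTypeR R * CC) :
    0 <= F ((v.1 : R) * ratio l (nrm2 v.2))%R * (pospow q (1 - l - nrm2 v.2))%:E.
  by rewrite mule_ge0// lee_fin pospow_ge0.
have mG : measurable_fun setT G by exact: (measurable_fun_fubini_tonelli_F _ mH H0).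
have G0 u : 0 <= G u by apply: integral_ge0 => z _; exact: (H0 (u, z)).
rewrite [upper_keys _]/= iint_cat.
have diagE y : (forall k, k \notin upper_keys m -> y k = x k) ->
    forall j, (0 < j <= m.+1)%N -> y (j, j) = x (j, j).
  by move=> yx j jm; rewrite yx// mem_upper_keys; lia.
transitivity (iint leb2 (upper_keys m) (fun y => k * upper_weight G p.+1 m y) x).
  apply: eq_iint => y /diagE yx.
  transitivity ((gapdens m.+1 p.+1 y)%:E * (k * \int[leb2]_z
    (F ((ov y m.+1)^-1 * ratio (nrm2 (y (m.+1, m.+1))) (nrm2 z))%R *
     (pospow (p + m) (1 - nrm2 (y (m.+1, m.+1)) - nrm2 z))%:E))).
    apply: (kE F y mF F0); last by rewrite yx ?l0//; lia.
    move=> j jm; have j' : (0 < j <= m.+1)%N by lia.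
    by rewrite -sqnorm_eq0 /tri leqnn; case/andP: jm => -> _ /=; rewrite -/(nrm2 _) yx ?l0.
  rewrite pq yx; last by lia.
  by rewrite /upper_weight -/l muleCA (muleC (G _)).
rewrite (iintZl leb2 _ _ (pmeasurable_upper_weight p.+1 m mG)
  (fun y => upper_weight_ge0 p.+1 m y G0) k0).
rewrite (k'E G x mG G0); last by move=> j jm; apply: l0; lia.
rewrite muleA; congr (_ * _).
rewrite top_keysS -cats1 iint_cat; apply: eq_iint => y yx /=.
have ly : nrm2 (y (m.+1, m.+1)) = l by rewrite yx// mem_top_keys.
rewrite /pair_weight muleC /G -ge0_integralZl//; last 3 first.
- exact: (measurable_curry1 (f := fun (a : measurableTypeR R) (z : CC) =>
    F ((a : R) * ratio l (nrm2 z))%R * (pospow q (1 - l - nrm2 z))%:E) _ mH).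
- by move=> z _; exact: (H0 (_, z)).
- by rewrite lee_fin pospows_ge0.
apply: eq_integral => z _; rewrite ratiosS pospowsS.
set y1 := update _ _ _.
have y1E j : y1 (j.+1, j.+1) = y (j.+1, j.+1) by [].
have y1z : y1 (0%N, m.+1) = z by rewrite /y1 /update eqxx.
have y1t j : (0 < j <= m)%N -> y1 (0%N, j) = y (0%N, j).
  by move=> jm; rewrite /y1 /update; case: eqP => // -[jE]; lia.
rewrite y1z y1E ly (eq_ratios (y := y1) (y' := y)) ?(eq_pospows q (y := y1) (y' := y))//.
- by rewrite EFinM muleCA.
- by case.
- by case.
Qed.

End stages.

(** * Averaging the Vandermonde factor *)

(** The polynomial [X^L - 1] splits with simple roots, and its [L] roots form a cyclic group. *)
Lemma primitive_root_exists (C : numClosedFieldType) L : (0 < L)%N ->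
  exists w : C, L.-primitive_root w.
Proof.
move=> L0; pose p : {poly C} := 'X^L - 1; have [r Dp] := closed_field_poly_normal p.
rewrite (monicP _) ?monicXnsubC// scale1r in Dp.
have rL : all L.-unity_root r by apply/allP => z; rewrite -root_prod_XsubC -Dp.
have sz_r : (L < (size r).+1)%N by rewrite -(size_prod_XsubC r id) -Dp size_XnsubC.
have [|z] := hasP (cyclic.has_prim_root L0 rL _ sz_r); last by exists z.
by rewrite -separable.separable_prod_XsubC -Dp cyclotomic.separable_Xn_sub_1// pnatr_eq0 -lt0n.
Qed.

Section vandermonde_weight.
Context (R : realType).
Local Notation C := R[i].
Local Notation CC := (measurableTypeR R * measurableTypeR R)%type.
Local Notation leb2 := (complex_lebesgue R).
Local Notation X := (nat * nat -> CC).
Implicit Types (x y : X) (F : measurableTypeR R -> \bar R).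

Definition vandermonde_weight m y : R :=
  \prod_(i < m.+1) \prod_(j < m.+1 | (i < j)%N) sqnorm (tri y i i - tri y j j).

Lemma vandermonde_weight_ge0 m y : 0 <= vandermonde_weight m y.
Proof. by apply: prodr_ge0 => i _; apply: prodr_ge0 => j _; exact: sqnorm_ge0. Qed.

Lemma pmeasurable_vandermonde_weight m d (U : measurableType d) (x : U -> X) :
  (forall k, measurable_fun setT (fun u => x u k)) ->
  measurable_fun setT (fun u => vandermonde_weight m (x u)).
Proof.
move=> mx; apply: measurable_prod => i _.
under eq_fun do rewrite big_mkcond/=.
apply: measurable_prod => j _; case: (i < j)%N; last exact: measurable_cst.
have [m1 m2] := cmeasurableD (cmeasurable_tri mx i i) (cmeasurableN (cmeasurable_tri mx j j)).
by apply: measurable_funD; exact: measurable_funX.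
Qed.

Lemma tri_diag y j : tri y j.+1 j.+1 = complex_of_pair (y (j.+1, j.+1)).
Proof. by rewrite /tri leqnn. Qed.

(** The pairs that contain index 0 give the squared moduli of the other eigenvalues, because
    [tri y 0 0 = 0]. This shifts all exponents up by one. *)
Lemma vandermonde_weightE m y : (vandermonde_weight m y)%:C%C =
  (\prod_(j < m) `|complex_of_pair (y (j.+1, j.+1))| ^+ 2) *
  `|\det (\matrix_(j < m, i < m) complex_of_pair (y (j.+1, j.+1)) ^+ i)| ^+ 2.
Proof.
rewrite /vandermonde_weight rmorph_prod/= big_ord_recl; congr (_ * _).
  rewrite rmorph_prod big_mkcond big_ord_recl/= mul1r; apply: eq_bigr => j _.
  by rewrite /= -sqnormE tri_diag /tri/= sub0r normrN.
rewrite -det_tr (_ : _^T = Vandermonde m (\row_j complex_of_pair (y (j.+1, j.+1)))); last first.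
  by apply/matrixP => i j; rewrite !mxE.
rewrite det_Vandermonde normr_prod -prodrXl; apply: eq_bigr => i _.
rewrite normr_prod -prodrXl rmorph_prod big_mkcond big_ord_recl/= mul1r -big_mkcond/=.
by apply: eq_bigr => j _; rewrite -sqnormE !tri_diag !mxE distrC.
Qed.

(* Averaging over rotations of the eigenvalues by roots of unity cancels the
   cross terms of |Vandermonde|^2 while every integrand stays nonnegative. *)
Definition diag_rotate m (u : nat -> C) (k : nat * nat) (z : CC) : CC :=
  if (k.1 == k.2) && (0 < k.1 <= m)%N then rotate (complex.Re (u k.1)) (complex.Im (u k.1)) z
  else z.

Lemma diag_rotate_diag m u j z : (j < m)%N ->
  complex_of_pair (diag_rotate m u (j.+1, j.+1) z) = u j.+1 * complex_of_pair z.
Proof.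
move=> jm; rewrite /diag_rotate eqxx/= jm; case: (u j.+1) => a b.
by rewrite /complex_of_pair /rotate/=; simpc; congr (_ +i* _)%C; rewrite addrC.
Qed.

Lemma diag_rotate_vandermonde_average m L (w : C) y : L.-primitive_root w -> (m <= L)%N ->
  \sum_(a : {ffun 'I_m -> 'I_L}) vandermonde_weight m (fun k =>
     diag_rotate m (fun j => if insub j.-1 is Some i then w ^+ a i else 1) k (y k)) =
  L%:R ^+ m * \sum_(s : {perm 'I_m}) \prod_(j < m) nrm2 (y (j.+1, j.+1)) ^+ (s j).+1.
Proof.
move=> wL mL; apply: complexI; rewrite rmorph_sum/=.
have L0 : (0 < L)%N := prim_order_gt0 wL.
have w1 a : `|w ^+ a| = 1 by rewrite normrX (primitive_root_norm1 L0 wL) expr1n.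
pose lam (j : 'I_m) := complex_of_pair (y (j.+1, j.+1)).
pose e : C := \prod_(j < m) `|lam j| ^+ 2.
transitivity (\sum_(a : {ffun 'I_m -> 'I_L})
    e * `|\det (\matrix_(j < m, i < m) (w ^+ a j * lam j) ^+ i)| ^+ 2).
  apply: eq_bigr => a _; rewrite vandermonde_weightE.
  have E (j : 'I_m) : complex_of_pair (diag_rotate m
      (fun j => if insub j.-1 is Some i then w ^+ a i else 1) (j.+1, j.+1) (y (j.+1, j.+1))) =
      w ^+ a j * lam j.
    by rewrite diag_rotate_diag// /= valK.
  congr (_ * _).
    by apply: eq_bigr => j _; rewrite E normrM w1 mul1r.
  by congr (`|\det _| ^+ 2); apply/matrixP => j i; rewrite !mxE E.
rewrite -mulr_sumr (vandermonde_average lam wL mL) mulrCA !rmorphM/= rmorphXn/= rmorph_nat.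
congr (_ * _); rewrite rmorph_sum mulr_sumr; apply: eq_bigr => s _.
rewrite rmorph_prod -big_split/=; apply: eq_bigr => j _.
by rewrite -exprS normC_pair rmorphXn.
Qed.

End vandermonde_weight.

Section vandermonde_integral.
Context (R : realType).
Local Notation C := R[i].
Local Notation CC := (measurableTypeR R * measurableTypeR R)%type.
Local Notation leb2 := (complex_lebesgue R).
Local Notation X := (nat * nat -> CC).
Local Open Scope ereal_scope.
Implicit Types (x y : X) (F : measurableTypeR R -> \bar R).

Definition diag_power m (e : nat -> nat) y : R :=
  (\prod_(j < m) (nrm2 (y (j.+1, j.+1)) : R) ^+ e j)%R.

Lemma diag_power_ge0 m e y : (0 <= diag_power m e y)%R.
Proof. by apply: prodr_ge0 => j _; rewrite exprn_ge0// nrm2_ge0. Qed.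

Lemma pmeasurable_diag_power m e d (U : measurableType d) (x : U -> X) :
  (forall k, measurable_fun setT (fun u => x u k)) ->
  measurable_fun setT (fun u => diag_power m e (x u)).
Proof.
move=> mx; apply: measurable_prod => j _; apply: measurable_funX.
exact: (measurable_nrm2_key mx (j.+1, j.+1)).
Qed.

Definition weighted (f : X -> R) (W : X -> \bar R) : X -> \bar R := fun y => (f y)%:E * W y.

Lemma pmeasurable_weighted (f : X -> R) (W : X -> \bar R) :
  pmeasurable (f : X -> measurableTypeR R) -> pmeasurable W -> pmeasurable (weighted f W).
Proof.
by move=> mf mW; apply: pmeasurableM => // d U x mx; apply/measurable_EFinP; exact: mf.
Qed.

Lemma nrm2_diag_rotate m (u : nat -> C) k z : (forall j, `|u j| = 1)%R ->
  nrm2 (diag_rotate m u k z) = nrm2 z.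
Proof.
move=> u1; rewrite /diag_rotate; case: ifP => // _.
have : (complex.Re (u k.1) ^+ 2 + complex.Im (u k.1) ^+ 2 = 1)%R.
  by apply: complexI; rewrite /= add_Re2_Im2 u1 expr1n.
move: (complex.Re _) (complex.Im _) => a b ab; rewrite /nrm2/=.
rewrite -[RHS]mul1r -ab; ring.
Qed.

(** The pair weight does not see the phases of the diagonal, so the integral equals its mean over
    the [L ^+ m] rotations by roots of unity. The diagonal keys must belong to [s] for these
    rotations to preserve the integral. *)
Lemma integral_vandermonde_weight m q F s x : measurable_fun setT F -> (forall r, 0 <= F r) ->
  (forall j, (0 < j <= m)%N -> (j, j) \in s) ->
  iint leb2 s (weighted (vandermonde_weight m) (pair_weight F q m)) x =
  \sum_(t : {perm 'I_m}) iint leb2 s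
    (weighted (diag_power m (fun j => oapp (fun i => (t i).+1) 0%N (insub j)))
      (pair_weight F q m)) x.
Proof.
move=> mF F0 sm.
(* The order [m.+1] exceeds the exponents, which are below [m], and is positive even for [m = 0]. *)
have [w wL] := primitive_root_exists C (ltn0Sn m); set L := m.+1 in wL.
pose u (a : {ffun 'I_m -> 'I_L}) (j : nat) : C := (if insub j.-1 is Some i then w ^+ a i else 1)%R.
have u1 a j : (`|u a j| = 1)%R.
  rewrite /u; case: insub => [i|]; last by rewrite normr1.
  by rewrite normrX (primitive_root_norm1 _ wL)// expr1n.
have uu a j : (complex.Re (u a j) ^+ 2 + complex.Im (u a j) ^+ 2 = 1)%R.
  by apply: complexI; rewrite /= add_Re2_Im2 u1 expr1n.
pose rot a y : X := fun k => diag_rotate m (u a) k (y k).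
pose W := pair_weight F q m.
have Wrot a y : W (rot a y) = W y.
  have h1 j : (0 < j <= m)%N -> nrm2 (rot a y (j, j)) = nrm2 (y (j, j)).
    by move=> _; exact: nrm2_diag_rotate.
  have h2 j : (0 < j <= m)%N -> rot a y (0%N, j) = y (0%N, j).
    by case: j.
  by rewrite /W /pair_weight (eq_ratios h1 h2) (eq_pospows q h1 h2).
have mW : pmeasurable W by exact: pmeasurable_pair_weight.
have W0 y : 0 <= W y by exact: pair_weight_ge0.
pose V := vandermonde_weight (R := R) m.
have mVW : pmeasurable (weighted V W).
  by apply: pmeasurable_weighted => // d U y my; exact: pmeasurable_vandermonde_weight.
have VW0 y : 0 <= weighted V W y by rewrite mule_ge0// lee_fin vandermonde_weight_ge0.
have rotE a : iint leb2 s (weighted V W) x = iint leb2 s (fun y => weighted V W (rot a y)) x.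
  rewrite (@iint_map _ _ _ _ leb2 s (diag_rotate m (u a)) _ x mVW VW0); last 2 first.
  - move=> k; rewrite /diag_rotate; case: (_ && _); last exact: measurable_id.
    exact: measurable_rotate.
  - move=> k f mf f0; rewrite /diag_rotate; case: (_ && _) => //.
    exact: ge0_integral_rotate.
  apply: iint_agree => -[i j] ks; rewrite /diag_rotate/=; case: ifP => // /andP[/eqP ij im].
  by rewrite -ij sm in ks.
pose g (t : {perm 'I_m}) j := oapp (fun i => (t i).+1) 0%N (insub j).
have avg y : \sum_(a : {ffun 'I_m -> 'I_L}) weighted V W (rot a y) =
    (L%:R ^+ m)%:E * \sum_(t : {perm 'I_m}) weighted (diag_power m (g t)) W y.
  under eq_bigr do rewrite /weighted Wrot.
  rewrite -ge0_sume_distrl; last by move=> a _; rewrite lee_fin vandermonde_weight_ge0.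
  rewrite -ge0_sume_distrl; last by move=> t _; rewrite lee_fin diag_power_ge0.
  rewrite !sumEFin (diag_rotate_vandermonde_average y wL (leqnSn m)) [RHS]muleA -EFinM.
  congr ((_ * _)%:E * _); apply: eq_bigr => t _; apply: eq_bigr => j _.
  by rewrite /g valK.
have mD t : pmeasurable (weighted (diag_power m (g t)) W).
  by apply: pmeasurable_weighted => // d U y my; exact: pmeasurable_diag_power.
have D0 t y : 0 <= weighted (diag_power m (g t)) W y.
  by rewrite mule_ge0// lee_fin diag_power_ge0.
have card : (\sum_(a : {ffun 'I_m -> 'I_L}) 1 = L%:R ^+ m :> R)%R.
  by rewrite sumr_const card_ffun !card_ord natrX.
have L0 : (0 < L%:R ^+ m :> R)%R by rewrite exprn_gt0// ltr0n.
have cancel (a b : \bar R) : (L%:R ^+ m)%:E * a = (L%:R ^+ m)%:E * b -> a = b.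
  move=> /(congr1 (fun c => ((L%:R ^+ m)^-1)%:E * c)).
  by rewrite !muleA -!EFinM mulVf ?gt_eqF// !mul1e.
apply: cancel.
rewrite -[in LHS]card -sumEFin ge0_sume_distrl; last by move=> a _; rewrite lee_fin.
under eq_bigr => a _ do rewrite mul1e (rotE a).
rewrite -iint_sum//; last by move=> a d U y my; apply: mVW => k;
   rewrite /rot/=; apply: measurableT_comp (my k); rewrite /diag_rotate;
   case: (_ && _) => //; exact: measurable_rotate.
under eq_iint do rewrite avg.
rewrite (iintZl leb2 s
  (F := fun y => \sum_(t : {perm 'I_m}) weighted (diag_power m (g t)) W y) x); last 3 first.
- by move=> d U y my; apply: emeasurable_sum => t; exact: mD.
- by move=> y; apply: sume_ge0 => t _.
- by rewrite lee_fin ltW.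
by rewrite iint_sum.
Qed.

End vandermonde_integral.

(** * Independent pairs of an eigenvalue and a free variable *)

Section pairs.
Context (R : realType).
Local Notation CC := (measurableTypeR R * measurableTypeR R)%type.
Local Notation leb2 := (complex_lebesgue R).
Local Notation X := (nat * nat -> CC).
Local Open Scope ereal_scope.
Implicit Types (x y : X) (F : measurableTypeR R -> \bar R).

Fixpoint pair_keys m : seq (nat * nat) :=
  if m is n.+1 then pair_keys n ++ [:: (n.+1, n.+1); (0%N, n.+1)] else [::].

Lemma perm_pair_keys m : perm_eq (diag_keys m ++ top_keys m) (pair_keys m).
Proof.
elim: m => [//|m ih]; rewrite [pair_keys _]/= diag_keysS top_keysS -!cats1 perm_catACA.
by rewrite perm_cat2r.
Qed.

(** The last pair is innermost: [ge0_integral_dirichlet] replaces it by one more average of [F], in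
    which the product of the previous ratios is the scale [o]. *)
Lemma integral_pair_keys m e q : exists2 k : \bar R, 0 <= k &
  forall F x, measurable_fun setT F -> (forall r, 0 <= F r) ->
  iint leb2 (pair_keys m) (weighted (diag_power m e) (pair_weight F q m)) x =
  k * pow_averages [seq e j | j <- iota 0 m] F 1%R.
Proof.
elim: m => [|m [k' k'0 k'E]].
  exists 1 => // F x mF F0 /=.
  rewrite /weighted /diag_power big_ord0 /pair_weight /ratios /pospows !big_geq//.
  by rewrite !mul1e mule1.
have [k k0 kE] := ge0_integral_dirichlet R (e m) q.
exists (k * k') => [|F x mF F0]; first exact: mule_ge0.
have mA := measurable_pow_average (e m) mF F0.
have A0 r := pow_average_ge0 (e m) r F0.
rewrite [pair_keys _]/= iint_cat.
transitivity (iint leb2 (pair_keys m) (fun y => k *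
    weighted (diag_power m e) (pair_weight (pow_average (e m) F) q m) y) x).
  apply: eq_iint => y _ /=.
  pose c := (diag_power m e y * pospows q m y)%R.
  have c0 : (0 <= c)%R by rewrite mulr_ge0 ?diag_power_ge0 ?pospows_ge0.
  pose H (u z : CC) := ((nrm2 u : R) ^+ e m * pospow q (1 - nrm2 u - nrm2 z))%:E *
      F (ratios m y * (nrm2 u / (nrm2 u + nrm2 z)))%R.
  have mH : measurable_fun setT (fun p : CC * CC => H p.1 p.2).
    have m1 : measurable_fun setT (fun p : CC * CC => nrm2 p.1).
      exact: (measurableT_comp (@measurable_nrm2 R) measurable_fst).
    have m2 : measurable_fun setT (fun p : CC * CC => nrm2 p.2).
      exact: (measurableT_comp (@measurable_nrm2 R) measurable_snd).
    apply: emeasurable_funM; last by apply: (measurableT_comp mF); msolve.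
    apply/measurable_EFinP; apply: measurable_funM; first exact: measurable_funX.
    by apply: (measurableT_comp (measurable_pospow q)); msolve.
  have H0 u z : 0 <= H u z.
    by rewrite mule_ge0// lee_fin mulr_ge0 ?pospow_ge0// exprn_ge0// nrm2_ge0.
  transitivity (\int[leb2]_u \int[leb2]_z (c%:E * H u z)).
    apply: eq_integral => u _; apply: eq_integral => z _.
    set y1 := update _ _ _.
    have y1u : y1 (m.+1, m.+1) = u by rewrite /y1 /update eqxx.
    have y1z : y1 (0%N, m.+1) = z by rewrite /y1 /update eqxx.
    have y1E i j : (j <= m)%N -> y1 (i, j) = y (i, j).
      by move=> jm; rewrite /y1 /update; do 2 (case: eqP => [[_ ?]|_]; first by lia).
    have dE : diag_power m e y1 = diag_power m e y.
      apply: eq_bigr => j _; have jm : (j.+1 <= m)%N by [].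
      by rewrite (y1E _ _ jm).
    have h1 j : (0 < j <= m)%N -> nrm2 (y1 (j, j)) = nrm2 (y (j, j)).
      by move=> /andP[_ jm]; rewrite (y1E _ _ jm).
    have h2 j : (0 < j <= m)%N -> y1 (0%N, j) = y (0%N, j).
      by move=> /andP[_ jm]; rewrite (y1E _ _ jm).
    rewrite /weighted /pair_weight ratiosS pospowsS y1u y1z (eq_ratios h1 h2) (eq_pospows q h1 h2).
    rewrite [diag_power m.+1 e y1]big_ord_recr/= -/(diag_power m e y1) dE y1u.
    rewrite /c /H /ratio !EFinM.
    set G := F _; rewrite -!muleA; congr (_ * _).
    rewrite [G * _]muleC -!muleA; rewrite muleCA; congr (_ * _).
  transitivity (c%:E * \int[leb2]_u \int[leb2]_z H u z).
    rewrite -ge0_integralZl//; last 2 first.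
    - exact: (measurable_fun_fubini_tonelli_F (fun p : CC * CC => H p.1 p.2)).
    - by move=> u _; apply: integral_ge0 => z _.
    apply: eq_integral => u _; rewrite -ge0_integralZl//.
    exact: (measurable_curry1 (f := H)).
  rewrite kE// muleCA; congr (_ * _).
  by rewrite /weighted /pair_weight /c EFinM -muleA; congr (_ * _); rewrite muleC.
rewrite iintZl//; last 2 first.
- apply: pmeasurable_weighted; last exact: pmeasurable_pair_weight.
  by move=> d U z mz; exact: pmeasurable_diag_power.
- by move=> y; rewrite mule_ge0 ?pair_weight_ge0// lee_fin diag_power_ge0.
rewrite k'E// muleA; congr (_ * _).
rewrite -addn1 iotaD map_cat/= add0n; move: (map e _) => s.
by elim: s (1%R : R) => //= a s ih r; congr (pow_average a _ r); apply/funext.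
Qed.

(** The exponents [t j + 1] exhaust 1 to [m + 1] in some order, so every permutation leads to the
    same beta integral, up to a constant that may depend on [t]. *)
Lemma integral_diag_top m q (t : {perm 'I_m.+1}) : exists2 k : \bar R, 0 <= k &
  forall F x, measurable_fun setT F -> (forall r, 0 <= F r) ->
  iint leb2 (diag_keys m.+1 ++ top_keys m.+1) (weighted
    (diag_power m.+1 (fun j => oapp (fun i => (t i).+1) 0%N (insub j))) (pair_weight F q m.+1)) x =
  k * beta_integral 1 m F.
Proof.
set e := fun j : nat => _.
have [k k0 kE] := integral_pair_keys m.+1 e q.
have [k' k'0 k'E] := pow_averages_iota R 1 m.
exists (k * k') => [|F x mF F0]; first exact: mule_ge0.
rewrite (perm_iint leb2 x (s2 := pair_keys m.+1)) ?perm_pair_keys//; last 2 first.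
- apply: pmeasurable_weighted; last exact: pmeasurable_pair_weight.
  by move=> d U z mz; exact: pmeasurable_diag_power.
- by move=> y; rewrite mule_ge0 ?pair_weight_ge0// lee_fin diag_power_ge0.
rewrite kE// -muleA -k'E//; congr (_ * _); apply: pow_averages_perm => //.
have -> : [seq e j | j <- iota 0 m.+1] = [seq (val i).+1 | i <- [seq t j | j <- enum 'I_m.+1]].
  rewrite -val_enum_ord -!map_comp; apply: eq_map => i /=.
  by rewrite /e valK.
have -> : iota 1 m.+1 = [seq (val i).+1 | i <- enum 'I_m.+1].
  by rewrite map_comp val_enum_ord -(iotaDl 1 0).
apply: perm_map; apply: uniq_perm.
- by rewrite map_inj_uniq ?enum_uniq//; exact: perm_inj.
- exact: enum_uniq.
- by move=> i; rewrite mem_enum; apply/mapP; exists (t^-1%g i); rewrite ?mem_enum// permKV.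
Qed.

End pairs.

(** * Reduction of the triangular density to a beta integral *)

Section schur_integral.
Context (R : realType).
Local Notation C := R[i].
Local Notation CC := (measurableTypeR R * measurableTypeR R)%type.
Local Notation leb2 := (complex_lebesgue R).
Local Notation X := (nat * nat -> CC).
Local Open Scope ereal_scope.
Implicit Types (x y : X) (F : measurableTypeR R -> \bar R).

Lemma eq_vandermonde_weight m y y' : (forall j, (0 < j <= m)%N -> y (j, j) = y' (j, j)) ->
  vandermonde_weight m y = vandermonde_weight m y'.
Proof.
move=> yy'; have triE j : (j <= m)%N -> tri y j j = tri y' j j.
  by case: j => [|j] jm; [rewrite /tri|apply/eq_tri/yy'].
apply: eq_bigr => i _; apply: eq_bigr => j _.
have im : (i <= m)%N by rewrite -ltnS.
have jm : (j <= m)%N by rewrite -ltnS.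
by rewrite (triE i im) (triE j jm).
Qed.

Lemma vandermonde_weight_eq0 m y j : (0 < j <= m)%N -> nrm2 (y (j, j)) = 0%R ->
  vandermonde_weight m y = 0%R.
Proof.
case: j => // j /andP[_ jm] y0; apply: complexI; rewrite vandermonde_weightE.
by rewrite (bigD1 (Ordinal jm))//= normC_pair y0 !mul0r.
Qed.

(** The strictly upper entries are integrated first, for a fixed diagonal. The Vandermonde factor
    depends on the diagonal only and is carried over unchanged to the variables of [top_keys]. *)
Lemma integral_schur m p q : (p + m.+1 = q.+1)%N -> exists2 k : \bar R, 0 <= k &
  forall F x, measurable_fun setT F -> (forall r, 0 <= F r) ->
  iint leb2 (diag_keys m.+1 ++ upper_keys m.+1)
    (weighted (vandermonde_weight m.+1) (upper_weight F p m.+1)) x =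
  k * beta_integral 1 m F.
Proof.
move=> pq; have [k k0 kE] := integral_upper R pq.
(* One constant is selected per permutation, so that they can be summed. *)
pose ct t := s2val (cid2 (@integral_diag_top R m q t)).
have ct0 t : 0 <= ct t by rewrite /ct; case: cid2.
exists (k * \sum_t ct t) => [|F x mF F0].
  by rewrite mule_ge0// sume_ge0.
pose V := vandermonde_weight (R := R) m.+1.
have V0 y : 0 <= (V y)%:E by rewrite lee_fin vandermonde_weight_ge0.
have mW := pmeasurable_pair_weight q m.+1 mF.
have W0 y := pair_weight_ge0 q m.+1 y F0.
have mVW : pmeasurable (weighted V (pair_weight F q m.+1)).
  by apply: pmeasurable_weighted => // d U z mz; exact: pmeasurable_vandermonde_weight.
have VW0 y : 0 <= weighted V (pair_weight F q m.+1) y by exact: mule_ge0.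
transitivity (iint leb2 (diag_keys m.+1) (fun y => k *
    iint leb2 (top_keys m.+1) (weighted V (pair_weight F q m.+1)) y) x).
  rewrite iint_cat; apply: eq_iint => y _.
  transitivity ((V y)%:E * iint leb2 (upper_keys m.+1) (upper_weight F p m.+1) y).
    rewrite -iintZl//; last 2 first.
    - exact: pmeasurable_upper_weight.
    - by move=> z; exact: upper_weight_ge0.
    apply: eq_iint => z zy; rewrite /weighted /V; congr (_%:E * _).
    by apply: eq_vandermonde_weight => j jm; apply: zy; rewrite mem_upper_keys; lia.
  transitivity (k * ((V y)%:E * iint leb2 (top_keys m.+1) (pair_weight F q m.+1) y)); last first.
    congr (_ * _); rewrite -iintZl//.
    apply: eq_iint => z zy; rewrite /weighted /V; congr (_%:E * _).
    by apply: eq_vandermonde_weight => j jm; rewrite zy// mem_top_keys; lia.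
  (* If some eigenvalue on the diagonal vanishes, [integral_upper] does not apply; but it then
     coincides with the eigenvalue 0 of index 0, and the Vandermonde factor makes both sides 0. *)
  have [l0|] := boolP [forall j : 'I_m.+2, (0 < j)%N ==>
      (nrm2 (y (nat_of_ord j, nat_of_ord j)) != 0%R)].
    rewrite kE//; first by rewrite muleCA.
    move=> j /andP[j0 jm]; have jm' : (j < m.+2)%N by [].
    by move/forallP : l0 => /(_ (Ordinal jm'))/implyP; apply.
  rewrite negb_forall => /existsP[j]; rewrite negb_imply negbK => /andP[j0 /eqP l0].
  have -> : V y = 0%R.
    by apply: (vandermonde_weight_eq0 (j := j)) => //; rewrite j0/= -ltnS.
  by rewrite !mul0e mule0.
rewrite iintZl//; last 2 first.
- exact: pmeasurable_iint.
- by move=> y; exact: iint_ge0.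
rewrite -iint_cat -muleA; congr (_ * _).
rewrite integral_vandermonde_weight//; last first.
  by move=> j jm; rewrite mem_cat mem_diag_keys eqxx/= jm.
rewrite ge0_sume_distrl//; apply: eq_bigr => t _.
by rewrite /ct; case: cid2 => /= c c0 ->.
Qed.

End schur_integral.

(** * Law of the conditioned overlap *)

Section density.
Import HBNNSimple.
Local Open Scope ereal_scope.
Context d d' (Omega : measurableType d) (E : measurableType d') (R : realType).
Context (P : probability Omega R) (X : {RV P >-> E}) (mu : {measure set E -> \bar R}).

(** [has_density] speaks of sets only; simple functions and monotone convergence extend it to
    nonnegative functions. *)
Lemma ge0_integral_density (f : E -> R) (g : E -> \bar R) : has_density X mu f ->
  measurable_fun setT f -> (forall x, 0 <= f x)%R ->
  measurable_fun setT g -> (forall x, 0 <= g x) ->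
  \int[P]_w g (X w) = \int[mu]_x (g x * (f x)%:E).
Proof.
move=> fX mf f0 mg g0; set nu := distribution P X.
have mfE : measurable_fun setT (EFin \o f) by exact/measurable_EFinP.
transitivity (\int[nu]_x g x); first by rewrite ge0_integral_distribution.
pose h := nnsfun_approx measurableT mg.
have hg x : (h n x)%:E @[n --> \oo] --> g x by exact: cvg_nnsfun_approx.
have mh n : measurable_fun setT (fun x => (h n x)%:E) by exact/measurable_EFinP.
have h0 n x : 0 <= (h n x)%:E by rewrite lee_fin.
have nd x : {homo (fun n => (h n x)%:E) : a b / (a <= b)%N >-> a <= b}.
  by move=> a b ab; rewrite lee_fin; exact/lefP/nd_nnsfun_approx.
transitivity (limn (fun n => \int[nu]_x (h n x)%:E)).
  rewrite -monotone_convergence//.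
  by apply: eq_integral => x _; apply/esym/cvg_lim; last exact: hg.
transitivity (limn (fun n => \int[mu]_x ((h n x)%:E * (f x)%:E))); last first.
  rewrite -monotone_convergence//.
  - by apply: eq_integral => x _; apply/cvg_lim => //; apply: cvgeZr.
  - by move=> n; exact: emeasurable_funM.
  - by move=> n x _; rewrite mule_ge0// lee_fin.
  - by move=> x _ a b ab; rewrite lee_wpmul2r ?lee_fin//; exact: nd.
congr (limn _); apply/funext => n.
have mpre r : measurable (h n @^-1` [set r]) by exact: measurable_funPTI.
have mind r : measurable_fun setT (fun x => (r * \1_(h n @^-1` [set r]) x)%:E).
  by apply/measurable_EFinP; exact: measurable_funM.
transitivity (\int[nu]_x (\sum_(r \in range (h n)) (r * \1_(h n @^-1` [set r]) x)%:E)).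
  by apply: eq_integral => x _; rewrite /= fimfunE -fsumEFin.
transitivity (\int[mu]_x
    (\sum_(r \in range (h n)) (r * \1_(h n @^-1` [set r]) x)%:E * (f x)%:E)); last first.
  apply: eq_integral => x _; rewrite /= fimfunE -fsumEFin//.
  by rewrite ge0_mule_fsuml// => r; exact: nnfun_muleindic_ge0.
rewrite ge0_integral_fsum//; last by move=> r x _; exact: nnfun_muleindic_ge0.
rewrite ge0_integral_fsum//; last 2 first.
- by move=> r; exact: emeasurable_funM.
- by move=> r x _; rewrite mule_ge0 ?lee_fin// -lee_fin; exact: nnfun_muleindic_ge0.
apply: eq_fsbigr => r rh.
under eq_integral do rewrite EFinM.
rewrite integralZl_indic_nnsfun// integral_indic// setIT.
under eq_integral do rewrite EFinM -muleA.
have r0 : (0 <= r)%R by move/set_mem : rh => -[x _ <-]; rewrite -lee_fin; exact: h0.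
rewrite ge0_integralZl//; last 2 first.
- by apply: emeasurable_funM => //; exact/measurable_EFinP.
- by move=> x _; rewrite mule_ge0// lee_fin.
congr (_ * _); rewrite -[LHS]/(distribution P X _) fX// integral_mkcond.
by apply: eq_integral => x _; rewrite patchE indicE; case: ifP => _; rewrite ?mul1e ?mul0e.
Qed.

End density.

Section free_entries.
Context (R : realType).
Local Notation C := R[i].
Local Notation CC := (measurableTypeR R * measurableTypeR R)%type.
Local Notation leb2 := (complex_lebesgue R).
Local Notation X := (nat * nat -> CC).

Definition entry_key N (e : free_entry N) : nat * nat :=
  (nat_of_ord (val e).1, nat_of_ord (val e).2).

Lemma entry_key_inj N : injective (@entry_key N).
Proof.
by move=> [[i j] ij] [[i' j'] ij'] [/val_inj/= ii /val_inj/= jj]; apply: val_inj; rewrite /= ii jj.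
Qed.

(** The order is that of the tuple, so that [integral_power_measure] applies; the keys are permuted
    afterwards. *)
Definition entry_keys N : seq (nat * nat) := [seq entry_key e | e <- enum {: free_entry N}].

Lemma uniq_entry_keys N : uniq (entry_keys N).
Proof. by rewrite map_inj_uniq ?enum_uniq//; exact: entry_key_inj. Qed.

Lemma size_entry_keys N : size (entry_keys N) = #|{: free_entry N}|.
Proof. by rewrite size_map cardE. Qed.

Lemma mem_entry_keys N i j : ((i, j) \in entry_keys N) = (i <= j < N)%N && (0 < j)%N.
Proof.
apply/mapP/idP => [[[[a b] ab] _ [-> ->]]|ij].
  by move: (ltn_ord b) ab => /=; lia.
have iN : (i < N)%N by lia.
have jN : (j < N)%N by lia.
have P : (Ordinal iN <= Ordinal jN)%N && ~~ ((Ordinal iN == 0 :> nat) && (Ordinal jN == 0 :> nat)).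
  by move: ij => /=; lia.
by exists (exist _ (Ordinal iN, Ordinal jN) P); rewrite ?mem_enum.
Qed.

Lemma uniq_upper_keys m : uniq (upper_keys m).
Proof.
elim: m => [//|m ih]; rewrite [upper_keys _]/= cat_uniq; apply/and3P; split=> //.
  apply/hasPn => -[i j]; rewrite mem_column_keys mem_upper_keys; lia.
by rewrite map_inj_uniq ?iota_uniq// => i j [].
Qed.

Lemma perm_entry_keys m : perm_eq (entry_keys m.+1) (diag_keys m ++ upper_keys m).
Proof.
apply: uniq_perm; first exact: uniq_entry_keys.
  rewrite cat_uniq uniq_upper_keys andbT; apply/andP; split.
    by rewrite map_inj_uniq ?iota_uniq// => i j [].
  by apply/hasPn => -[i j]; rewrite mem_diag_keys mem_upper_keys; lia.
by move=> -[i j]; rewrite mem_cat mem_entry_keys mem_diag_keys mem_upper_keys; lia.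
Qed.

Definition entry_point N (t : free_entries R N) : X := fill (entry_keys N) (fun=> (0, 0) : CC) t.

Lemma entry_pointE N (t : free_entries R N) e : entry_point t (entry_key e) = tnth t (enum_rank e).
Proof.
rewrite /entry_point /fill (tnth_nth ((0, 0) : CC)); congr (nth _ _ _).
rewrite index_map; last exact: entry_key_inj.
rewrite -[in LHS](nth_enum_rank e e) index_uniq ?enum_uniq//.
by rewrite -cardE.
Qed.

Lemma schur_matrixE N (t : free_entries R N) : schur_matrix t = mxn N (tri (entry_point t)).
Proof.
apply/matrixP => i j; rewrite !mxE; case: insubP => [e ije eE|].
  rewrite /tri (_ : entry_point _ _ = tnth t (enum_rank e)); last first.
    by rewrite -entry_pointE /entry_key eE.
  by rewrite ifT//; move: ije => /=; lia.
by move=> /= nij; rewrite /tri ifF//; lia.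
Qed.

Lemma measurable_entry_point N k :
  measurable_fun setT (fun t : free_entries R N => entry_point t k).
Proof. exact: measurable_fill. Qed.

Lemma schur_densityE m M (t : free_entries R m.+1) :
  schur_density M (schur_matrix t) =
  vandermonde_weight m (entry_point t) * gapdens m.+1 (M - m.+1) (entry_point t).
Proof.
rewrite schur_matrixE; set y := entry_point t.
rewrite /schur_density /gapdens /gap mxn_contraction_gap.
set A := 1%:M - _; rewrite (_ : posdef A = posdefmx A)//.
case: asboolP => pA; last by rewrite mulr0.
have hA : hermitian (gap y m.+1) := gap_hermitian y m.+1.
have AE : A = mxn m.+1 (gap y m.+1) by rewrite /gap mxn_contraction_gap.
have pA' : posdef (mxn m.+1 (gap y m.+1)) by rewrite -AE; exact: pA.
have [_ dE] := complex_gt0 (det_mxn_gt0 hA pA'); rewrite -AE in dE.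
rewrite dE -rmorphXn /= (_ : \prod_(i < m.+1) _ = (vandermonde_weight m y)%:C%C).
  by rewrite -rmorphM.
rewrite /vandermonde_weight rmorph_prod; apply: eq_bigr => i _.
by rewrite rmorph_prod; apply: eq_bigr => j _; rewrite !mxE; exact: sqnormE.
Qed.

End free_entries.

Section conditioned_overlap.
Context (R : realType).
Local Notation C := R[i].
Local Notation CC := (measurableTypeR R * measurableTypeR R)%type.
Local Notation leb2 := (complex_lebesgue R).
Local Notation X := (nat * nat -> CC).
Local Open Scope sesquilinear_scope.

(** The value 0 for a multiple spectrum is the default value of [overlap], and the density vanishes
    there. *)
Definition diag_overlap m (y : X) : R :=
  if vandermonde_weight m y == 0 then 0 else ov y m.+1.

Lemma vandermonde_weight_neq0 m (y : X) :
  vandermonde_weight m y != 0 <-> injective (fun i : 'I_m.+1 => mxn m.+1 (tri y) i i).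
Proof.
split=> [V0 i j ij|inj].
  have [//|neq] := eqVneq i j.
  have key (a b : 'I_m.+1) : (a < b)%N -> mxn m.+1 (tri y) a a = mxn m.+1 (tri y) b b -> False.
    move=> ab; rewrite !mxE => E; move: V0.
    rewrite /vandermonde_weight (bigD1 a)//= (bigD1 b)//= E subrr.
    by rewrite [sqnorm 0](_ : _ = 0) ?mul0r ?eqxx//; apply/eqP; rewrite sqnorm_eq0.
  have [ij'|ji|/val_inj ->//] := ltngtP i j.
    by case: (key _ _ ij' ij).
  by case: (key _ _ ji (esym ij)).
apply/prodf_neq0 => i _; apply/prodf_neq0 => j ij.
rewrite sqnorm_eq0 subr_eq0; apply/eqP => E.
have := inj i j; rewrite !mxE => /(_ E) ije.
by rewrite ije ltnn in ij.
Qed.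

Lemma overlap_diag_overlap m (y : X) (G U : 'M[C]_m.+1) : U \is unitarymx ->
  G = U *m mxn m.+1 (tri y) *m U^t* ->
  complex.Re (overlap G (fun i => mxn m.+1 (tri y) i i) ord0 ord0) = diag_overlap m y.
Proof.
move=> hU hG; rewrite /diag_overlap.
case: ifPn => [V0|/vandermonde_weight_neq0 inj].
  rewrite overlap_noninjective//= => inj.
  by have := (vandermonde_weight_neq0 m y).2 inj; rewrite V0.
have upper (i j : 'I_m.+1) : (j < i)%N -> mxn m.+1 (tri y) i j = 0.
  by move=> ji; rewrite mxE /tri leqNgt ji.
pose w : 'rV[C]_m.+1 := \row_j bvec y j.
have l0 j : (0 < j < m.+1)%N -> tri y j j != 0.
  move=> /andP[j0 jm]; apply/eqP => lj0.
  have := inj (Ordinal jm) ord0; rewrite !mxE /= lj0 => /(_ _)/(congr1 val)/= j0E.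
  by rewrite j0E in j0.
have T0 : col 0 (mxn m.+1 (tri y)) = 0.
  by apply/matrixP => i j; rewrite !mxE /tri andbF.
have wT : w *m mxn m.+1 (tri y) = 0.
  apply/matrixP => i j; rewrite !mxE -[RHS](bvec_null l0 (ltn_ord j)).
  by apply: eq_bigr => k _; rewrite !mxE.
have w0 : w 0 0 = 1 by rewrite mxE bvec0.
rewrite (overlap_conj_triangular upper T0 wT w0 hU hG inj).
have -> : (w *m w^t*) 0 0 = (ov y m.+1)%:C%C.
  rewrite mxE /ov rmorph_sum; apply: eq_bigr => j _.
  by rewrite !mxE -normCK; exact: sqnormE.
by [].
Qed.

Lemma measurable_diag_overlap m d (T : measurableType d) (x : T -> X) :
  (forall k, measurable_fun setT (fun u => x u k)) ->
  measurable_fun setT (fun u => diag_overlap m (x u)).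
Proof.
move=> mx; apply: measurable_fun_ifT.
- by apply: measurable_fun_eqr => //; exact: pmeasurable_vandermonde_weight.
- exact: measurable_cst.
- exact: measurable_ov.
Qed.

Local Open Scope ereal_scope.

Lemma conditioned_overlap_law m M d (Omega : measurableType d) (P : probability Omega R)
    (Z : {RV P >-> free_entries R m.+2}) : (m.+2 <= M)%N ->
  has_density_propto Z (power_measure leb2 #|{: free_entry m.+2}|)
    (fun t => schur_density M (schur_matrix t)) ->
  exists k : \bar R, forall F : measurableTypeR R -> \bar R,
    measurable_fun setT F -> (forall r, 0 <= F r) ->
    \int[P]_w F ((diag_overlap m.+1 (entry_point (Z w)))^-1)%R = k * beta_integral 1 m F.
Proof.
move=> mM [c]; set mu := power_measure _ _.
pose f t : R := schur_density M (@schur_matrix R m.+2 t); move=> fZ0.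
have fZ : has_density Z mu (fun t => c * f t)%R by exact: fZ0.
have mp := @measurable_entry_point R m.+2.
have fE t : f t = (vandermonde_weight m.+1 (entry_point t) *
    gapdens m.+2 (M - m.+2) (entry_point t))%R by exact: schur_densityE.
have f0 t : (0 <= f t)%R by rewrite fE mulr_ge0 ?vandermonde_weight_ge0 ?gapdens_ge0.
have mf : measurable_fun setT f.
  rewrite (funext fE); apply: measurable_funM; last exact: measurable_gapdens.
  exact: pmeasurable_vandermonde_weight.
(* The sign of the proportionality constant is not given; a negative one would make the total mass
   nonpositive. *)
have c0 : (0 <= c)%R.
  rewrite leNgt; apply/negP => c0; have := fZ _ measurableT.
  rewrite probability_setT integralE (_ : \int[mu]_t _ = 0); last first.
    apply: integral0_eq => t _; rewrite funeposE.
    by apply/max_idPr; rewrite lee_fin mulr_le0_ge0// ltW.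
  rewrite add0e => E; have := @lte01 R; rewrite E oppe_gt0 ltNge => /negP; apply.
  by apply: integral_ge0 => t _; exact: funeneg_ge0.
(* For matrix size [m + 2], the common power of the pair weights is [M - 2]. *)
have pq : ((M - m.+2) + m.+1 = (M - m.+2 + m).+1)%N by rewrite addnS.
have [k k0 kE] := integral_schur R pq.
exists (c%:E * k) => F mF F0.
have mG : measurable_fun setT (fun t : free_entries R m.+2 =>
    F ((diag_overlap m.+1 (entry_point t))^-1)%R).
  by apply: (measurableT_comp mF); apply: measurable_inv; exact: measurable_diag_overlap.
rewrite (ge0_integral_density fZ _ _ mG)//; last 2 first.
- exact: measurable_funM.
- by move=> t; exact: mulr_ge0.
have mVW : pmeasurable (weighted (vandermonde_weight m.+1)
    (upper_weight (R := R) F (M - m.+2) m.+1)).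
  apply: pmeasurable_weighted; last exact: pmeasurable_upper_weight.
  by move=> d' U x mx; exact: pmeasurable_vandermonde_weight.
have VW0 y : 0 <= weighted (vandermonde_weight m.+1) (upper_weight (R := R) F (M - m.+2) m.+1) y.
  by rewrite mule_ge0 ?upper_weight_ge0// lee_fin vandermonde_weight_ge0.
rewrite -muleA -(kE F (fun=> (0, 0)%R) mF F0).
rewrite -(perm_iint leb2 _ mVW VW0 (perm_entry_keys m.+1)).
rewrite -(integral_power_measure leb2 _ (uniq_entry_keys m.+2) (size_entry_keys m.+2) mVW VW0).
rewrite -ge0_integralZl//; last by apply: mVW => l; exact: mp.
apply: eq_integral => t _; rewrite fE /weighted /upper_weight /diag_overlap.
rewrite -/(entry_point t).
have [->|V0] := eqVneq (vandermonde_weight m.+1 (entry_point t)) 0%R.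
  by rewrite mul0r mulr0 mul0e !mule0.
by rewrite !EFinM !muleA [F _ * _]muleC -!muleA; congr (_ * _); rewrite muleCA; congr (_ * _).
Qed.

End conditioned_overlap.

(** * The limit *)

Section beta_limit.
Context (R : realType).
Local Notation leb := (@lebesgue_measure R).
Local Notation RR := (measurableTypeR R).

(** With [N = n + 2] the matrix size, this is [N] times the weight [u (1 - u)^n] at [u = t / N]. *)
Definition beta_kernel (n : nat) (t : R) : R :=
  ((0 < t) && (t < n.+2%:R))%:R * (t * (1 - t / n.+2%:R) ^+ n).

Lemma beta_kernel_ge0 n t : 0 <= beta_kernel n t.
Proof.
rewrite /beta_kernel; have [/andP[t0 tn]|] := boolP (_ && _); last by rewrite mul0r.
by rewrite mul1r mulr_ge0 ?(ltW t0)// exprn_ge0// subr_ge0 ler_pdivrMr// mul1r ltW.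
Qed.

Lemma measurable_beta_kernel n : measurable_fun setT (beta_kernel n : RR -> RR).
Proof. rewrite /beta_kernel; msolve. Qed.

Lemma measurable_gamma2_pdf : measurable_fun setT (@gamma2_pdf R : RR -> RR).
Proof.
rewrite /gamma2_pdf; apply: measurable_if_lt => //.
by apply: measurable_funM => //; apply: (measurableT_comp (@measurable_expR R)); msolve.
Qed.

Lemma gamma2_pdf_ge0 (t : R) : 0 <= gamma2_pdf t.
Proof. by rewrite /gamma2_pdf; case: ltP => // t0; rewrite mulr_ge0 ?expR_ge0// ltW. Qed.

Lemma expr_onem_le (x : R) n : x <= 1 -> (1 - x) ^+ n <= expR (- (n%:R * x)).
Proof.
move=> x1; rewrite -mulrN expRM_natl; apply: lerXn2r; rewrite ?nnegrE ?expR_ge0 ?subr_ge0//.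
exact: expR_ge1Dx.
Qed.

(** The inverse of [1 - x] is [1 + x / (1 - x)], which is at most the exponential of
    [x / (1 - x)]. *)
Lemma expr_onem_ge (x : R) n : x < 1 -> expR (- (n%:R * (x / (1 - x)))) <= (1 - x) ^+ n.
Proof.
move=> x1; have y0 : 0 < 1 - x by rewrite subr_gt0.
rewrite -mulrN expRM_natl; apply: lerXn2r; rewrite ?nnegrE ?expR_ge0 ?(ltW y0)//.
rewrite -[leRHS]invrK expRN lef_pV2 ?posrE ?expR_gt0 ?invr_gt0//.
apply: le_trans (expR_ge1Dx _); rewrite le_eqVlt; apply/orP; left; apply/eqP.
field; exact: lt0r_neq0.
Qed.

(** The exponent [n t / N] equals [t - 2 t / N], and [t < N] on the support: at most a factor
    [expR 2] is lost. *)
Lemma beta_kernel_le n t : beta_kernel n t <= expR 2 * gamma2_pdf t.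
Proof.
rewrite /beta_kernel; have [/andP[t0 tn]|_] := boolP (_ && _); last first.
  by rewrite mul0r mulr_ge0 ?expR_ge0 ?gamma2_pdf_ge0.
have N0 : 0 < n.+2%:R :> R by rewrite ltr0n.
rewrite mul1r /gamma2_pdf t0 mulrCA ler_pM2l// -expRD.
apply: (le_trans (expr_onem_le _ _)); first by rewrite ler_pdivrMr// mul1r ltW.
rewrite ler_expR -subr_ge0 (_ : _ - _ = (2 / n.+2%:R) * (n.+2%:R - t)); last first.
  have E : n.+2%:R = n%:R + 2 :> R by rewrite -natrD addn2.
  by move: N0; rewrite E => N0; field; rewrite gt_eqF.
by rewrite mulr_ge0 ?divr_ge0// ?ler0n// subr_ge0 ltW.
Qed.

Lemma cvg_beta_kernel t : beta_kernel n t @[n --> \oo] --> gamma2_pdf t.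
Proof.
rewrite /gamma2_pdf; case: ifPn => [t0|/negbTE t0]; last first.
  by under eq_fun do rewrite /beta_kernel t0 mul0r; exact: cvg_cst.
have h0 : (n.+2%:R^-1 : R) @[n --> \oo] --> (0 : R).
  have := @cvg_harmonic R; rewrite -(cvg_shiftS (harmonic : R^nat)); exact.
have th0 : t / n.+2%:R @[n --> \oo] --> (0 : R).
  by rewrite -(mulr0 t); apply: cvgMr.
have n2 n : n%:R * (t / n.+2%:R) = t - 2 * t * n.+2%:R^-1.
  have E : n.+2%:R = n%:R + 2 :> R by rewrite -natrD addn2.
  rewrite E; field; rewrite -E; exact/lt0r_neq0/ltr0Sn.
have up : n%:R * (t / n.+2%:R) @[n --> \oo] --> t.
  under eq_fun do rewrite n2.
  have : t - 2 * t * n.+2%:R^-1 @[n --> \oo] --> t - 2 * t * 0.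
    by apply: cvgB; [exact: cvg_cst|exact: cvgMr].
  by rewrite mulr0 subr0.
have lo : n%:R * (t / n.+2%:R / (1 - t / n.+2%:R)) @[n --> \oo] --> t.
  under eq_fun do rewrite mulrA.
  have : n%:R * (t / n.+2%:R) / (1 - t / n.+2%:R) @[n --> \oo] --> t / (1 - 0).
    apply: cvgM => //; apply: cvgV; first by rewrite subr0 oner_neq0.
    by apply: cvgB => //; exact: cvg_cst.
  by rewrite subr0 divr1.
have cexp (u : R^nat) : u @ \oo --> t -> expR (- u n) @[n --> \oo] --> expR (- t).
  move=> ut; have nut : - u n @[n --> \oo] --> - t by exact: cvgN.
  exact: (cvg_comp _ _ nut (@continuous_expR R (- t))).
have near1 : \forall n \near \oo, t / n.+2%:R < 1.
  by apply: (cvgr_lt 0) => //.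
apply: (@squeeze_cvgr _ _ _ _
  (fun n => t * expR (- (n%:R * (t / n.+2%:R / (1 - t / n.+2%:R)))))
  (fun n => t * expR (- (n%:R * (t / n.+2%:R))))).
- near=> n; have tn : t / n.+2%:R < 1 by near: n.
  have N0 : 0 < n.+2%:R :> R by rewrite ltr0n.
  rewrite /beta_kernel t0 (_ : t < n.+2%:R)/=; last by move: tn; rewrite ltr_pdivrMr// mul1r.
  by rewrite mul1r !ler_pM2l// expr_onem_ge// expr_onem_le// ltW.
- by apply: cvgMr; exact: (cexp (fun n => n%:R * (t / n.+2%:R / (1 - t / n.+2%:R)))).
- by apply: cvgMr; exact: (cexp (fun n => n%:R * (t / n.+2%:R))).
Unshelve. all: by end_near. Qed.

Local Open Scope ereal_scope.

(** Substitution [t = N u]: one factor [N] is the Jacobian, the other comes from the factor [u] of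
    the weight. *)
Lemma beta_integral_kernel n (F : RR -> \bar R) :
  measurable_fun setT F -> (forall r, 0 <= F r) ->
  (n.+2%:R ^+ 2)%:E * beta_integral 1 n (fun u => F (n.+2%:R * (u : R))%R) =
  \int[leb]_t ((beta_kernel n t)%:E * F t).
Proof.
move=> mF F0; have N0 : (0 < n.+2%:R :> R)%R by rewrite ltr0n.
have mG : measurable_fun setT (fun t : RR => (beta_kernel n t)%:E * F t).
  by apply: emeasurable_funM => //; apply/measurable_EFinP; exact: measurable_beta_kernel.
have G0 t : 0 <= (beta_kernel n t)%:E * F t by rewrite mule_ge0// lee_fin beta_kernel_ge0.
have := ge0_integral_affine 0%R N0 mG G0.
move=> /(congr1 (fun a => n.+2%:R%:E * a)); rewrite muleA -EFinM mulfV ?gt_eqF// mul1e => <-.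
rewrite expr2 EFinM -muleA; congr (_ * _); rewrite /beta_integral -ge0_integralZl//.
- apply: eq_integral => u _; rewrite addr0 muleA -EFinM; congr (_%:E * _).
  rewrite /beta_kernel pmulr_rgt0// (_ : (n.+2%:R * u < n.+2%:R) = (u < 1))%R; last first.
    by rewrite -[RHS](ltr_pM2l N0) mulr1.
  have -> : (n.+2%:R * u / n.+2%:R = u)%R by rewrite mulrAC mulfV ?gt_eqF// mul1r.
  by rewrite expr1 mulrCA !mulrA.
- apply: emeasurable_funM; first by apply/measurable_EFinP; msolve.
  by apply: (measurableT_comp mF); msolve.
- move=> u _; rewrite mule_ge0// lee_fin.
  have [/andP[u0 u1]|_] := boolP (0 < (u : R) < 1)%R; last by rewrite mul0r.
  by rewrite mul1r expr1 mulr_ge0 ?exprn_ge0 ?subr_ge0// ltW.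
Qed.

(** It makes the dominating function integrable. In the theorem it follows from the presence of a
    random variable with this density. *)
Hypothesis gamma2_total : \int[leb]_t (@gamma2_pdf R t)%:E = 1.

Lemma cvg_beta_kernel_integral (g : RR -> R) (B : R) : measurable_fun setT g ->
  (forall t, 0 <= g t <= B)%R ->
  \int[leb]_t ((beta_kernel n t)%:E * (g t)%:E) @[n --> \oo] -->
  \int[leb]_t ((gamma2_pdf t)%:E * (g t)%:E).
Proof.
move=> mg gB; have B0 : (0 <= B)%R by have /andP[] := gB 0%R; exact: le_trans.
have mpdf : measurable_fun setT (fun t : RR => (@gamma2_pdf R t)%:E).
  by apply/measurable_EFinP; exact: measurable_gamma2_pdf.
apply: (@dominated_cvg _ _ _ leb setT measurableT _ _
  (fun t : RR => (expR 2 * B)%:E * (gamma2_pdf t)%:E)) => //.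
- move=> n; apply: emeasurable_funM; apply/measurable_EFinP => //; exact: measurable_beta_kernel.
- move=> t _; under eq_fun do rewrite -EFinM; rewrite -EFinM; apply: cvg_EFin.
    by apply: nearW.
  by apply: cvgMl; exact: cvg_beta_kernel.
- apply: integrableZl => //; apply/integrableP; split => //.
  under eq_integral do rewrite gee0_abs ?lee_fin ?gamma2_pdf_ge0//.
  by rewrite gamma2_total ltry.
- move=> n t _; have /andP[g0 gb] := gB t.
  rewrite -!EFinM abse_EFin lee_fin normrM !ger0_norm ?beta_kernel_ge0//.
  rewrite [leRHS]mulrAC; apply: ler_pM => //; [exact: beta_kernel_ge0|exact: beta_kernel_le].
Qed.

End beta_limit.

(** An infinite factor gives an infinite product, or 0 against 0, but not 1. *)
Lemma mule_eq1 (R : realFieldType) (a b : \bar R) : (1 = a * b)%E ->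
  exists2 r : R, r != 0 & a = (r^-1)%:E /\ b = r%:E.
Proof.
have infty c : (c * +oo)%E <> 1%E :> \bar R.
  case: c => [c| |] //; rewrite mulry; case: sgrP => _; rewrite ?mul0e ?mul1e ?mulN1e//.
  by move=> [/eqP]; rewrite eq_sym oner_eq0.
case: b => [b| |] ab.
- have b0 : b != 0.
    apply/eqP => b0; move: ab; rewrite b0 mule0 => -[/eqP]; by rewrite oner_eq0.
  exists b => //; split=> //.
  by rewrite -[a]mule1 -[1%E](_ : b%:E * (b^-1)%:E = 1)%E ?muleA -?ab ?mul1e// -EFinM mulfV.
- by case: (infty a).
- by case: (infty (- a)%E); rewrite mulNe -muleN.
Qed.

Section expectation_shift.
Local Open Scope ereal_scope.

(** Adding a bound of [f] makes the integrand nonnegative, as the laws established above require. *)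
Lemma expectation_comp_shift d (Omega : measurableType d) (R : realType)
    (P : probability Omega R) (Y : Omega -> R) (f : R -> R) (B : R) :
  measurable_fun setT Y -> measurable_fun setT (f : measurableTypeR R -> measurableTypeR R) ->
  (forall t, `|f t| <= B)%R ->
  'E_P[f \o Y] = \int[P]_w (f (Y w) + B)%:E - B%:E.
Proof.
move=> mY mf fB; have mfY : measurable_fun setT (fun w => f (Y w)).
  exact: (measurableT_comp mf mY).
have PB : \int[P]_w B%:E = B%:E.
  have := integral_cst P measurableT B%:E.
  by rewrite [X in _ * X](@probability_setT _ _ _ P) mule1.
have intB (a : Omega -> R) : measurable_fun setT a -> (forall w, `|a w| <= B + B)%R ->
    P.-integrable setT (EFin \o a).
  move=> ma aB; apply: measurable_bounded_integrable => //.
    by rewrite (le_lt_trans (probability_le1 _ _))// ltry.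
  by exists (B + B)%R; split; [exact: num_real|move=> M BM w _; exact: le_trans (aB w) (ltW BM)].
have B0 : (0 <= B)%R := le_trans (normr_ge0 _) (fB 0%R).
rewrite unlock -[X in _ - X]PB -integralB//.
- by apply: eq_integral => w _; rewrite -EFinB addrK.
- apply: (intB (fun w => f (Y w) + B)%R) => [|w]; first exact: measurable_funD.
  by rewrite (le_trans (ler_normD _ _))// lerD// ger0_norm.
- by apply: (intB (fun=> B)) => // w; rewrite ger0_norm// lerDl.
Qed.

End expectation_shift.

Local Open Scope sesquilinear_scope.

(* The matrix size N >= 2 is n.+2, and lambda_1 has index ord0. *)
Theorem proposition3p7 (R : realType) (M : nat -> nat)
  (hM : forall N : nat, (2 <= N)%N -> (N <= M N)%N)
  (d : nat -> measure_display) (Omega : forall n : nat, measurableType (d n))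
  (P : forall n : nat, probability (Omega n) R)
  (G U T : forall n : nat, Omega n -> 'M[R[i]]_n.+2)
  (hU : forall (n : nat) (w : Omega n), U n w \is unitarymx)
  (hG : forall (n : nat) (w : Omega n),
      G n w = U n w *m T n w *m (U n w)^t*)
  (hT : forall n : nat, conditioned_schur_law (M n.+2) (P n) (T n))
  (d' : measure_display) (Omega' : measurableType d') (Q : probability Omega' R)
  (gamma2 : {RV Q >-> measurableTypeR R})
  (hgamma2 : has_density gamma2 lebesgue_measure (@gamma2_pdf R)) :
  cvg_in_distribution P
    (fun (n : nat) (w : Omega n) =>
       complex.Re (overlap (G n w) (fun i => T n w i i) ord0 ord0) / n.+2%:R)
    Q (fun w : Omega' => (gamma2 w : R)^-1).
Proof.
pose Z n := projT1 (cid (hT n)).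
have TZ n w : T n w = mxn n.+2 (tri (entry_point (Z n w))).
  by rewrite -schur_matrixE /Z; case: cid => /= X [].
have lawZ n : has_density_propto (Z n) (power_measure (complex_lebesgue R) #|{: free_entry n.+2}|)
    (fun t => schur_density (M n.+2) (schur_matrix t)).
  by rewrite /Z; case: cid => /= X [].
pose D n (w : Omega n) := diag_overlap n.+1 (entry_point (Z n w)).
have XE n : (fun w => complex.Re (overlap (G n w) (fun i => T n w i i) ord0 ord0) / n.+2%:R) =
    (fun w => D n w / n.+2%:R).
  apply/funext => w; rewrite TZ; congr (_ / _).
  by apply: (overlap_diag_overlap (hU n w)); rewrite hG TZ.
have mD n : measurable_fun setT (D n).
  apply: measurable_diag_overlap => k.
  exact: (measurableT_comp (@measurable_entry_point R n.+2 k)).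
have mX n : measurable_fun setT (fun w => D n w / n.+2%:R).
  by apply: measurable_funM => //; exact: mD.
have mg : measurable_fun setT (fun w => (gamma2 w : R)^-1).
  exact: (measurable_inv (measurable_funPT gamma2)).
split=> // [n|f fc fb]; first by rewrite XE.
have mf := continuous_measurable_fun fc.
have [B fB] : exists B : R, forall t : R, `|f t| <= B.
  have [B [_ fB]] := fb; exists (B + 1) => t; by apply: fB => //; rewrite ltrDl.
have gamma2_total : (\int[lebesgue_measure]_t (@gamma2_pdf R t)%:E = 1)%E.
  have := hgamma2 setT measurableT.
  by rewrite probability_setT.
under eq_fun do rewrite XE (expectation_comp_shift _ (mX _) mf fB).
rewrite (expectation_comp_shift _ mg mf fB).
apply: cvgeB; [by rewrite fin_num_adde_defl| |exact: cvg_cst].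
(* The variable [t] stands for N/O, hence the inverse; the shift by [B] makes the test function
   nonnegative. *)
pose h (t : measurableTypeR R) : R := f t^-1 + B.
have h0 t : 0 <= h t by have := fB t^-1; rewrite ler_norml -subr_ge0 opprK => /andP[].
have hB t : 0 <= h t <= B + B.
  by rewrite h0 lerD2r; exact: le_trans (ler_norm _) (fB _).
have mh : measurable_fun setT h.
  by apply: measurable_funD => //; apply: (measurableT_comp mf); apply: measurable_inv.
have mhE : measurable_fun setT (EFin \o h) by exact/measurable_EFinP.
have -> : (\int[Q]_w (f (gamma2 w : R)^-1 + B)%:E =
    \int[lebesgue_measure]_t ((gamma2_pdf t)%:E * (h t)%:E))%E.
  rewrite -[LHS]/(\int[Q]_w ((EFin \o h) (gamma2 w)))%E.
  rewrite (ge0_integral_density hgamma2 (@measurable_gamma2_pdf R) (@gamma2_pdf_ge0 R) mhE)//.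
  by apply: eq_integral => t _; rewrite muleC.
pose A (g : measurableTypeR R -> R) n :=
  (\int[lebesgue_measure]_t ((beta_kernel n t)%:E * (g t)%:E))%E.
have Ah : A h n @[n --> \oo] --> (\int[lebesgue_measure]_t ((gamma2_pdf t)%:E * (h t)%:E))%E.
  exact: (cvg_beta_kernel_integral gamma2_total mh hB).
(* The unnormalized total masses tend to 1, so the limit is not changed by dividing by them. *)
have A1 : A (cst 1) n @[n --> \oo] --> 1%E.
  have -> : 1%E = (\int[lebesgue_measure]_t ((@gamma2_pdf R t)%:E * (cst 1 t)%:E))%E.
    by apply: (eq_trans (esym gamma2_total)); apply: eq_integral => t _; exact: (esym (mule1 _)).
  by apply: (cvg_beta_kernel_integral gamma2_total (B := 1)) => // t; rewrite ler01/=.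
have ratioE n : A (cst 1) n \is a fin_num /\ (\int[P n]_w (f (D n w / n.+2%:R) + B)%:E =
    A h n * (fine (A (cst 1) n))^-1%:E)%E.
  have nM : (n.+2 <= M n.+2)%N by exact: hM.
  have [k kE] := conditioned_overlap_law nM (lawZ n).
  have N0 : 0 < n.+2%:R ^+ 2 :> R by rewrite exprn_gt0// ltr0n.
  have AE (g : measurableTypeR R -> R) : measurable_fun setT g -> (forall t, 0 <= g t) ->
      A g n = ((n.+2%:R ^+ 2)%:E * beta_integral 1 n (fun u => (g (n.+2%:R * (u : R)))%:E))%E.
    by move=> mg' g0; rewrite (beta_integral_kernel n (F := EFin \o g))//; exact/measurable_EFinP.
  have kh : (\int[P n]_w (f (D n w / n.+2%:R) + B)%:E =
      k * beta_integral 1 n (fun u => (h (n.+2%:R * (u : R)))%:E))%E.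
    rewrite -kE; last 2 first.
    - by apply/measurable_EFinP; apply: (measurableT_comp mh); apply: measurable_funM.
    - by move=> r; rewrite lee_fin.
    by apply: eq_integral => w _; rewrite /h invfM invrK mulrC.
  have k1 : (1 = k * beta_integral 1 n (cst 1))%E.
    rewrite -(kE (cst 1%E) (measurable_cst _) (fun=> lee01)).
    have := integral_cst (P n) measurableT 1%E.
    by rewrite [X in (_ * X)%E](@probability_setT _ _ _ (P n)) mul1e => E1; exact: (esym E1).
  (* The total mass of [P n] determines [k] as the inverse of the beta integral of 1; the factors
     [N^2] then cancel in the quotient. *)
  have [r r0 [kr bE]] := mule_eq1 k1.
  have A1E : A (cst 1) n = ((n.+2%:R ^+ 2)%:E * r%:E)%E by rewrite AE// -bE.
  rewrite A1E kh kr AE//; split => //=.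
  by rewrite [RHS]muleAC -EFinM invfM mulrA mulfV ?mul1r ?gt_eqF.
under eq_fun do rewrite (ratioE _).2.
set I := (\int[lebesgue_measure]_t _)%E in Ah *.
suff : (A h n * (fine (A (cst 1) n))^-1%:E)%E @[n --> \oo] --> (I * 1)%E by rewrite mule1.
apply: cvgeM => //.
- by rewrite mule_defE onee_eq0 abse1 andbF.
- apply: cvg_EFin; first by apply: nearW.
  have /fine_cvgP[_ f1] := A1.
  suff : (fine (A (cst 1) n))^-1 @[n --> \oo] --> (1 : R)^-1 by rewrite invr1.
  by apply: cvgV; [exact: oner_neq0|exact: f1].
Qed.
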